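(* Let $\Theta$ be a positive real random variable on $(\Omega,\Sigma,P)$, $D\in\mathfrak B(\mathbb R)$ with $\Theta(\Omega)\subseteq D$, $h:D\to\mathbb R$ Borel, $N$ a $P$-eMRP$(\mathbf K(h(\Theta)))$, and $\{P_\theta\}_{\theta\in D}$ a disintegration of $P$ over $P_\Theta$ consistent with $\Theta$ such that $N$, $h$, $\{P_\theta\}_{\theta\in D}$ satisfy Standing Assumption A (with null set $L_h$ and function $p_h$). Suppose there is a $P_\Theta$-null set $L_0\in\mathfrak B(D)$ such that $h$ restricted to $D\setminus L_0$ is injective. Put $O_h:=L_0\cup L_h$, define $\widehat\Theta:=p_h\circ\Theta$ on $\Theta^{-1}(D\setminus O_h)$ and extend it arbitrarily to a measurable real function on $\Omega$ (still denoted $\widehat\Theta$). For $A\in\Sigma$ put $Q_{\hat\theta}(A):=P_{p_h^{-1}(\hat\theta)}(A)$ if $\hat\theta\in p_h(D\setminus O_h)$ and $Q_{\hat\theta}(A):=P(A)$ otherwise. Then $\{Q_{\hat\theta}\}_{\hat\theta\in\mathbb R}$ is a disintegration of $P$ over $P_{\widehat\Theta}$ consistent with $\widehat\Theta$, and the following are equivalent: (i) $N$ is a $P$-MPP$(\widehat\Theta)$; (ii) $N$ is a $P$-MPP$(\{Q_{\hat\theta}\}_{\hat\theta\in\mathbb R},P_{\widehat\Theta})$; (iii) $N$ is a $Q_{\hat\theta}$-PP$(\hat\theta)$ for $P_{\widehat\Theta}$-almost all $\hat\theta\in\mathbb R$; (iv) $N$ is a $P$-MPP$(P_{\widehat\T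heta})$.
   Context: Counting process: a family $N=\{N_t\}_{t\in[0,\infty)}$ of measurable maps into $\overline{\mathbb R}$ whose paths take values in $\mathbb N_0\cup\{\infty\}$, are right-continuous, have jumps of size at most one, vanish at $0$ and increase to $\infty$; $T_0=0$, $T_n=\inf\{t:N_t\ge n\}$, $W_n=T_n-T_{n-1}$. $\mathbf P(\lambda)$ Poisson law, $\mathbf{Exp}(\lambda)$ exponential law with density $\lambda e^{-\lambda t}$; $Q$-PP$(\theta)$ means Poisson process with rate $\theta$ under $Q$. $P_{X|\Theta}$: conditional distribution of $X$ given $\sigma(\Theta)$; conditional independence given $\Theta$ means factorization of $P(\bigcap_j\{X_{i_j}\le x_j\}\mid\sigma(\Theta))$ a.s. $P$-MPP$(\Theta)$ (for $P_\Theta((0,\infty))=1$): $N$ has $P$-conditionally (given $\Theta$) independent and conditionally stationary increments (increment vectors over $t_0<\dots<t_m$ and over the shifted times $t_j+h$ have the same conditional law given $\sigma(\Theta)$), and $P_{N_t|\Theta}=\mathbf P(\Theta t)$ a.s. for each $t>0$. $P$-MPP$(\{P_{\tilde y}\}_{\tilde y\in\tilde\Upsilon},\nu)$: $\{P_{\tilde y}\}$ probability measures on $\Sigma$, $\nu$ a probability measure on the $\sigma$-algebra generated by $\tilde y\mapsto P_{\tilde y}(E)$, $E\in\Sigma$; for some positive measurable $\alpha$ and $\nu$-a.a. $\tilde y$, $W$ is $P_{\tilde y}$-independent with $(P_{\tilde y})_{W_n}=\mathbf{Exp}(\alpha(\tilde y))$; and $P(\bigcap_{k=1}^r\{W_k\le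 w_k\})=\int\prod_{k=1}^rP_{\tilde y}(\{W_k\le w_k\})\nu(d\tilde y)$ for all $r$ and $w_k>0$. $P$-MPP$(U)$: $P(\bigcap_{j=1}^m\{N_{t_j}-N_{t_{j-1}}=\kappa_j\})=\int_{(0,\infty)}\prod_{j=1}^me^{-\theta(t_j-t_{j-1})}\frac{(\theta(t_j-t_{j-1}))^{\kappa_j}}{\kappa_j!}U(d\theta)$ for all $0=t_0<\dots<t_m$, $\kappa_j\in\mathbb N_0$. Disintegration of $P$ over a probability $Q$ on $\mathfrak B(D)$: probabilities $\{P_\theta\}$ on $\Sigma$ with $\theta\mapsto P_\theta(E)$ measurable and $\int P_\theta(E)Q(d\theta)=P(E)$; consistent with $\Theta$ (where $P_\Theta=Q$) if for each Borel $B$, $P_\theta(\Theta^{-1}(B))=1$ for $Q$-a.e. $\theta\in B$. $P$-eMRP$(\mathbf K(h(\Theta)))$: $\{\mathbf K(s)\}$ a measurably parametrized family of distributions on $\mathfrak B(\mathbb R)$; $W$ is $P$-conditionally independent given $\Theta$ and $P_{W_n|\Theta}=\mathbf K(h(\Theta))$ for all $n$. Standing Assumption A (for $N$, $h$, $\{P_\theta\}_{\theta\in D}$): with $F_{h(\theta)}(t):=P_\theta(\{W_n\le t\})$ (independent of $n$, since $(P_\theta)_{W_n}=\mathbf K(h(\theta))$ for all $n$, $\theta\in D$), there is a $P_\Theta$-null set $L_h\in\mathfrak B(D)$ such that for $\theta\in D\setminus L_h$: $F_{h(\theta)}$ is continuously differentiable on $(0,\infty)$, $0<F'_{h(\theta)}(t)<C(h(\theta))$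 for all $t>0$ for some $C\in\mathcal L^1(P_{h(\Theta)})$, and $p_h(\theta):=\lim_{t\to0}F'_{h(\theta)}(t)$ defines a positive injective function on $D\setminus L_h$. *)

(* Defs.v *)
From HB Require Import structures.
From mathcomp Require Import all_boot all_order all_algebra.
From mathcomp Require Import all_classical all_reals all_analysis.
From mathcomp Require Import measurable_realfun.
From mathcomp Require Import exponential_distribution.

Set Implicit Arguments.
Unset Strict Implicit.
Unset Printing Implicit Defensive.

Import Order.TTheory GRing.Theory Num.Theory.
Import numFieldNormedType.Exports.

Local Open Scope classical_set_scope.
Local Open Scope ring_scope.

Section Defs.
Context {R : realType} {d : measure_display} {Om : measurableType d}.

(* N = {N_t}_{t in [0,oo)}; only the values at t >= 0 are relevant. *)
Definition CountingProcess (N : R -> Om -> \bar R) : Prop :=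
  (forall t, 0 <= t -> measurable_fun [set: Om] (N t)) /\
  forall w : Om,
    (forall t, 0 <= t -> (exists n : nat, N t w = (n%:R)%:E) \/ N t w = +oo%E) /\
    (forall t, 0 <= t -> (N^~ w) x @[x --> t^'+] --> N t w) /\
    (* jumps of size at most one: N_t <= N_{t-} + 1 (N_{t-} = sup_{s<t} N_s) *)
    (forall t : R, 0 < t ->
        (N t w <= ereal_sup [set N s w | s in [set s | (0 <= s < t)%R]] + 1)%E) /\
    N 0 w = 0%E /\
    (forall s t, 0 <= s -> s <= t -> (N s w <= N t w)%E) /\
    (forall M : R, exists t, 0 <= t /\ (M%:E <= N t w)%E).

Definition arrT (N : R -> Om -> \bar R) (n : nat) (w : Om) : R :=
  inf [set t : R | 0 <= t /\ ((n%:R)%:E <= N t w)%E].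

(* W_n = T_n - T_{n-1}, used for n >= 1 *)
Definition interW (N : R -> Om -> \bar R) (n : nat) (w : Om) : R :=
  arrT N n w - arrT N n.-1 w.

Definition sigma_meas (Th : Om -> R) (g : Om -> R) : Prop :=
  forall U : set R, measurable U ->
    exists B : set R, measurable B /\ g @^-1` U = Th @^-1` B.

Definition cond_prob_version (P : probability Om R) (Th : Om -> R)
    (A : set Om) (g : Om -> R) : Prop :=
  sigma_meas Th g /\ P.-integrable setT (EFin \o g) /\
  forall C : set R, measurable C ->
    (\int[P]_(w in Th @^-1` C) (g w)%:E = P (A `&` Th @^-1` C))%E.

Definition cond_law {d' : measure_display} {T' : measurableType d'}
    (P : probability Om R) (Th : Om -> R) (X : Om -> T')
    (L : Om -> set T' -> \bar R) : Prop :=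
  forall B : set T', measurable B ->
    cond_prob_version P Th (X @^-1` B) (fun w => fine (L w B)).

(* conditional independence given Th of the family {X_i}_{i in Idx},
   where Ev i x = {X_i <= x}: factorization of
   P(\bigcap_j {X_{i_j} <= x_j} | sigma(Th)) a.s. for distinct indices *)
Definition cond_indep (P : probability Om R) (Th : Om -> R)
    (Idx : nat -> Prop) (Ev : nat -> R -> set Om) : Prop :=
  forall (s : seq nat) (x : nat -> R) (g : Om -> R) (gs : nat -> Om -> R),
    uniq s -> (forall i, i \in s -> Idx i) ->
    cond_prob_version P Th (\bigcap_(i in [set i | i \in s]) Ev i (x i)) g ->
    (forall i, i \in s -> cond_prob_version P Th (Ev i (x i)) (gs i)) ->
    {ae P, forall w, g w = \prod_(i <- s) gs i w}.

(* (unconditional) independence under Q of {X_i}_{i in Idx}, Ev i x = {X_i <= x} *)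
Definition indep (Q : probability Om R)
    (Idx : nat -> Prop) (Ev : nat -> R -> set Om) : Prop :=
  forall (s : seq nat) (x : nat -> R),
    uniq s -> (forall i, i \in s -> Idx i) ->
    Q (\bigcap_(i in [set i | i \in s]) Ev i (x i))
      = (\prod_(i <- s) fine (Q (Ev i (x i))))%:E.

Definition inc_times (m : nat) (t : nat -> R) : Prop :=
  (1 <= m)%N /\ t 0%N = 0 /\ forall j, (j < m)%N -> t j < t j.+1.

Definition incr (N : R -> Om -> \bar R) (t : nat -> R) (j : nat) (w : Om)
  : \bar R := (N (t j) w - N (t j.-1) w)%E.

Definition jrange (m : nat) : nat -> Prop := fun j => (1 <= j <= m)%N.

Definition poisL (lam : R) (B : set (\bar R)) : \bar R :=
  (\sum_(0 <= k <oo)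
     ((\1_B ((k%:R)%:E) : R) * (expR (- lam) * lam ^+ k / (k`!)%:R))%:E)%E.

Definition MPP (P : probability Om R) (N : R -> Om -> \bar R) (Th : Om -> R)
  : Prop :=
  pushforward P Th [set th0 : R | (0 < th0)%R] = 1%E /\
  (forall m t, inc_times m t ->
     cond_indep P Th (jrange m) (fun j x => [set w | (incr N t j w <= x%:E)%E])) /\
  (forall m t (hh : R) (B : nat -> set (\bar R)) (g g' : Om -> R),
     inc_times m t -> 0 < hh -> (forall j, measurable (B j)) ->
     cond_prob_version P Th
       (\bigcap_(j in jrange m) [set w | B j (incr N t j w)]) g ->
     cond_prob_version P Th
       (\bigcap_(j in jrange m) [set w | B j (incr N (fun i => t i + hh) j w)]) g' ->
     {ae P, forall w, g w = g' w}) /\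
  (forall t, 0 < t -> cond_law P Th (N t) (fun w => poisL (Th w * t))).

Definition PP (Q : probability Om R) (N : R -> Om -> \bar R) (th : R) : Prop :=
  (forall m t, inc_times m t ->
     indep Q (jrange m) (fun j x => [set w | (incr N t j w <= x%:E)%E])) /\
  (forall m t (hh : R) (B : nat -> set (\bar R)),
     inc_times m t -> 0 < hh -> (forall j, measurable (B j)) ->
     Q (\bigcap_(j in jrange m) [set w | B j (incr N t j w)])
     = Q (\bigcap_(j in jrange m) [set w | B j (incr N (fun i => t i + hh) j w)])) /\
  (forall t, 0 < t -> forall B : set (\bar R), measurable B ->
     Q (N t @^-1` B) = poisL (th * t) B).

Definition gen_maps (Q : R -> probability Om R) : set (set R) :=
  [set A | exists (E : set Om) (U : set (\bar R)),
      measurable E /\ measurable U /\ A = (fun y => Q y E) @^-1` U].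

Definition MPPmix (P : probability Om R) (N : R -> Om -> \bar R)
    (Q : R -> probability Om R) (nu : set R -> \bar R) : Prop :=
  exists alpha : R -> R,
    (forall y, 0 < alpha y) /\
    (forall U : set R, measurable U -> <<s gen_maps Q >> (alpha @^-1` U)) /\
    {ae nu, forall y,
       indep (Q y) (fun n => (1 <= n)%N) (fun n x => [set w | interW N n w <= x]) /\
       forall n, (1 <= n)%N -> forall B : set R, measurable B ->
         Q y (interW N n @^-1` B) = exponential_prob (alpha y) B} /\
    (forall (r : nat) (wk : nat -> R), (1 <= r)%N -> (forall k, 0 < wk k) ->
       P (\bigcap_(k in jrange r) [set w | interW N k w <= wk k])
       = (\int[nu]_y
            (\prod_(1 <= k < r.+1) fine (Q y [set w | interW N k w <= wk k]))%:E)%E).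

Definition MPPU (P : probability Om R) (N : R -> Om -> \bar R)
    (U : set R -> \bar R) : Prop :=
  forall (m : nat) (t : nat -> R) (kap : nat -> nat), inc_times m t ->
    P (\bigcap_(j in jrange m) [set w | incr N t j w = ((kap j)%:R)%:E])
    = (\int[U]_(th in [set th0 : R | (0 < th0)%R])
         (\prod_(1 <= j < m.+1)
            (expR (- (th * (t j - t j.-1))) * (th * (t j - t j.-1)) ^+ kap j
               / ((kap j)`!)%:R))%:E)%E.

Definition disintegration (P : probability Om R) (Pf : R -> probability Om R)
    (Qm : set R -> \bar R) (D : set R) : Prop :=
  forall E : set Om, measurable E ->
    measurable_fun D (fun th => Pf th E) /\
    (\int[Qm]_(th in D) Pf th E = P E)%E.

Definition consistent (Pf : R -> probability Om R) (Qm : set R -> \bar R)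
    (D : set R) (Th : Om -> R) : Prop :=
  forall B : set R, measurable B -> B `<=` D ->
    {ae Qm, forall th, B th -> Pf th (Th @^-1` B) = 1%E}.

Definition meas_param (K : R -> probability R R) : Prop :=
  forall B : set R, measurable B -> measurable_fun setT (fun s => K s B).

Definition eMRP (P : probability Om R) (N : R -> Om -> \bar R)
    (K : R -> probability R R) (h : R -> R) (Th : Om -> R) : Prop :=
  cond_indep P Th (fun n => (1 <= n)%N) (fun n x => [set w | interW N n w <= x]) /\
  forall n, (1 <= n)%N -> cond_law P Th (interW N n) (fun w => K (h (Th w))).

Definition Fcdf (K : R -> probability R R) (s : R) (t : R) : R :=
  fine (K s [set x | x <= t]).

Definition standingA (P : probability Om R) (N : R -> Om -> \bar R)
    (Th : Om -> R) (D : set R) (h : R -> R) (Pf : R -> probability Om R)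
    (K : R -> probability R R) (Lh : set R) (ph : R -> R) : Prop :=
  (forall th n, D th -> (1 <= n)%N -> forall B : set R, measurable B ->
     Pf th (interW N n @^-1` B) = K (h th) B) /\
  measurable Lh /\ Lh `<=` D /\ pushforward P Th Lh = 0%E /\
  (exists C : R -> R,
     (pushforward P (h \o Th)).-integrable setT (EFin \o C) /\
     forall th, (D `\` Lh) th ->
       (forall t : R, 0 < t -> derivable (Fcdf K (h th)) t 1) /\
       (forall t : R, 0 < t ->
          derive1 (Fcdf K (h th)) x @[x --> t] --> derive1 (Fcdf K (h th)) t) /\
       (forall t : R, 0 < t ->
          0 < derive1 (Fcdf K (h th)) t < C (h th)) /\
       (derive1 (Fcdf K (h th)) x @[x --> 0^'+] --> ph th)) /\
  (forall th, (D `\` Lh) th -> 0 < ph th) /\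
  (forall a b, (D `\` Lh) a -> (D `\` Lh) b -> ph a = ph b -> a = b).

End Defs.

(* Main.v *)
(* A point y in the range of p_h is the image of a single theta, so Q_y = P_theta there; that
   y |-> Q_y(E) is Borel rests on the Lusin-Souslin theorem (injective Borel images of Borel sets
   are Borel). All four conditions are equivalent to
     (E) for almost every y, the interarrival times are Q_y-i.i.d. exponential with rate y.
   (ii) gives (E) because the derivative at 0+ of an exponential distribution function is its
   rate, while for K(h(theta)) it is p_h(theta) = y. (E) gives (iii), the construction of the
   Poisson process from exponential interarrival times, through the lack of memory. (iii) gives
   (i), and (i) gives (iv), because Q is a version of the conditional probability given the
   parameter. Finally (iv) determines the joint tails of the interarrival times,
     P(W_1 > a_1, ..., W_r > a_r) = int exp(-y (a_1 + ... + a_r)) U(dy),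
   and a second moment computation with r = 2, 3, 4 shows that S_y(t) = Q_y(W_1 > t) satisfies
   S_y(a + b) = S_y(a) S_y(b) almost surely; as F_y = 1 - S_y is differentiable with F_y'(0+) = y,
   this forces S_y(t) = exp(-y t), which is (E). *)
Require Import Defs.
From HB Require Import structures.
From mathcomp Require Import all_boot all_order all_algebra.
From mathcomp Require Import all_classical all_reals all_analysis.
From mathcomp Require Import measurable_realfun exponential_distribution.
From mathcomp Require Import ring lra zify.
Set Implicit Arguments.
Unset Strict Implicit.
Unset Printing Implicit Defensive.
Import Order.TTheory GRing.Theory Num.Theory.
Import numFieldNormedType.Exports.
Local Open Scope classical_set_scope.
Local Open Scope ring_scope.

(** * The Lusin-Souslin theorem *)

(** [MPP] and [eMRP] yield identities for one finite family of events at a time, each valid off its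
    own null set, whereas [PP (Q y) N y] concerns all events for a single y. The identities are
    therefore indexed by rational thresholds (integer ones for increments), so that only countably
    many null sets are discarded, and pi-systems restore all Borel sets once y is fixed.

    Paths may also take the value +oo, where increments lose their meaning. The Poisson construction
    carries along the event that [N t] is finite, which turns out to have full mass because the
    Poisson weights sum to 1.

    Finally, the inverse of the injective function p_h has no continuity to rely on. Measurability
    of images is proved on the line itself, by nested cells in countably many coordinates. *)

Section closed_graphs.
Context {R : realType}.
Implicit Types (f g : R -> R) (A B : set R).

(** Sequential closedness of the graph of x |-> (c k x)_k in R x R^I. The index type is arbitrary so
    that several codings can be merged before [enum_coding] renumbers them. *)
Definition closed_graph (I : Type) (c : I -> R -> R) : Prop :=
  forall (u : R^nat) (x : R) (s : I -> R), u @ \oo --> x ->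
    (forall k, c k (u n) @[n --> \oo] --> s k) -> forall k, c k x = s k.

(* Substitute for refining the topology so that [f] becomes continuous: [f] is one
   coordinate of a Borel map from R to R^nat with a closed graph. *)
Definition codable f : Prop := exists (c : nat -> R -> R) (k : nat),
  [/\ forall k, measurable_fun setT (c k), closed_graph c & c k = f].

Definition enum_coding (I : countType) (c : I -> R -> R) (n : nat) : R -> R :=
  if unpickle n is Some k then c k else cst 0.

Lemma enum_codingK (I : countType) (c : I -> R -> R) i : enum_coding c (pickle i) = c i.
Proof. by rewrite /enum_coding pickleK. Qed.

Lemma measurable_enum_coding (I : countType) (c : I -> R -> R) n :
  (forall k, measurable_fun setT (c k)) -> measurable_fun setT (enum_coding c n).
Proof. by rewrite /enum_coding => mc; case: unpickle => // ; exact: measurable_cst. Qed.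

Lemma closed_graph_enum (I : countType) (c : I -> R -> R) :
  closed_graph c -> closed_graph (enum_coding c).
Proof.
move=> cG u x s ux us n; have := us n; rewrite /enum_coding; case E : unpickle => [k|] h.
  have uk k' : c k' (u m) @[m --> \oo] --> s (pickle k').
    by have := us (pickle k'); rewrite enum_codingK.
  rewrite (cG u x _ ux uk k).
  by apply: cvg_unique (uk k) h; exact: norm_hausdorff.
by apply: cvg_unique h; [exact: norm_hausdorff | exact: cvg_cst].
Qed.

Lemma codable_count (I : countType) (c : I -> R -> R) (i : I) :
  (forall k, measurable_fun setT (c k)) -> closed_graph c -> codable (c i).
Proof.
move=> mc cG; exists (enum_coding c), (pickle i).
by split; [move=> n; exact: measurable_enum_coding | exact: closed_graph_enum | exact: enum_codingK].
Qed.

Lemma cvg_eventually_cst (v : R^nat) (s : R) :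
  (forall n, exists m, v n = m%:R) -> v @ \oo --> s -> \forall n \near \oo, v n = s.
Proof.
move=> vN vs.
have vc : \forall n \near \oo, `|s - v n| < 4^-1.
  by move/cvgrPdist_lt : vs; apply; rewrite invr_gt0.
have [N _ HN] := vc.
have vcst n : (N <= n)%N -> v n = v N.
  move=> Nn; have := HN n Nn; have := HN N (leqnn N) => /=.
  have [a ->] := vN n; have [b ->] := vN N => h1 h2.
  have : `|a%:R - b%:R| < 1 :> R.
    rewrite (_ : _ - _ = (s - b%:R) - (s - a%:R)); last by ring.
    by apply: le_lt_trans (ler_normB _ _) _; lra.
  case: (ltngtP a b) => [ab|ab|->//].
  - rewrite distrC -natrB 1?ltnW// normr_nat (ltrn1 _ (b - a)%N); lia.
  - rewrite -natrB 1?ltnW// normr_nat (ltrn1 _ (a - b)%N); lia.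
have -> : s = v N.
  apply: cvg_unique vs _; first exact: norm_hausdorff.
  apply: cvg_near_cst.
  by exists N => // n /= /vcst.
by exists N => // n /= /vcst.
Qed.

Lemma indic_nat (A : set R) (x : R) : exists m, \1_A x = m%:R :> R.
Proof. by rewrite indicE; eexists. Qed.

Lemma indicT (A : set R) (x : R) : A x -> \1_A x = 1 :> R.
Proof. by move=> Ax; rewrite indicE mem_set. Qed.

Lemma indicF (A : set R) (x : R) : ~ A x -> \1_A x = 0 :> R.
Proof. by move=> Ax; rewrite indicE memNset. Qed.

Lemma indic_eq1 (A : set R) (x : R) : \1_A x = 1 :> R -> A x.
Proof.
by rewrite indicE => /eqP; case: (boolP (x \in A)) => [|_] ;rewrite ?inE// eq_sym oner_eq0.
Qed.

Lemma eq_indic_mem (A : set R) (x y : R) : \1_A x = \1_A y :> R -> A x <-> A y.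
Proof.
case: (pselect (A x)) => Ax; first by rewrite (indicT Ax) => /esym /indic_eq1.
by rewrite (indicF Ax); case: (pselect (A y)) => // Ay; rewrite (indicT Ay) => /esym/eqP; rewrite oner_eq0.
Qed.

Lemma near_indic (A : set R) (u : R^nat) (x : R) : \1_A (u n) @[n --> \oo] --> (\1_A x : R) ->
  \forall n \near \oo, A (u n) <-> A x.
Proof.
move=> /(cvg_eventually_cst (fun n => indic_nat A (u n))).
by apply: filterS => n; exact: eq_indic_mem.
Qed.

(** The sets with a codable indicator form a sigma-algebra containing the open rays. For a union or
    a ray, one extra coordinate prevents a sequence in the set from converging to a point outside
    it. *)
Lemma codable_measurable A : measurable A -> codable (\1_A).
Proof.
pose C := [set A | measurable A /\ codable (\1_A)].
suff CA : measurable `<=` C by move=> /CA [].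
have -> : @measurable _ R = <<s @RGenOInfty.G R >> by exact: RGenOInfty.measurableE.
apply: smallest_sub.
  split.
  - split=> //; exists (fun _ => cst 0), 0%N; split => //.
    by move=> u x s _ us k; apply: cvg_unique (us k); [exact: norm_hausdorff|exact: cvg_cst].
    by apply/funext => x; rewrite indicE in_set0.
  - move=> B [mB [c [k [mc cG ck]]]]; rewrite setTD; split; first exact: measurableC.
    have cN x : \1_(~` B) x = 1 - \1_B x :> R by rewrite !indicE in_setC; case: (_ \in _); rewrite /= ?subrr ?subr0.
    have := @codable_count (option nat) (fun o => if o is Some k then c k else \1_(~` B)) None.
    apply; first by move=> [//|]; apply: measurable_indic; exact: measurableC.
    move=> u x s ux us.
    have cx k' : c k' x = s (Some k') by exact: (cG u x (fun k => s (Some k)) ux (fun k => us (Some k)) k').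
    move=> [//|]; apply: cvg_unique (us None); first exact: norm_hausdorff.
    rewrite /= cN -ck cx; under eq_fun do rewrite cN -ck.
    by apply: cvgB; [exact: cvg_cst | exact: (us (Some k))].
  - move=> B BC; have mB i : measurable (B i) := (BC i).1.
    split; first exact: bigcup_measurable.
    have /choice[c] : forall i, exists c : nat -> R -> R, [/\ forall k, measurable_fun setT (c k),
        closed_graph c & exists k, c k = \1_(B i)].
      by move=> i; have [_ [c [k [? ? ?]]]] := BC i; exists c; split => //; exists k.
    move=> H.
    pose F x := [pred i | `[< B i x >]].
    (* One plus the index of the first [B i] containing x, and 0 outside the union. When this
       coordinate converges it is eventually constant, so u n cannot run through ever later [B i]
       while x lies in none. *)
    pose m x : nat := if pselect (exists i, F x i) is left e then (ex_minn e).+1 else 0%N.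
    have mS x i : m x = i.+1 <-> B i x /\ forall j, (j < i)%N -> ~ B j x.
      rewrite /m; case: pselect => [e|e]; last first.
        by split=> // -[Bi _]; exfalso; apply: e; exists i; exact/asboolP.
      case: ex_minnP => j /asboolP Bj jmin; split.
        move=> [<-]; split=> // k kj Bk.
        by have := jmin k (introT (asboolP _) Bk); rewrite leqNgt kj.
      move=> [Bi imin]; congr S; apply/eqP; rewrite eqn_leq jmin; last exact/asboolP.
      by rewrite leqNgt; apply/negP => /imin.
    have m0 x : m x = 0%N <-> forall i, ~ B i x.
      rewrite /m; case: pselect => [e|e]; split => //.
        by move=> h; exfalso; have [i /asboolP] := e; exact: h.
      by move=> _ i Bi; apply: e; exists i; exact/asboolP.
    have mm i : measurable [set x | m x = i].
      case: i => [|i].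
        rewrite (_ : mkset _ = ~` \bigcup_i B i); first by apply: measurableC; exact: bigcup_measurable.
        by apply/seteqP; split => x /=; [move=> /m0 h [i _ /h] | move=> h; apply/m0 => i Bi; apply: h; exists i].
      rewrite (_ : mkset _ = B i `\` \bigcup_(j < i) B j).
        by apply: measurableD => //; apply: bigcup_measurable.
      apply/seteqP; split => x /=.
        by move=> /mS[Bi h]; split => // -[j /= ji /(h _ ji)].
      by move=> [Bi h]; apply/mS; split => // j ji Bj; apply: h; exists j.
    pose I : countType := option (option (nat * nat)).
    pose c' (o : I) : R -> R := match o with None => \1_(\bigcup_i B i)
      | Some None => fun x => (m x)%:R | Some (Some (i, k)) => c i k end.
    apply: (@codable_count I c' None).
      move=> [[[i k]|]|] /=.
      + by have [+ _ _] := H i; exact.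
      + move=> _ Y mY; rewrite setTI.
        rewrite (_ : _ @^-1` _ = \bigcup_(i in [set i | Y i%:R]) [set x | m x = i]).
          by apply: bigcup_measurable => i _; exact: mm.
        by apply/seteqP; split => x /=; [move=> Yx; exists (m x) | move=> [i /= Yi ->]].
      + by apply: measurable_indic; exact: bigcup_measurable.
    move=> u x s ux us.
    have cx i k' : c i k' x = s (Some (Some (i, k'))).
      have [_ cG _] := H i.
      exact: (cG u x (fun k => s (Some (Some (i, k)))) ux (fun k => us (Some (Some (i, k)))) k').
    have Bx i : \forall n \near \oo, B i (u n) <-> B i x.
      apply: near_indic; have [_ _ [k' ck]] := H i.
      by rewrite -ck cx; exact: (us (Some (Some (i, k')))).
    have mu : \forall n \near \oo, (m (u n))%:R = s (Some None) :> R.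
      by apply: cvg_eventually_cst (us (Some None)) => n; exists (m (u n)).
    have mx : (m x)%:R = s (Some None) /\ \forall n \near \oo, m (u n) = m x.
      have {}mu : exists i, i%:R = s (Some None) /\ \forall n \near \oo, m (u n) = i.
        have [n0 _ Hn] := mu; exists (m (u n0)); split; first exact: (Hn n0 (leqnn _)).
        exists n0 => // n /= nn; apply/eqP; rewrite -(eqr_nat R).
        by rewrite (Hn n nn) -(Hn n0 (leqnn _)).
      move: mu => [i [<- mui]]; suff -> : m x = i by [].
      case: i mui => [|i] mui.
        apply/m0 => i; near \oo => n.
        have [_ h] : B i (u n) <-> B i x by near: n; exact: Bx.
        move=> /h; have /m0 : m (u n) = 0%N by near: n.
        exact.
      apply/mS; split.
        near \oo => n.
        have [h _] : B i (u n) <-> B i x by near: n; exact: Bx.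
        by apply: h; have /mS[] : m (u n) = i.+1 by near: n.
      move=> j ji; near \oo => n.
      have [_ h] : B j (u n) <-> B j x by near: n; exact: Bx.
      by have /mS[_ mi] : m (u n) = i.+1 by [near: n]; move=> /h; exact: mi.
    move=> [[[i k']|]|] /=; [exact: cx | by have [] := mx |].
    apply: cvg_unique (us None); first exact: norm_hausdorff.
    apply: cvg_near_cst; have [_] := mx; apply: filterS => n /= mun.
    have mU y : (\bigcup_i B i) y <-> m y <> 0%N.
      split; first by move=> [i _ Bi] /m0 /(_ i).
      by move=> h; apply: contrapT => g; apply/h/m0 => i Bi; apply: g; exists i.
    case: (pselect ((\bigcup_i B i) x)) => Ux; have := Ux; rewrite mU -mun -mU => Uu.
      by rewrite !indicT.
    by rewrite !indicF.
move=> _ [a ->]; split=> //.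
(* Convergence of ln (u n - a) keeps u n away from a, hence its limit stays inside the open ray. *)
pose c (b : bool) : R -> R := if b then \1_`]a, +oo[ else fun x => if a < x then ln (x - a) else 0.
apply: (@codable_count bool c true).
  move=> []; first by apply: measurable_indic.
  rewrite /c; apply: measurable_fun_if => //.
  - exact: measurable_fun_ltr.
  - by apply: measurable_funTS; apply: measurableT_comp => //; exact: measurable_funB.
move=> u x s ux us.
have sx : \1_`]a, +oo[ (u n) @[n --> \oo] --> s true := us true.
have := cvg_eventually_cst (fun n => indic_nat _ (u n)) sx => -[n0 _ Hn].
have e0 := Hn n0 (leqnn _).
have [an|/negP an] := boolP (a < u n0).
  have s1 : s true = 1 by rewrite -e0 indicT//= in_itv/= an.
  have un n : (n0 <= n)%N -> a < u n.
    move=> nn; have /= := Hn _ nn; rewrite s1 => /indic_eq1.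
    by rewrite /= in_itv/= andbT.
  have h : expR (s false) = x - a.
    have h1 : u n - a @[n --> \oo] --> x - a by apply: cvgB => //; exact: cvg_cst.
    have h2 : expR (c false (u n)) @[n --> \oo] --> expR (s false).
      by apply: continuous_cvg (us false); exact: continuous_expR.
    apply: cvg_unique h2 _; first exact: norm_hausdorff.
    apply: cvg_trans h1; apply: near_eq_cvg; exists n0 => // n /= /un aun.
    by rewrite /c aun lnK// posrE subr_gt0.
  have ax : a < x by rewrite -subr_gt0 -h expR_gt0.
  move=> [] /=; first by rewrite s1 indicT//= in_itv/= ax.
  by rewrite ax -h expRK.
have s0 : s true = 0 by rewrite -e0 indicF//= in_itv/= andbT.
have un n : (n0 <= n)%N -> u n <= a.
  move=> nn; rewrite leNgt; apply/negP => aun; have /= := Hn _ nn; rewrite s0 indicT//= ?in_itv/= ?aun//.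
  by move/eqP; rewrite oner_eq0.
have ax : x <= a.
  apply: (closed_cvg (fun y => y <= a) _ _ _ ux).
  - exact: closed_le.
  - by exists n0 => // n /= /un.
move=> [] /=; first by rewrite s0 indicF//= in_itv/= andbT; apply/negP; rewrite -leNgt.
rewrite ltNge ax/=; apply: cvg_unique (us false); first exact: norm_hausdorff.
by apply: cvg_near_cst; exists n0 => // n /= /un; rewrite leNgt => /negbTE ->.
Unshelve. all: by end_near.
Qed.

(** Only the indicators of the sets where f exceeds a rational are coded; f itself is one more
    coordinate. A rational strictly between f x and the limit of f (u n) would contradict the
    indicators being eventually constant. *)
Lemma codable_fun f : measurable_fun setT f -> codable f.
Proof.
move=> mf.
have /choice[c] : forall q : rat, exists c : nat -> R -> R, [/\ forall k, measurable_fun setT (c k),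
    closed_graph c & exists k, c k = \1_(f @^-1` `]ratr q, +oo[)].
  move=> q; have [|c [k [? ? ?]]] := @codable_measurable (f @^-1` `]ratr q, +oo[).
    by rewrite -[_ @^-1` _]setTI; exact: mf.
  by exists c; split => //; exists k.
move=> H.
apply: (@codable_count (option (rat * nat)) (fun o => if o is Some (q, k) then c q k else f) None).
  by move=> [[q k]|//]; have [+ _ _] := H q; exact.
move=> u x s ux us.
have cx q k : c q k x = s (Some (q, k)).
  have [_ cG _] := H q.
  exact: (cG u x (fun k => s (Some (q, k))) ux (fun k => us (Some (q, k))) k).
have near_gt q : \forall n \near \oo, ratr q < f (u n) <-> ratr q < f x.
  have [_ _ [k ck]] := H q.
  have := @near_indic (f @^-1` `]ratr q, +oo[) u x.
  rewrite -ck cx => /(_ (us (Some (q, k)))); apply: filterS => n /=.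
  by rewrite !in_itv/= !andbT.
have us0 : f (u n) @[n --> \oo] --> s None := us None.
move=> [[q k]|]; first exact: cx.
apply/eqP; rewrite eq_le; apply/andP; split; rewrite leNgt; apply/negP => /rat_in_itvoo[q].
  rewrite in_itv/= => /andP[sq qf].
  have [n [[_ h] fq]] := filter_ex (filterI (near_gt q) (cvgr_lt _ us0 _ sq)).
  by have := lt_trans fq (h qf); rewrite ltxx.
rewrite in_itv/= => /andP[fq qs].
have [n [[h _] qf]] := filter_ex (filterI (near_gt q) (cvgr_gt _ us0 _ qs)).
by have := lt_trans fq (h qf); rewrite ltxx.
Qed.

Lemma closed_graph_cons (c : nat -> R -> R) g (k : nat) : closed_graph c -> g = id \/ c k = g ->
  closed_graph (fun n => if n is m.+1 then c m else g).
Proof.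
move=> cG gk u x s ux us.
have cx m : c m x = s m.+1 := cG u x (fun m => s m.+1) ux (fun m => us m.+1) m.
move=> [|m]; last exact: cx.
case: gk => [gid|ck]; apply: cvg_unique (us 0%N); first exact: norm_hausdorff.
- by rewrite gid.
- exact: norm_hausdorff.
- by rewrite -ck cx; exact: (us k.+1).
Qed.

(** Fixed positions for the coordinates used below. The identity at position 0 turns convergence of
    all coordinates into convergence of the points themselves. *)
Lemma coding_exists f A B : measurable_fun setT f -> measurable A -> measurable B ->
  exists c : nat -> R -> R, [/\ forall k, measurable_fun setT (c k), closed_graph c &
    [/\ c 0%N = id, c 1%N = f, c 2%N = \1_A & c 3%N = \1_B]].
Proof.
move=> mf mA mB.
have [cf [kf [mcf cfG ckf]]] := codable_fun mf.
have [cA [kA [mcA cAG ckA]]] := codable_measurable mA.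
have [cB [kB [mcB cBG ckB]]] := codable_measurable mB.
pose c' (p : option bool * nat) := match p.1 with None => cf p.2 | Some true => cA p.2 | _ => cB p.2 end.
have c'G : closed_graph c'.
  move=> u x s ux us [[[]|] k].
  - exact: (cAG u x (fun k => s (Some true, k)) ux (fun k => us (Some true, k)) k).
  - exact: (cBG u x (fun k => s (Some false, k)) ux (fun k => us (Some false, k)) k).
  - exact: (cfG u x (fun k => s (None, k)) ux (fun k => us (None, k)) k).
have dG := closed_graph_enum c'G.
have eB : enum_coding c' (pickle (Some false, kB)) = \1_B by rewrite enum_codingK.
have eA : enum_coding c' (pickle (Some true, kA)) = \1_A by rewrite enum_codingK.
have ef : enum_coding c' (pickle (None : option bool, kf)) = f by rewrite enum_codingK.
have := closed_graph_cons (k := (pickle (Some false, kB))) dG (or_intror eB).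
move/(closed_graph_cons (k := (pickle (Some true, kA)).+1))/(_ (or_intror eA)).
move/(closed_graph_cons (k := (pickle (None : option bool, kf)).+2))/(_ (or_intror ef)).
move/(closed_graph_cons (g := id) (k := 0%N))/(_ (or_introl erefl)) => ?.
eexists; split; [|eassumption|by []].
move=> [|[|[|[|k]]]] //=; try exact: measurable_indic.
by apply: measurable_enum_coding => -[[[]|] q]; rewrite /c'/=; [exact: mcA|exact: mcB|exact: mcf].
Qed.

(** * Dyadic cells of a coding *)

Section cells.
Variable c : nat -> R -> R.

(** Level n fixes the dyadic intervals of the first n coordinates at all scales 2^-j with j < n, so
    the levels are nested and each has countably many cells. *)
Definition same_cell (n : nat) (x y : R) : Prop := forall i j, (i < n)%N -> (j < n)%N ->
  Num.floor (2 ^+ j * c i x) = Num.floor (2 ^+ j * c i y).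

Lemma same_cell_trans n y x z : same_cell n x y -> same_cell n y z -> same_cell n x z.
Proof. by move=> h1 h2 i j ni nj; rewrite h1// h2. Qed.

Lemma same_cell_leq m n x y : (m <= n)%N -> same_cell n x y -> same_cell m x y.
Proof. by move=> mn h i j im jm; apply: h; exact: leq_trans mn. Qed.

Lemma same_cell_dist n i j x y : (i < n)%N -> (j < n)%N -> same_cell n x y ->
  `|c i x - c i y| < 2^-1 ^+ j.
Proof.
move=> ni nj /(_ i j ni nj) h.
have := floor_itv (2 ^+ j * c i x); have := floor_itv (2 ^+ j * c i y).
rewrite h !intrD => /andP[h1 h2] /andP[h3 h4].
have : `|2 ^+ j * c i x - 2 ^+ j * c i y| < 1 by rewrite ltr_norml; apply/andP; split; lra.
by rewrite -mulrBr normrM normrX ger0_norm// exprVn -ltr_pdivlMl ?exprn_gt0// mulr1.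
Qed.

Hypotheses (cG : closed_graph c) (c0 : c 0%N = id).

Lemma half_expr_lt (e : R) : 0 < e -> exists j, 2^-1 ^+ j < e :> R.
Proof.
move=> e0; have h : `|2^-1| < 1 :> R by rewrite ger0_norm ?invr_ge0//; lra.
have [j /=] := filter_ex (cvgr_lt _ (cvg_geometric (1 : R) h) _ e0).
by rewrite /geometric mul1r => ?; exists j.
Qed.

(** Along nested cells every coordinate is Cauchy, and the closed graph identifies the limits as the
    coordinates of one point. This replaces completeness of a finer topology. *)
Lemma cell_limit (u : R^nat) : (forall m n, (m <= n)%N -> same_cell m (u m) (u n)) ->
  exists x, forall k, c k (u n) @[n --> \oo] --> c k x.
Proof.
move=> us.
have cv k : cvg (c k (u n) @[n --> \oo]).
  apply/cauchy_cvgP/cauchy_exP => e e0.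
  have [j je] := half_expr_lt e0.
  pose m := maxn k j; exists (c k (u m.+1)); exists m.+1 => // n /= mn.
  apply: lt_trans je; apply: (same_cell_dist (n := m.+1)); rewrite ?ltnS ?leq_maxl ?leq_maxr//.
  exact: us.
pose s k := lim (c k (u n) @[n --> \oo]).
have us0 : u n @[n --> \oo] --> s 0%N by have := cv 0%N; rewrite /s c0.
by exists (s 0%N) => k; rewrite (cG us0 cv); exact: cv.
Qed.

End cells.

Lemma countable_cells (c : nat -> R -> R) n : (forall k, measurable_fun setT (c k)) ->
  exists key : R -> nat, (forall x y, key x = key y <-> same_cell c n x y) /\
    forall t, measurable [set x | key x = t].
Proof.
move=> mc.
pose key x : {ffun 'I_n * 'I_n -> int} := [ffun p : 'I_n * 'I_n => Num.floor (2 ^+ p.2 * c p.1 x)].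
have keyP x y : key x = key y <-> same_cell c n x y.
  split.
    move=> /ffunP h i j ni nj; have := h (Ordinal ni, Ordinal nj).
    by rewrite !ffunE.
  by move=> h; apply/ffunP => -[i j]; rewrite !ffunE; exact: h.
exists (pickle \o key); split.
  by move=> x y; rewrite -keyP /=; split => [/(pcan_inj pickleK)|->].
move=> t; case: (pselect (exists x, pickle (key x) = t)) => [[z <-]|nt]; last first.
  rewrite (_ : mkset _ = set0) //; apply/seteqP; split => // x /= xt.
  by apply: nt; exists x.
rewrite (_ : mkset _ = \bigcap_(p : 'I_n * 'I_n)
    [set x | Num.floor (2 ^+ p.2 * c p.1 x) = key z p]); last first.
  apply/seteqP; split => x /=.
    by move=> /(pcan_inj pickleK) <- p _ /=; rewrite ffunE.
  by move=> h; congr pickle; apply/ffunP => p; have := h p Logic.I => /= <-; rewrite ffunE.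
apply: fin_bigcap_measurable => // p _.
pose a := 2^-1 ^+ p.2 * (key z p)%:~R : R; pose b := 2^-1 ^+ p.2 * (key z p + 1)%:~R : R.
rewrite (_ : mkset _ = c p.1 @^-1` `[a, b[); first by rewrite -[X in measurable X]setTI; exact: mc.
apply/seteqP; split => x /=; rewrite in_itv/= /a /b exprVn ler_pdivrMl ?exprn_gt0// ltr_pdivlMl ?exprn_gt0//.
  by move=> <-; exact: floor_itv.
by move=> /andP[? ?]; apply: floor_def; apply/andP.
Qed.
(** Separation by a Borel set, applied to images not yet known to be Borel. *)
Definition separable A B := exists S, [/\ measurable S, A `<=` S & S `&` B = set0].

Lemma separable_bigcup (I J : countType) (A : I -> set R) (B : J -> set R) :
  (forall i j, separable (A i) (B j)) -> separable (\bigcup_i A i) (\bigcup_j B j).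
Proof.
move=> AB; have /choice[S HS] : forall ij : I * J, exists S,
    [/\ measurable S, A ij.1 `<=` S & S `&` B ij.2 = set0] by move=> ij; exact: AB.
exists (\bigcup_i \bigcap_j S (i, j)); split.
- apply: countable_bigcupT_measurable => [|i]; first exact: countableP.
  rewrite -[X in measurable X]setCK setC_bigcap; apply: measurableC.
  apply: countable_bigcupT_measurable => [|j]; first exact: countableP.
  by apply: measurableC; have [] := HS (i, j).
- move=> y [i _ Aiy]; exists i => // j _; have [_ + _] := HS (i, j); exact.
- apply/seteqP; split => // y [[i _ Sy] [j _ Bjy]].
  have [_ _ h] := HS (i, j); rewrite -h; split => //; exact: Sy.
Qed.

(* Lusin's separation theorem, by bisecting along the cells of a coding. *)
Lemma image_separable f A B : measurable_fun setT f -> measurable A -> measurable B ->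
  (forall a b, A a -> B b -> f a <> f b) -> separable (f @` A) (f @` B).
Proof.
move=> mf mA mB fAB; apply: contrapT => nsep.
have [c [mc cG [c0 c1 c2 c3]]] := coding_exists mf mA mB.
pose E n x := [set y | same_cell c n x y].
have E0 x : E 0%N x = setT by apply/seteqP; split.
pose nS n (p : R * R) := A p.1 /\ B p.2 /\ ~ separable (f @` (A `&` E n p.1)) (f @` (B `&` E n p.2)).
(* Countable unions of pairwise separated sets are separated, so inseparability passes to some pair
   of cells of the next level. *)
have step n p : (n = 0%N) \/ nS n p -> exists q, nS n.+1 q /\
    (n = 0%N \/ same_cell c n p.1 q.1 /\ same_cell c n p.2 q.2).
  move=> np; have [key [keyP _]] := countable_cells n.+1 mc.
  apply: contrapT => nq.
  pose A' := A `&` (if n is 0%N then setT else E n p.1).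
  pose B' := B `&` (if n is 0%N then setT else E n p.2).
  suff : separable (f @` A') (f @` B').
    rewrite /A' /B'; case: np => [->|[_ [_ ns]]]; first by rewrite !setIT.
    by move: ns; case: (n) => [|//]; rewrite !E0.
  have UE (C : set R) : f @` C = \bigcup_t f @` (C `&` [set x | key x = t]).
    apply/seteqP; split => y; first by move=> [x Cx <-]; exists (key x) => //; exists x.
    by move=> [t _ [x [Cx _] <-]]; exists x.
  rewrite (UE A') (UE B'); apply: separable_bigcup => s t; apply: contrapT => ns.
  have nonempty (C D : set R) : ~ separable (f @` C) (f @` D) -> (exists x, C x) /\ (exists x, D x).
    move=> h; split; apply: contrapT => e; apply: h.
      by exists set0; split => //; [move=> y [x Cx]; exfalso; apply: e; exists x | rewrite set0I].
    exists setT; split => //; apply/seteqP; split => // y [_ [x Dx _]]; apply: e; by exists x.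
  have [[a [[Aa Ea] /= ka]] [b [[Bb Eb] /= kb]]] := nonempty _ _ ns.
  apply: nq; exists (a, b); split; last first.
    by move: Ea Eb; case: (n) => [|m] /=; [left|right].
  split => //; split => // -[S [mS AS SB]]; apply: ns; exists S; split => //.
    move=> y [x [[Ax _] /= kx] <-]; apply: AS; exists x => //; split => //=.
    by apply/keyP; rewrite ka kx.
  apply/seteqP; split => // y [Sy [x [[Bx _] /= kx] xy]]; have [] : set0 y.
  by rewrite -SB; split => //; exists x => //; split => //=; apply/keyP; rewrite kb kx.
(* Level 0 imposes nothing, so that dependent choice can start at (0, 0) without points of A and B
   at hand. *)
pose X := {p : nat * (R * R) | p.1 = 0%N \/ nS p.1 p.2}.
pose Rel (p q : X) := (sval q).1 = (sval p).1.+1 /\ ((sval p).1 = 0%N \/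
  same_cell c (sval p).1 (sval p).2.1 (sval q).2.1 /\ same_cell c (sval p).1 (sval p).2.2 (sval q).2.2).
have RelP p : {q | Rel p q}.
  apply: cid; case: p => -[n p] /= np; have [q [nq h]] := step n p np.
  by exists (exist _ (n.+1, q) (or_intror nq)); split.
have [F [F0 FS]] := dependent_choice RelP (exist _ (0%N, (0, 0)) (or_introl erefl)).
have F1 n : (sval (F n)).1 = n by elim: n => [|n IH]; [rewrite F0 | have [-> _] := FS n; rewrite IH].
pose u n := (sval (F n.+1)).2.1; pose v n := (sval (F n.+1)).2.2.
have nSuv n : nS n.+1 (u n, v n).
  by have := svalP (F n.+1); rewrite F1 => -[//|]; rewrite /u /v -surjective_pairing.
have uvS n : same_cell c n.+1 (u n) (u n.+1) /\ same_cell c n.+1 (v n) (v n.+1).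
  by have [_] := FS n.+1; rewrite F1 => -[].
have chain (w : R^nat) : (forall n, same_cell c n.+1 (w n) (w n.+1)) ->
    forall m n, (m <= n)%N -> same_cell c m.+1 (w m) (w n).
  move=> wS m n; elim: n => [|n IH]; first by rewrite leqn0 => /eqP ->.
  rewrite leq_eqVlt => /orP[/eqP -> //|]; rewrite ltnS => mn.
  by apply: same_cell_trans (IH mn) _; exact: same_cell_leq (wS n).
have cu := chain u (fun n => (uvS n).1); have cv := chain v (fun n => (uvS n).2).
have [x cx] := cell_limit cG c0 (fun m n mn => same_cell_leq (leqnSn m) (cu m n mn)).
have [y cy] := cell_limit cG c0 (fun m n mn => same_cell_leq (leqnSn m) (cv m n mn)).
have Ax : A x.
  have := cx 2%N; rewrite c2 => /near_indic h; have [n] := filter_ex h.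
  by have [? _] := nSuv n; move=> [+ _]; exact.
have By : B y.
  have := cy 3%N; rewrite c3 => /near_indic h; have [n] := filter_ex h.
  by have [_ [? _]] := nSuv n; move=> [+ _]; exact.
(* At a deep level the image of the cell of u n lies within 2 e of f x and that of the cell of v n
   within 2 e of f y, so the ball of radius 2 e around f x separates them. *)
pose e := `|f x - f y| / 4.
have e0 : 0 < e by rewrite divr_gt0// normr_gt0 subr_eq0; apply/eqP; exact: fAB.
have [j je] := half_expr_lt e0.
have fx : f (u n) @[n --> \oo] --> f x by have := cx 1%N; rewrite c1.
have fy : f (v n) @[n --> \oo] --> f y by have := cy 1%N; rewrite c1.
move/cvgrPdist_lt : (fx) => /(_ _ e0) hx; move/cvgrPdist_lt : (fy) => /(_ _ e0) hy.
have [n [[hn1 hn2] hn3]] := filter_ex (filterI (filterI hx hy) (nbhs_infty_gt (maxn 1 j))).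
have near z z' : same_cell c n.+1 z z' -> `|f z - f z'| < e.
  move=> zz; rewrite -c1; apply: lt_trans je.
  by apply: same_cell_dist zz; move: hn3 => /=; lia.
have [_ [_]] := nSuv n; apply; exists (ball (f x) (2 * e)); split.
- exact: measurable_ball.
- move=> _ [z [_ /near h] <-]; rewrite /ball/= ; move: h hn1 => /=.
  rewrite !ltr_norml => /andP[? ?] /andP[? ?]; apply/andP; split; lra.
- apply/seteqP; split => // w [+ [z [_ /near + zw]]]; rewrite -{}zw; move: hn2; rewrite /ball/= => h1 h3 h2.
  suff : `|f x - f y| < 4 * e by rewrite /e mulrC divfK// ltxx.
  rewrite (_ : _ - _ = (f x - f z) - (f (v n) - f z) - (f y - f (v n))); last by ring.
  apply: le_lt_trans (ler_normB _ _) _.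
  by have := ler_normB (f x - f z) (f (v n) - f z); lra.
Qed.

(* The Lusin-Souslin theorem on the real line. *)
Lemma injective_image_measurable f B : measurable_fun setT f -> measurable B ->
  {in B &, injective f} -> measurable (f @` B).
Proof.
move=> mf mB finj.
have [c [mc cG [c0 c1 c2 _]]] := coding_exists mf mB mB.
have /choice[key' Hk] : forall n, exists key : R -> nat,
    (forall x y, key x = key y <-> same_cell c n x y) /\ forall t, measurable [set x | key x = t].
  by move=> n; exact: countable_cells.
pose cell (a : nat * nat) := B `&` [set x | key' a.1 x = a.2].
have mcell a : measurable (cell a) by apply: measurableI => //; have [_] := Hk a.1; exact.
have /choice[S HS] : forall ab : (nat * nat) * (nat * nat), exists S,
    measurable S /\ (cell ab.1 `&` cell ab.2 = set0 ->
      f @` cell ab.1 `<=` S /\ S `&` (f @` cell ab.2) = set0).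
  move=> [a b]; case: (pselect (cell a `&` cell b = set0)) => /= ab; last by exists set0; split.
  have [|S [mS aS Sb]] := @image_separable f _ _ mf (mcell a) (mcell b).
    move=> x y cx cy fxy; have xy : x = y by apply: finj => //; rewrite inE; [case: cx|case: cy].
    by have [] : set0 x by rewrite -ab; split => //; rewrite xy.
  by exists S; split.
(* The closure keeps y approximable by images of points of the cell. Removing [S (b, a)] from
   [S (a, b)] makes the stars of disjoint cells disjoint. *)
pose star a := closure (f @` cell a) `&` ~`
  \bigcup_(b in [set b | cell a `&` cell b = set0]) (~` (S (a, b) `\` S (b, a))).
have mstar a : measurable (star a).
  apply: measurableI; first by apply: closed_measurable; exact: closed_closure.
  apply: measurableC; rewrite bigcup_mkcond.
  apply: countable_bigcupT_measurable => [|b]; first exact: countableP.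
  by case: ifP => // _; apply: measurableC; apply: measurableD; exact: (HS _).1.
have -> : f @` B = \bigcap_n \bigcup_t star (n, t).
  apply/seteqP; split.
    move=> y [x Bx <-] n _; exists (key' n x) => //.
    have cx : cell (n, key' n x) x by [].
    split; first by apply: subset_closure; exists x.
    move=> [b /= ab]; apply; have [Sab _] := (HS ((n, key' n x), b)).2 ab.
    have [_ Sba] := (HS (b, (n, key' n x))).2 (etrans (setIC _ _) ab).
    split; first by apply: Sab; exists x.
    by move=> Sb; have [] : set0 (f x) by rewrite -Sba; split => //; exists x.
  move=> y Hy; have /choice[t Ht] : forall n, exists t, star (n, t) y.
    by move=> n; have [t _ ?] := Hy n Logic.I; exists t.
  (* Stars of disjoint cells are disjoint, so the cells chosen for y meet pairwise; being cells of
     nested levels, they are nested. *)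
  have meet m n : exists x, cell (m, t m) x /\ cell (n, t n) x.
    apply: contrapT => h.
    have e : cell (m, t m) `&` cell (n, t n) = set0.
      by apply/seteqP; split => // x ?; apply: h; exists x.
    have [_ h1] := Ht m; have [_ h2] := Ht n.
    apply: h1; exists (n, t n) => // -[Smn nSnm].
    apply: h2; exists (m, t m) => /=; first by rewrite setIC.
    by move=> [].
  have /choice[u Hu] : forall n, exists x, cell (n, t n) x /\ `|y - f x| < 2^-1 ^+ n.
    move=> n; have [+ _] := Ht n.
    have e0 : 0 < 2^-1 ^+ n :> R by rewrite exprn_gt0// invr_gt0.
    by move=> /(_ _ (nbhsx_ballx y _ e0))[_ [[x cx <-] yx]]; exists x.
  have us m n : (m <= n)%N -> same_cell c m (u m) (u n).
    move=> mn; have [z [[_ /= zm] [_ /= zn]]] := meet m n.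
    have [[_ /= um] _] := Hu m; have [[_ /= un] _] := Hu n.
    apply: (@same_cell_trans _ _ z); first by have [/(_ (u m) z) [+ _] _] := Hk m; apply; rewrite zm.
    by apply: (same_cell_leq mn); have [/(_ z (u n)) [+ _] _] := Hk n; apply; rewrite zn.
  have [x cx] := cell_limit cG c0 us.
  exists x.
    have := cx 2%N; rewrite c2 => /near_indic h; have [n] := filter_ex h.
    by have [[Bu _] _] := Hu n; move=> [+ _]; exact.
  have fx : f (u n) @[n --> \oo] --> f x by have := cx 1%N; rewrite c1.
  apply: (cvg_unique _ fx); first exact: norm_hausdorff.
  apply/cvgrPdist_lt => e e0; have [j je] := half_expr_lt e0.
  exists j => // n /= jn; have [_ h] := Hu n; apply: lt_le_trans h _.
  apply: le_trans (ltW je); apply: ler_wiXn2l => //; lra.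
apply: bigcapT_measurable => n; exact: bigcupT_measurable.
Qed.

End closed_graphs.

(** * Exponential laws and lack of memory *)

Section erlang_integral.
Context {R : realType}.
Implicit Types (la x y t : R).

Definition exp_poly (n : nat) : {poly R} := \poly_(k < n) (k`!%:R)^-1.

Definition expsum (n : nat) (x : R) : R := \sum_(k < n) x ^+ k / k`!%:R.

Lemma expsumE n x : expsum n x = (exp_poly n).[x].
Proof. by rewrite /expsum horner_poly; apply: eq_bigr => i _; rewrite mulrC. Qed.

Lemma deriv_exp_poly n : (exp_poly n.+1)^`() = exp_poly n.
Proof.
apply/polyP => i; rewrite coef_deriv !coef_poly ltnS; case: ifP => // _; last by rewrite mul0rn.
by rewrite -[LHS]mulr_natr factS natrM invfM mulrAC mulVf ?mul1r// pnatr_eq0.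
Qed.

#[local] Instance is_derive_expsum n x : is_derive x 1 (expsum n.+1) (expsum n x).
Proof.
have -> : expsum n.+1 = horner (exp_poly n.+1) by apply/funext => y; rewrite expsumE.
by rewrite expsumE -(deriv_exp_poly n); exact: is_derive_poly.
Qed.

Lemma expsum0 n : expsum n.+1 0 = 1.
Proof.
by rewrite /expsum big_ord_recl big1 ?addr0/= ?expr0 ?divr1// => i _; rewrite exprS mul0r mul0r.
Qed.

(** One convolution step for sums of exponential times: the bracket is the distribution function of
    a sum of n of them at t - y, the other factor the density of one more. [F] is an explicit
    antiderivative. *)
Lemma erlang_integral la n t : 0 < t ->
  (\int[lebesgue_measure]_(y in `[0%R, t])
    ((1 - expR (- la * (t - y)) * expsum n (la * (t - y))) * (la * expR (- la * y)))%:E =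
  (1 - expR (- la * t) * expsum n.+1 (la * t))%:E)%E.
Proof.
move=> t0.
pose F (y : R) : R := - expR (- la * y) + expR (- la * t) * expsum n.+1 (la * (t - y)).
pose f (y : R) : R := (1 - expR (- la * (t - y)) * expsum n (la * (t - y))) * (la * expR (- la * y)).
have dF (y : R) : is_derive y 1 F (f y).
  have h : is_derive y 1 (fun y : R => la * (t - y)) (- la).
    by apply: is_derive_eq; rewrite add0r mul1r scalerN scaler1.
  have h2 : is_derive y 1 (fun y => expsum n.+1 (la * (t - y))) (expsum n (la * (t - y)) * - la).
    exact: (@is_derive1_comp _ (expsum n.+1) _ y _ _ (is_derive_expsum n (la * (t - y))) h).
  have e1 : expR (- la * t) = expR (- la * (t - y)) * expR (- la * y) by rewrite -expRD; congr expR; ring.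
  rewrite /F; apply: is_derive_eq.
  by rewrite /f e1 /GRing.scale/= mulr1; ring.
have cF : continuous F.
  by move=> y; apply/differentiable_continuous/derivable1_diffP; have [] := dF y.
have cf : continuous f.
  have cs : continuous (fun y => expsum n (la * (t - y))).
    move=> z; apply: (@continuous_comp _ _ _ (fun y => la * (t - y)) (expsum n)).
      apply: continuousM; first exact: cst_continuous.
      by apply: continuousB; [exact: cst_continuous|].
    by rewrite (_ : expsum n = horner (exp_poly n)); [exact: continuous_horner|apply/funext => ?; rewrite expsumE].
  have ce (g : R -> R) : continuous g -> continuous (fun y => expR (- la * g y)).
    move=> cg z; apply: (@continuous_comp _ _ _ (fun y => - la * g y) expR).
      by apply: continuousM; [exact: cst_continuous|exact: cg].
    exact: continuous_expR.
  rewrite /f => y; apply: cvgM.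
    apply: cvgB; first exact: cvg_cst.
    apply: cvgM; last exact: cs.
    by apply: (ce (fun z => t - z)) => z; apply: cvgB; [exact: cvg_cst|].
  by apply: cvgM; [exact: cvg_cst|apply: (ce id) => z].
rewrite (@continuous_FTC2 _ _ F) //.
- by rewrite -EFinB /F subrr !mulr0 expR0 subr0 expsum0; congr EFin; ring.
- by apply: continuous_subspaceT; exact: cf.
- split.
  + by move=> y _; have [] := dF y.
  + by apply/cvg_at_right_filter; exact: cF.
  + by apply/cvg_at_left_filter; exact: cF.
- by move=> y _; rewrite derive1E; have [_] := dF y.
Qed.

End erlang_integral.

(** * Image measures and uniqueness on rays *)

Section measure_tools.
Context d1 d2 (T1 : measurableType d1) (T2 : measurableType d2) (R : realType).

(** The measurability proof is an argument so that a finite measure structure can be attached to the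
    pushforward. *)
Definition push (m : {finite_measure set T1 -> \bar R}) (f : T1 -> T2)
  of measurable_fun setT f : set T2 -> \bar R := pushforward m f.

Variables (m : {finite_measure set T1 -> \bar R}) (f : T1 -> T2) (mf : measurable_fun setT f).

Let push0 : push m mf set0 = 0%E. Proof. by rewrite /push /pushforward preimage_set0 measure0. Qed.
Let push_ge0 A : (0 <= push m mf A)%E. Proof. by rewrite measure_ge0. Qed.
Let push_sigma_additive : semi_sigma_additive (push m mf).
Proof. exact: (@measure_semi_sigma_additive _ _ _ (pushforward m (HB.pack_for {mfun T1 >-> T2} f (isMeasurableFun.Build _ _ _ _ _ mf)))). Qed.

HB.instance Definition _ := isMeasure.Build _ _ _ (push m mf) push0 push_ge0 push_sigma_additive.

Let push_fin : fin_num_fun (push m mf).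
Proof. by move=> A mA; apply: fin_num_measure; rewrite -[X in measurable X]setTI; exact: mf. Qed.

HB.instance Definition _ := @Measure_isFinite.Build _ _ _ (push m mf) push_fin.

End measure_tools.

Lemma ray_unique (R : realType) (m1 m2 : {finite_measure set R -> \bar R}) :
  (forall a, m1 `]a, +oo[%classic = m2 `]a, +oo[%classic) ->
  forall A, measurable A -> m1 A = m2 A.
Proof.
move=> m12 A mA.
apply: (measure_unique (@RGenOInfty.G R) (fun n => `]- n%:R, +oo[%classic)) => //.
- exact: RGenOInfty.measurableE.
- move=> _ _ [a ->] [b ->]; exists (Num.max a b).
  by apply/seteqP; split => x /=; rewrite !in_itv/= !andbT gt_max => /andP.
- by move=> n; exists (- n%:R).
- apply/seteqP; split => // x _; exists (Num.truncn `|x|).+1 => //=.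
  rewrite in_itv/= andbT ltrNl; apply: le_lt_trans (ler_norm _) _; rewrite normrN.
  exact: truncnS_gt.
- by move=> _ [a ->]; exact: m12.
- by move=> k; rewrite ltey_eq fin_num_measure.
Qed.

(** * The exponential law as a probability measure on the line *)

Section exponential.
Context {R : realType} (la : R) (la0 : 0 < la).

Definition expo of 0 < la : set R -> \bar R := exponential_prob la.

(* The library equips [measurableTypeR R], not [R] itself, with this measure; the
   two measurable structures have the same sets but are not convertible. *)
Let libexpo : probability (measurableTypeR R) R :=
  exponential_distribution_exponential_prob__canonical__probability_measure_Probability la0.

Let expo0 : expo la0 set0 = 0%E. Proof. exact: (measure0 libexpo). Qed.
Let expo_ge0 A : (0 <= expo la0 A)%E. Proof. exact: (measure_ge0 libexpo). Qed.
Let expo_sigma_additive : semi_sigma_additive (expo la0).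
Proof. exact: (@measure_semi_sigma_additive _ _ _ libexpo). Qed.

HB.instance Definition _ := isMeasure.Build _ _ _ (expo la0) expo0 expo_ge0 expo_sigma_additive.

Let expo_setT : expo la0 setT = 1%E. Proof. exact: (@probability_setT _ _ _ libexpo). Qed.

HB.instance Definition _ := @Measure_isProbability.Build _ _ R (expo la0) expo_setT.

Lemma expoE A : expo la0 A = exponential_prob la A. Proof. by []. Qed.

Definition expo_tail (a : R) : R := expR (- la * Num.max a 0).

(** The exponential density agrees almost everywhere with the Radon-Nikodym derivative of the law,
    and the change of variables is carried out for the latter. *)
Lemma ge0_integral_expo (f : R -> \bar R) : measurable_fun setT f -> (forall x, 0 <= f x)%E ->
  (\int[expo la0]_x f x = \int[lebesgue_measure]_x (f x * (exponential_pdf la x)%:E))%E.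
Proof.
move=> mf f0.
have -> : (\int[expo la0]_x f x = \int[libexpo]_x f x)%E.
  have mid : measurable_fun setT (id : measurableTypeR R -> R) by move=> _ Y mY; rewrite setTI.
  exact: (ge0_integral_pushforward mid libexpo).
have dom : libexpo `<< @lebesgue_measure R.
  move=> A An B mB BA; rewrite /libexpo /= /exponential_prob; apply: null_set_integral => //.
  - by apply: measurable_funTS; apply/measurable_EFinP; exact: measurable_exponential_pdf.
  - exact: An.
rewrite -(Radon_Nikodym_SigmaFinite.change_of_variables dom)//.
apply: ae_eq_integral => //.
- apply: emeasurable_funM => //; exact: (measurable_int _ (Radon_Nikodym_SigmaFinite.f_integrable dom)).
- by apply: emeasurable_funM => //; apply/measurable_EFinP; exact: measurable_exponential_pdf.
apply: ae_eqe_mul2l.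
apply: integral_ae_eq => //.
- exact: Radon_Nikodym_SigmaFinite.f_integrable.
- by apply/measurable_EFinP; exact: measurable_exponential_pdf.
- by move=> E _ mE; rewrite -Radon_Nikodym_SigmaFinite.f_integral.
Qed.

Lemma expo_gt (a : R) : expo la0 `]a, +oo[%classic = (expo_tail a)%:E.
Proof.
have neg : expo la0 `]-oo, 0]%classic = 0%E.
  rewrite (_ : `]-oo, 0]%classic = `]-oo, 0[ `|` [set 0]); last first.
    apply/seteqP; split => x /=; rewrite !in_itv/= le_eqVlt; first by move=> /orP[/eqP|]; [right|left].
    by move=> [->|->]; rewrite ?orbT ?eqxx.
  rewrite measureU//=; last first.
    by apply/seteqP; split => x //=; rewrite in_itv/= => -[/[swap] ->]; rewrite ltxx.
  rewrite !expoE /exponential_prob integral_set1 adde0; apply: integral0_eq => x /=.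
  by rewrite in_itv/= => x0; rewrite lt0_exponential_pdf.
have C (b : R) : `]b, +oo[%classic = ~` `]-oo, b] by rewrite setCitvl.
rewrite /expo_tail; have [a0|a0] := leP a 0.
  rewrite mulr0 expR0; apply/eqP; rewrite eq_le probability_le1//=.
  rewrite -(sube0 1%E) -[in leLHS]neg -probability_setC// -C; apply: le_measure; rewrite ?inE//.
  by apply: subset_itvr; rewrite bnd_simp.
rewrite C probability_setC//.
rewrite (_ : `]-oo, a]%classic = `]-oo, 0[ `|` `[0, a]); last first.
  apply/seteqP; split => x /=; rewrite !in_itv/=; first by case: (ltP x 0) => //= ? ?; [left|right].
  by move=> [x0|/andP[]//]; apply: ltW; exact: lt_trans a0.
rewrite measureU//=; last first.
  by apply/seteqP; split => x //=; rewrite !in_itv/= => -[+ /andP[+ _]]; rewrite ltNge => /negP.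
have -> : expo la0 `]-oo, 0[%classic = 0%E.
  apply/eqP; rewrite eq_le measure_ge0 andbT -neg; apply: le_measure; rewrite ?inE//.
  by apply: subset_itvl; rewrite bnd_simp.
by rewrite add0e expoE exponential_prob_itv0c// -!EFinB subKr.
Qed.

End exponential.

(** * Sequences with product-form joint tails *)

Section iid_tail.
Context {R : realType} {d : measure_display} {Om : measurableType d}.
Variable mu : {finite_measure set Om -> \bar R}.
Implicit Types (E : set Om) (X : nat -> Om -> R) (a : nat -> R).

Definition tails X (r : nat) a : set Om := \bigcap_(i in `I_r) [set w | a i < X i w].

(* Under [mu] restricted to [E], the X_i are i.i.d. with survival function [q], up to the total mass [c]. *)
Definition iid_tail E (c : R) (q : R -> R) X : Prop :=
  forall r a, mu (E `&` tails X r a) = (c * \prod_(i < r) q (a i))%:E.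

Definition psum X (n : nat) (w : Om) : R := \sum_(i < n) X i w.

Lemma measurable_gt (f : Om -> R) (x : R) : measurable_fun setT f -> measurable [set w | x < f w].
Proof.
move=> mf; rewrite (_ : mkset _ = f @^-1` `]x, +oo[); first by rewrite -[X in measurable X]setTI; exact: mf.
by apply/seteqP; split => w /=; rewrite in_itv/= andbT.
Qed.

Lemma measurable_tails X r a : (forall i, measurable_fun setT (X i)) -> measurable (tails X r a).
Proof. by move=> mX; apply: bigcap_measurableType => i _; exact: measurable_gt. Qed.

Lemma measurable_psum X n : (forall i, measurable_fun setT (X i)) -> measurable_fun setT (psum X n).
Proof. by move=> mX; rewrite /psum; apply: measurable_sum. Qed.

Variables (X : nat -> Om -> R) (E : set Om) (c : R) (q : R -> R).
Hypotheses (mX : forall i, measurable_fun setT (X i)) (mE : measurable E).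
Hypotheses (q_ge0 : forall x, 0 <= q x) (HX : iid_tail E c q X).

(** Pi-system generating the sigma-algebra of X_0, ..., X_(n-1). *)
Definition past (n : nat) : set (set Om) := [set A | exists b, A = tails X n b].

Lemma past_measurable n : past n `<=` measurable.
Proof. by move=> _ [b ->]; exact: measurable_tails. Qed.

Lemma past_setI n : setI_closed (past n).
Proof.
move=> _ _ [a ->] [b ->]; exists (fun i => Num.max (a i) (b i)).
rewrite /tails -bigcapI; apply: eq_bigcapr => i _.
by apply/seteqP; split => w /=; rewrite gt_max => /andP.
Qed.

Lemma past_cover n : \bigcup_k tails X n (fun=> - k%:R) = setT.
Proof.
apply/seteqP; split => // w _; exists (\sum_(i < n) (Num.truncn `|X i w|).+1)%N => // i /= ni.
rewrite ltrNl; apply: le_lt_trans (ler_norm _) _; rewrite normrN.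
apply: lt_le_trans (truncnS_gt _) _; rewrite ler_nat.
by rewrite (bigD1 (Ordinal ni))//= leq_addr.
Qed.

Lemma past_gt n i x : (i < n)%N -> <<s past n >> [set w | x < X i w].
Proof.
move=> ni.
rewrite (_ : mkset _ = \bigcup_k tails X n (fun j => if j == i then x else - k%:R)).
  by apply: (@bigcup_measurable _ (g_sigma_algebraType (past n))) => k _;
    apply: sub_sigma_algebra; eexists.
apply/seteqP; split => w /=; last by move=> [k _ /(_ i ni)] /=; rewrite eqxx.
have : setT w by []; rewrite -(past_cover n) => -[k _ h] xw; exists k => // j nj /=.
by have := h j nj; case: eqP => // ->.
Qed.

Lemma past_psum n B : measurable B -> <<s past n >> (psum X n @^-1` B).
Proof.
move=> mB; suff : measurable_fun (setT : set (g_sigma_algebraType (past n))) (psum X n : _ -> R).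
  by move=> /(_ measurableT _ mB); rewrite setTI.
apply: measurable_sum => i; apply: (measurability _ (RGenOInfty.measurableE R)) => //.
move=> _ [_ [x ->] <-]; rewrite setTI (_ : _ @^-1` _ = [set w | x < X i w]); first exact: past_gt.
by apply/seteqP; split => w /=; rewrite in_itv/= andbT.
Qed.

Lemma past_sub n A : <<s past n >> A -> measurable A.
Proof.
apply: smallest_sub; first exact: sigma_algebra_measurable.
exact: past_measurable.
Qed.

Definition shift n : nat -> Om -> R := fun i => X (n + i)%N.

(** Both sides are finite measures in A. On the pi-system [past n] they agree because the past tail
    and the shifted one merge into a single tail event of length n + r. *)
Lemma indep_past n r a A : <<s past n >> A ->
  (mu (E `&` A `&` tails (shift n) r a) = mu (E `&` A) * (\prod_(i < r) q (a i))%:E)%E.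
Proof.
have p0 : 0 <= \prod_(i < r) q (a i) by apply: prodr_ge0.
have mT : measurable (tails (shift n) r a) by apply: measurable_tails => i; exact: mX.
have mET := measurableI _ _ mE mT.
pose m1 : {measure set Om -> \bar R} := mrestr mu mET.
pose m2 : {measure set Om -> \bar R} := mscale (NngNum p0) (mrestr mu mE).
move=> pA; have : m1 A = m2 A.
  apply: (@g_sigma_algebra_measure_unique _ _ _ (past n) (@past_measurable n)
    (fun k => tails X n (fun=> - k%:R))) pA.
  - by move=> k; eexists.
  - exact: past_cover.
  - exact: past_setI.
  - move=> _ [b ->].
    change (mu (tails X n b `&` (E `&` tails (shift n) r a)) =
      ((\prod_(i < r) q (a i))%:E * mu (tails X n b `&` E))%E).
    rewrite (setIC _ E) HX -EFinM setIC -setIA.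
    have -> : tails (shift n) r a `&` tails X n b =
        tails X (n + r)%N (fun i => if (i < n)%N then b i else a (i - n)%N).
      apply/seteqP; split => w.
        move=> [h1 h2] i /= inr; case: ifPn => [|/negbTE]; first exact: h2.
        rewrite ltnNge => /negbFE ni; have := h1 (i - n)%N; rewrite /shift /= subnKC//; apply.
        by rewrite ltn_subLR.
      move=> h; split=> i /= ir.
        by have := h (n + i)%N; rewrite /= ltn_add2l (ltnNge (n + i)) leq_addr addKn; exact.
      by have := h i; rewrite /= ir; apply; exact: ltn_addr.
    rewrite HX big_split_ord/=; congr EFin; rewrite [RHS]mulrCA; congr (_ * _).
    rewrite [RHS]mulrC; congr (_ * _); apply: eq_bigr => i _.
      by rewrite ltn_ord.
    by rewrite ltnNge leq_addr /= addKn.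
  - by move=> k; rewrite ltey_eq fin_num_measure//; exact: measurable_tails.
move=> h; rewrite (setIC E A) -setIA [RHS]muleC; exact: h.
Qed.

Variable rho : probability R R.
Hypothesis rhoq : forall x, rho `]x, +oo[%classic = (q x)%:E.

Lemma pair_law n r a B1 B2 : measurable B1 -> measurable B2 ->
  (mu (E `&` psum X n @^-1` B1 `&` X n @^-1` B2 `&` tails (shift n.+1) r a) =
   mu (E `&` psum X n @^-1` B1) * rho B2 * (\prod_(i < r) q (a i))%:E)%E.
Proof.
move=> mB1 mB2.
have mS : measurable (psum X n @^-1` B1) by apply: past_sub; exact: past_psum.
have mT : measurable (tails (shift n.+1) r a) by apply: measurable_tails => i; exact: mX.
have mEST := measurableI _ _ (measurableI _ _ mE mS) mT.
have p0 : 0 <= fine (mu (E `&` psum X n @^-1` B1)) * \prod_(i < r) q (a i).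
  by rewrite mulr_ge0// ?fine_ge0//; exact: prodr_ge0.
have := @ray_unique R (push (mrestr mu mEST) (mX n)) (mscale (NngNum p0) rho).
move=> /(_ _ _ mB2) h.
rewrite -setIA (setIC (X n @^-1` B2)) setIA setIC.
transitivity (mscale (NngNum p0) rho B2); first apply: h; last first.
  rewrite /mscale /= EFinM fineK ?fin_num_measure//; last exact: measurableI.
  by rewrite muleAC.
move=> x.
change (mu (X n @^-1` `]x, +oo[ `&` (E `&` psum X n @^-1` B1 `&` tails (shift n.+1) r a)) =
  ((fine (mu (E `&` psum X n @^-1` B1)) * \prod_(i < r) q (a i))%:E * rho `]x, +oo[%classic)%E); rewrite rhoq.
have -> : X n @^-1` `]x, +oo[ `&` (E `&` psum X n @^-1` B1 `&` tails (shift n.+1) r a) =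
   E `&` psum X n @^-1` B1 `&` tails (shift n) r.+1 (fun i => if i is j.+1 then a j else x).
  rewrite setIC -setIA; congr (_ `&` _); apply/seteqP; split => w.
    move=> [h1 h2] [_|i] /=; first by rewrite /shift addn0; move: h2; rewrite /= in_itv/= andbT.
    by rewrite ltnS => ir; have := h1 i ir; rewrite /shift /= addSnnS.
  move=> h1; split; last by have := h1 0%N; rewrite /= /shift addn0 in_itv/= andbT; exact.
  by move=> i /= ir; have := h1 i.+1; rewrite /= /shift addSnnS; exact.
rewrite indep_past; last exact: past_psum.
rewrite big_ord_recl/= !EFinM fineK ?fin_num_measure//; last exact: measurableI.
by rewrite -muleA [X in (_ * X)%E]muleC.
Qed.

(** Whether the sum passes a level D at step n depends jointly on [psum X n] and [X n], hence
    general Borel sets C of the plane instead of rectangles. *)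
Lemma pair_product n r a C : measurable C ->
  (mu (E `&` (fun w => (psum X n w, X n w)) @^-1` C `&` tails (shift n.+1) r a) =
   (\prod_(i < r) q (a i))%:E * (push (mrestr mu mE) (measurable_psum n mX) \x rho) C)%E.
Proof.
move=> mC; have p0 : 0 <= \prod_(i < r) q (a i) by apply: prodr_ge0.
have mT : measurable (tails (shift n.+1) r a) by apply: measurable_tails => i; exact: mX.
have mET := measurableI _ _ mE mT.
have mp : measurable_fun setT (fun w => (psum X n w, X n w)).
  by apply/measurable_fun_pairP; split; [exact: measurable_psum | exact: mX].
pose m1 := push (mrestr mu mE) (measurable_psum n mX).
pose m2 := mscale (NngNum p0) rho.
have := @product_measure_unique _ _ _ _ _ m1 m2 (push (mrestr mu mET) mp).
move=> /(_ _ C mC) h.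
transitivity (push (mrestr mu mET) mp C).
  change (mu (E `&` (fun w => (psum X n w, X n w)) @^-1` C `&` tails (shift n.+1) r a) =
    mu ((fun w => (psum X n w, X n w)) @^-1` C `&` (E `&` tails (shift n.+1) r a))).
  by rewrite [in RHS]setIA (setIC _ E).
rewrite -h.
  rewrite /product_measure1 -ge0_integralZl//=.
  - by move: (measurable_fun_xsection rho mC).
move=> A B mA mB.
change (mu ((fun w => (psum X n w, X n w)) @^-1` (A `*` B) `&` (E `&` tails (shift n.+1) r a)) =
  (mu (psum X n @^-1` A `&` E) * ((\prod_(i < r) q (a i))%:E * rho B))%E).
rewrite setIA (setIC _ E) (setIC _ E).
rewrite (_ : _ @^-1` (A `*` B) = psum X n @^-1` A `&` X n @^-1` B) // setIA pair_law//.
by rewrite -muleA [(rho B * _)%E]muleC.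
Qed.

End iid_tail.

(** * Lack of memory at a fixed time *)

Section exponential_restart.
Context {R : realType} {d : measure_display} {Om : measurableType d}.
Variable mu : {finite_measure set Om -> \bar R}.
Variables (la : R) (la0 : 0 < la).
Notation q := (expo_tail la).

Lemma expo_tail_ge0 x : 0 <= q x. Proof. exact: expR_ge0. Qed.

Lemma expo_tailD x y : 0 <= x -> 0 <= y -> q (x + y) = q x * q y.
Proof. by move=> x0 y0; rewrite /expo_tail !max_l ?addr_ge0// mulrDr expRD. Qed.

Lemma expo_tail0 : q 0 = 1. Proof. by rewrite /expo_tail maxxx mulr0 expR0. Qed.

Variables (X : nat -> Om -> R) (E : set Om) (c : R).
Hypotheses (mX : forall i, measurable_fun setT (X i)) (mE : measurable E).
Hypothesis HX : iid_tail mu E c q X.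

Let mS n := measurable_psum n mX.

Lemma psumS n w : psum X n.+1 w = psum X n w + X n w.
Proof. by rewrite /psum big_ord_recr. Qed.

(** When X lists the waiting times after a time s, this is the event of exactly n jumps in the
    interval from s (excluded) to s + D. *)
Definition between (n : nat) (D : R) : set Om := [set w | psum X n w <= D < psum X n.+1 w].

(** For the pair (S_n, X_n): the n-th sum has not passed D and the next one passes it by more than
    b. *)
Definition straddle (D b : R) : set (R * R) := [set p | p.1 <= D /\ D + b - p.1 < p.2].

Lemma measurable_straddle D b : measurable (straddle D b).
Proof.
rewrite (_ : straddle D b = fst @^-1` `]-oo, D] `&` (fun p => p.1 + p.2) @^-1` `]D + b, +oo[); last first.
  apply/seteqP; split => -[x y]; rewrite /straddle/= !in_itv/= andbT ltrBlDl//.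
apply: measurableI; first by rewrite -[X in measurable X]setTI; exact: measurable_fst.
by rewrite -[X in measurable X]setTI; exact: measurable_funD.
Qed.

(** Lack of memory on each fibre: given S_n = x <= D, the remaining time D - x + b splits into D - x
    and b, both nonnegative, and the exponential tail is multiplicative there. *)
Lemma straddle_memoryless (m : {finite_measure set R -> \bar R}) D b : 0 <= b ->
  ((m \x expo la0) (straddle D b) = (q b)%:E * (m \x expo la0) (straddle D 0))%E.
Proof.
move=> b0; rewrite /product_measure1 -ge0_integralZl//=; last 2 first.
- exact: (measurable_fun_xsection _ (measurable_straddle D 0)).
- by rewrite lee_fin expo_tail_ge0.
have xs e x : xsection (straddle D e) x = if x <= D then `]D + e - x, +oo[%classic else set0.
  apply/seteqP; split => y; rewrite /xsection /straddle/= inE/=.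
    by move=> [-> h]; rewrite /= in_itv/= andbT.
  by case: ifP => //=; rewrite in_itv/= andbT.
apply: eq_integral => x _; rewrite !xs; case: ifPn => [xD|]; last by rewrite !measure0 mule0.
rewrite !expo_gt -EFinM -expo_tailD ?subr_ge0 ?addr0//.
by congr ((q _)%:E); ring.
Qed.

Lemma restart_event n D r a :
  (mu (E `&` between n D `&` [set w | (a 0%N < psum X n.+1 w - D)%R] `&`
      tails (shift X n.+1) r (fun i => a i.+1)) =
  (\prod_(i < r.+1) q (a i))%:E * mu (E `&` between n D))%E.
Proof.
have pp r' a' b := @pair_product _ _ _ mu X E c q mX mE expo_tail_ge0 HX (expo la0)
  (expo_gt la0) n r' a' _ (measurable_straddle D b).
(* The overshoot beyond D is positive on [between n D], so a negative threshold may be raised to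
   0. *)
pose b := Num.max (a 0%N) 0.
have b0 : 0 <= b by rewrite le_max lexx orbT.
have := pp r (fun i => a i.+1) b; rewrite straddle_memoryless//.
have := pp 0%N a 0; rewrite big_ord0 mul1e => <-.
rewrite (_ : tails (shift X n.+1) 0 a = setT) ?setIT; last by apply/seteqP; split => // w _ i.
rewrite muleA -EFinM big_ord_recl.
have -> : q b = q (a 0%N) by rewrite /expo_tail /b -maxA maxxx.
rewrite [in RHS]mulrC => h.
rewrite (_ : between n D =
    (fun w => (psum X n w, X n w)) @^-1` straddle D 0); last first.
  by apply/seteqP; split => w; rewrite /straddle/between/= psumS addr0 ltrBlDl => /andP.
rewrite -h; congr (mu _); congr (_ `&` _); rewrite -setIA; congr (_ `&` _).
apply/seteqP; split => w; rewrite /straddle/= /b psumS addr0.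
  by move=> [[-> h1] h2]; split => //; case: (leP (a 0%N) 0) => _; lra.
by case: (leP (a 0%N) 0) => h1 [-> h2]; split; [split| |split|] => //; lra.
Qed.

Lemma mass : mu E = c%:E.
Proof.
have := HX 0%N (fun=> 0); rewrite big_ord0 mulr1 => <-; congr (mu _).
by apply/seteqP; split => [w Ew|w []//]; split.
Qed.

Lemma psum_convolution n t :
  (mu (E `&` [set w | (psum X n.+1 w <= t)%R]) =
   \int[expo la0]_y mu (E `&` [set w | (psum X n w <= t - y)%R]))%E.
Proof.
pose C := [set p : R * R | p.1 + p.2 <= t].
have mC : measurable C.
  rewrite (_ : C = (fun p => p.1 + p.2) @^-1` `]-oo, t]); last first.
    by apply/seteqP; split => p; rewrite /C/= in_itv.
  by rewrite -[X in measurable X]setTI; exact: measurable_funD.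
have := @pair_product _ _ _ mu X E c q mX mE expo_tail_ge0 HX (expo la0)
  (expo_gt la0) n 0%N (fun=> 0) C mC.
rewrite big_ord0 mul1e (_ : tails _ 0 _ = setT) ?setIT; last by apply/seteqP; split => // w _ i.
rewrite (_ : _ @^-1` C = [set w | psum X n.+1 w <= t]); last first.
  by apply/seteqP; split => w; rewrite /C/= psumS.
move=> ->.
pose m := push (mrestr mu mE) (mS n).
rewrite (@product_measure_unique _ _ _ _ _ m (expo la0) (m \x^ expo la0)%E)//; last first.
  by move=> A B mA mB; exact: (product_measure2E m (expo la0)).
rewrite /product_measure2; apply: eq_integral => y _.
change (mu (psum X n @^-1` (ysection C y) `&` E) = mu (E `&` [set w | psum X n w <= t - y])).
rewrite setIC; congr (mu (_ `&` _)); apply/seteqP; split => w; rewrite /C /ysection/= inE/= lerBrDr//.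
Qed.

Let measurable_erlang_cdf n t :
  measurable_fun setT (fun y : R => 1 - expR (- la * (t - y)) * expsum n (la * (t - y))).
Proof.
have ml : measurable_fun setT (fun y : R => la * (t - y)) by apply: measurable_funM => //; exact: measurable_funB.
apply: measurable_funB => //; apply: measurable_funM.
  by apply: measurableT_comp => //; apply: measurable_funM => //; exact: measurable_funB.
rewrite /expsum; apply: measurable_sum => i; apply: measurable_funM => //.
exact: measurable_funX.
Qed.

Lemma psum_cdf n t : mu (E `&` [set w | psum X n w <= t]) =
  (if 0 <= t then c * (1 - expR (- la * t) * expsum n (la * t)) else 0)%:E.
Proof.
have c0 : 0 <= c by rewrite -lee_fin -mass.
elim: n t => [|n IH] t.
  rewrite /expsum big_ord0 mulr0 subr0 mulr1.
  rewrite (_ : [set w | _] = [set _ | 0 <= t]); last first.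
    by apply/seteqP; split => w; rewrite /psum/= big_ord0.
  case: ifP => t0; last by rewrite (_ : mkset _ = set0) ?setI0 ?measure0//; apply/seteqP; split => // w; rewrite /= t0.
  by rewrite (_ : mkset _ = setT) ?setIT ?mass//; apply/seteqP; split => w.
rewrite psum_convolution.
under eq_integral do rewrite IH.
pose g y := if 0 <= t - y then c * (1 - expR (- la * (t - y)) * expsum n (la * (t - y))) else 0.
have g0 y : 0 <= g y by rewrite -lee_fin /g -IH.
have mg : measurable_fun setT g.
  rewrite /g; apply: measurable_fun_ifT => //.
    by apply: measurable_fun_ler => //; exact: measurable_funB.
  by apply: measurable_funM => //; exact: measurable_erlang_cdf.
rewrite ge0_integral_expo//; last exact/measurable_EFinP.
transitivity (\int[lebesgue_measure]_(y in `[0%R, t])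
    (c%:E * ((1 - expR (- la * (t - y)) * expsum n (la * (t - y))) * (la * expR (- la * y)))%:E))%E.
  rewrite [RHS]integral_mkcond; apply: eq_integral => y _; rewrite patchE mem_setE/= in_itv/=.
  have [y0|y0] := leP 0 y; last by rewrite lt0_exponential_pdf// mule0.
  rewrite exponential_pdfE// /g subr_ge0; case: ifP => ty /=; last by rewrite mul0e.
  by rewrite -!EFinM -mulrA.
have [t0|t0|t0] := ltgtP 0 t.
- move: c0; rewrite le_eqVlt => /orP[/eqP c0|c0].
    by rewrite -c0 mul0r; apply: integral0_eq => y _; rewrite mul0e.
  rewrite ge0_integralZl//= ?lee_fin ?ltW//; last 2 first.
  + apply/measurable_EFinP; apply: measurable_funTS; apply: measurable_funM.
      exact: measurable_erlang_cdf.
    apply: measurable_funM => //; apply: measurableT_comp => //; exact: measurable_funM.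
  + move=> y; rewrite /= in_itv/= => /andP[y0 yt]; rewrite lee_fin.
    apply: mulr_ge0; last by rewrite mulr_ge0 ?expR_ge0// ltW.
    by have := g0 y; rewrite /g subr_ge0 yt pmulr_rge0.
  by rewrite erlang_integral.
- rewrite (_ : [set` `[0%R, t]] = set0) ?integral_set0//.
  by apply/seteqP; split => // y; rewrite /= in_itv/= => /andP[/le_trans/[apply]]; rewrite leNgt t0.
- rewrite -t0 set_itv1 integral_set1 mulr0 expR0 mulr0 expsum0 mulr1 subrr mulr0//.
Qed.

Definition pois (la D : R) (n : nat) : R := expR (- (la * D)) * (la * D) ^+ n / n`!%:R.

(** A difference of two consecutive Erlang distribution functions leaves the n-th Poisson weight. As
    [X n] is positive only almost surely, E is first cut down to [E'], where the n-th sum cannot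
    exceed the next one. *)
Lemma mu_between n D : 0 <= D -> mu (E `&` between n D) = (c * pois la D n)%:E.
Proof.
move=> D0.
have mle k : measurable [set w | psum X k w <= D].
  rewrite (_ : mkset _ = psum X k @^-1` `]-oo, D]); first by rewrite -[X in measurable X]setTI; exact: mS.
  by apply/seteqP; split => w /=; rewrite in_itv.
have m0 : measurable [set w | 0 < X n w] by exact: measurable_gt.
have null : mu (E `&` ~` [set w | 0 < X n w]) = 0%E.
  have <- : mu (E `\` (E `&` [set w | 0 < X n w])) = mu (E `&` ~` [set w | 0 < X n w]).
    by congr (mu _); rewrite setDIr setDv set0U.
  rewrite measureD//; [|exact: measurableI|by rewrite ltey_eq fin_num_measure].
  rewrite setIA setIid.
  have sT : <<s past X n >> setT := @measurableT _ (g_sigma_algebraType (past X n)).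
  have := @indep_past _ _ _ mu X E c q mX mE expo_tail_ge0 HX n 1%N (fun=> 0) _ sT.
  rewrite setIT big_ord1 expo_tail0 mule1 => ht.
  rewrite (_ : [set w | 0 < X n w] = tails (shift X n) 1 (fun=> 0)).
    have : (mu E - mu (E `&` tails (shift X n) 1 (fun=> 0%R)) = 0)%E by rewrite ht subee// fin_num_measure.
    exact.
  apply/seteqP; split => w; last by move=> /(_ 0%N isT); rewrite /shift addn0.
  by move=> Xw [|i]//= _; rewrite /shift addn0.
pose E' := E `&` [set w | 0 < X n w].
have mE' : measurable E' by exact: measurableI.
have eE A : measurable A -> mu (E `&` A) = mu (E' `&` A).
  move=> mA; have mN : measurable (E `&` ~` [set w | 0 < X n w]) by apply: measurableI => //; exact: measurableC.
  have -> : E `&` A = (E' `&` A) `|` (A `&` (E `&` ~` [set w | 0 < X n w])).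
    apply/seteqP; split => w; last by move=> [[[? _] ?]|[? [? _]]].
    by move=> [Ew Aw]; case: (pselect (0 < X n w)) => h; [left|right].
  rewrite measureU//; [|exact: measurableI|exact: measurableI|].
    rewrite [X in (_ + X)%E](_ : _ = 0%E) ?adde0//; apply/eqP; rewrite eq_le measure_ge0 andbT -null.
    by apply: le_measure; rewrite ?inE//; exact: measurableI.
  by apply/seteqP; split => // w [[[_ /= h] _] [_ [_]]].
have mB : measurable (between n D).
  rewrite (_ : between n D = [set w | psum X n w <= D] `\` [set w | psum X n.+1 w <= D]).
    exact: measurableD.
  apply/seteqP; split => w; rewrite /between/=.
    by move=> /andP[-> ?]; split => //; apply/negP; rewrite -ltNge.
  by move=> [-> /negP]; rewrite -ltNge.
have : mu (E `&` [set w | psum X n w <= D]) =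
    (mu (E `&` between n D) + mu (E `&` [set w | (psum X n.+1 w <= D)%R]))%E.
  rewrite !eE// -measureU//; [|exact: measurableI|exact: measurableI|].
    congr (mu _); rewrite -setIUr; apply/seteqP; split => w [[Ew Xw] /=]; rewrite /between/=.
      by move=> h; split => //; rewrite h /=; case: (ltP D (psum X n.+1 w)); [left|right].
    move=> [/andP[h _]|h]; split => //; apply: le_trans h; rewrite psumS lerDl; exact: ltW.
  by apply/seteqP; split => // w [[_ /andP[_ /=]]] + [_ /=]; rewrite ltNge => /negP.
rewrite !psum_cdf D0 => h.
have : mu (E `&` between n D) \is a fin_num by rewrite fin_num_measure//; exact: measurableI.
move: h; case: (mu (E `&` between n D)) => // r [] h _; congr EFin; move: h.
rewrite /expsum big_ord_recr/= /pois mulNr; set e := expR _; set S := \sum_(i < n) _; set T := _ ^+ _ / _ => h.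
by rewrite -mulrA -/T; have : r = c * (1 - e * S) - c * (1 - e * (S + T)); [rewrite h; ring|move=> ->; ring].
Qed.

(** Markov property at the fixed time D: on the event of n jumps the overshoot replaces the first
    waiting time, the later ones are merely renumbered, and the mass picks up the Poisson weight. *)
Lemma restart n D (X' : nat -> Om -> R) : 0 <= D ->
  (forall w, E w -> between n D w -> X' 0%N w = psum X n.+1 w - D /\
     forall i, X' i.+1 w = X (n.+1 + i)%N w) ->
  iid_tail mu (E `&` between n D) (c * pois la D n) q X'.
Proof.
move=> D0 X'E r a.
have h r' : mu (E `&` between n D `&` tails X' r'.+1 a) = (c * pois la D n * \prod_(i < r'.+1) q (a i))%:E.
  transitivity (mu (E `&` between n D `&` [set w | (a 0%N < psum X n.+1 w - D)%R] `&`
      tails (shift X n.+1) r' (fun i => a i.+1))).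
    congr (mu _); rewrite -[RHS]setIA; apply/seteqP; split => w [[Ew Bw]]; have [X0 XS] := X'E w Ew Bw.
      move=> T; split => //; split; first by have := T 0%N isT; rewrite /= X0.
      by move=> i ir /=; have := T i.+1 ir; rewrite /= XS.
    by move=> [T0 TS]; split => // -[|i] /= ir; [rewrite X0|rewrite XS; exact: TS].
  by rewrite restart_event mu_between// muleC EFinM.
case: r => [|r]; last exact: h.
rewrite big_ord0 mulr1 -mu_between//; congr (mu _).
by apply/seteqP; split => [w []//|w Ew]; split.
Qed.

End exponential_restart.

(** * Poisson processes with exponential interarrival times *)

Section paths.
Context {R : realType} {d : measure_display} {Om : measurableType d}.
Variable N : R -> Om -> \bar R.
Hypothesis CN : CountingProcess N.
Implicit Types (s t : R) (n k : nat) (w : Om).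
Local Notation T := (arrT N).

Let N_val t w : 0 <= t -> (exists n, N t w = n%:R%:E) \/ N t w = +oo%E.
Proof. by move=> t0; have [/(_ t t0)] := CN.2 w. Qed.

Let N_mono s t w : 0 <= s -> s <= t -> (N s w <= N t w)%E.
Proof. by move=> s0 st; have [_ [_ [_ [_ [+ _]]]]] := CN.2 w; exact. Qed.

Let N_zero w : N 0 w = 0%E.
Proof. by have [_ [_ [_ []]]] := CN.2 w. Qed.

Let measurable_N t : 0 <= t -> measurable_fun setT (N t).
Proof. by move=> t0; have [+ _] := CN; exact. Qed.

Let hit n w := [set t : R | 0 <= t /\ ((n%:R)%:E <= N t w)%E].

Let has_inf_hit n w : has_inf (hit n w).
Proof.
split; last by exists 0 => t [].
by have [_ [_ [_ [_ [_ /(_ n%:R) [t tP]]]]]] := CN.2 w; exists t.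
Qed.

Lemma arrT_ge0 n w : 0 <= T n w.
Proof. by apply: lb_le_inf; [exact: (has_inf_hit n w).1 | move=> t []]. Qed.

(** Right-continuity makes the infimum defining T_n attained. This equivalence is the only passage
    between arrival times and the values of N. *)
Lemma arrT_le n t w : 0 <= t -> T n w <= t <-> (n%:R%:E <= N t w)%E.
Proof.
move=> t0; split; last by move=> nt; apply: ge_inf; [exact: (has_inf_hit n w).2|].
move=> Tt; apply: le_trans (N_mono w (arrT_ge0 n w) Tt).
have [_ [/(_ _ (arrT_ge0 n w)) rc _]] := CN.2 w.
apply: (closed_cvg (fun y => n%:R%:E <= y)%E _ _ _ rc).
  exact: closed_ereal_le_ereal.
near=> x; have Tx : T n w < x by near: x; exact: nbhs_right_gt.
have xT : 0 < x - T n w by rewrite subr_gt0.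
have [y [y0 Ny] yx] := inf_adherent xT (has_inf_hit n w).
apply: le_trans Ny _; apply: N_mono => //; apply: ltW; apply: lt_le_trans yx _.
by rewrite /arrT -/(hit n w) addrC subrK.
Unshelve. all: by end_near. Qed.

Lemma arrT0 w : T 0 w = 0.
Proof.
by apply/eqP; rewrite eq_le arrT_ge0 andbT; apply/arrT_le => //; rewrite N_zero.
Qed.

(** Before T_n, for n > 0, the path is at most n - 1, so a jump of size at most one leaves it at
    most n at T_n; at time 0 it vanishes. *)
Lemma arrT_lt n w : T n w < T n.+1 w.
Proof.
rewrite ltNge; apply/negP => /(arrT_le _ _ (arrT_ge0 n w)); set t := T n w => Nt.
have [t0|t0] := eqVneq t 0.
  by move: Nt; rewrite t0 N_zero lee_fin leNgt ltr0n.
have {}t0 : 0 < t by rewrite lt_neqAle eq_sym t0 arrT_ge0.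
case: n @t t0 Nt => [|n] t t0 Nt; first by move: t0; rewrite /t arrT0 ltxx.
have [_ [_ [/(_ t t0) jump _]]] := CN.2 w.
have : (ereal_sup [set N s w | s in [set s | (0 <= s < t)%R]] <= n%:R%:E)%E.
  apply: ge_ereal_sup => _ [s /andP[s0 st] <-]; rewrite leNgt; apply/negP => Ns.
  have : t <= s; last by rewrite leNgt st.
  apply/arrT_le => //; move: Ns; case: (N_val w s0) => [[k ->]|->]; last by rewrite leey.
  by rewrite lte_fin lee_fin ltr_nat ler_nat.
move=> /(leeD2r 1%E) /(le_trans jump) /(le_trans Nt).
by rewrite -EFinD lee_fin natr1 ler_nat ltnn.
Qed.

Lemma N_eqP n t w : 0 <= t -> N t w = n%:R%:E <-> T n w <= t < T n.+1 w.
Proof.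
move=> t0; split.
  move=> Nt; apply/andP; split; first by apply/arrT_le => //; rewrite Nt.
  by rewrite ltNge; apply/negP => /arrT_le -/(_ t0); rewrite Nt lee_fin ler_nat ltnn.
move=> /andP[/(arrT_le _ _ t0) nN]; rewrite ltNge => /negP h.
case: (N_val w t0) => [[k Nk]|Ny]; last by exfalso; apply: h; apply/arrT_le => //; rewrite Ny leey.
rewrite Nk; congr (_%:R%:E); move: nN; rewrite Nk lee_fin ler_nat => nk.
apply/eqP; rewrite eqn_leq nk andbT leqNgt; apply/negP => kn; apply: h; apply/arrT_le => //.
by rewrite Nk lee_fin ler_nat.
Qed.

Lemma measurable_arrT n : measurable_fun setT (T n).
Proof.
apply: (measurability _ (RGenOInfty.measurableE R)) => //.
move=> _ [_ [x ->] <-]; rewrite setTI.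
have [x0|x0] := ltP x 0.
  rewrite (_ : _ @^-1` _ = setT) //; apply/seteqP; split => w //= _; rewrite in_itv/= andbT.
  exact: lt_le_trans x0 (arrT_ge0 n w).
rewrite (_ : _ @^-1` _ = ~` (N x @^-1` `[n%:R%:E, +oo[)).
  apply: measurableC; rewrite -[X in measurable X]setTI; apply: measurable_N => //.
  exact: emeasurable_itv.
apply/seteqP; split => w /=; rewrite !in_itv/= ?andbT ltNge.
  by move=> /negP h /(arrT_le _ _ x0).
by move=> h; apply/negP => /(arrT_le _ _ x0).
Qed.

Lemma measurable_interW n : measurable_fun setT (interW N n).
Proof. by apply: measurable_funB; exact: measurable_arrT. Qed.

Definition wait (i : nat) : Om -> R := interW N i.+1.

(** Takes the default value 0 where [N t] is +oo, so [resid] is defined everywhere but is meaningful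
    only where [N t] is finite. *)
Definition count t w : nat := Num.truncn (fine (N t w)).

Lemma count_eq n t w : N t w = n%:R%:E -> count t w = n.
Proof. by rewrite /count => ->; rewrite natrK. Qed.

Lemma N_fin t w : 0 <= t -> N t w \is a fin_num -> N t w = (count t w)%:R%:E.
Proof. by move=> t0; case: (N_val w t0) => [[n Nn] _|->//]; rewrite Nn (count_eq Nn). Qed.

(* The waiting times of the process restarted at time [t]. *)
Definition resid t (i : nat) (w : Om) : R :=
  if i is 0 then T (count t w).+1 w - t else wait (count t w + i) w.

Lemma resid0 : resid 0 = wait.
Proof.
apply/funext => i; apply/funext => w; have c0 : count 0 w = 0%N by apply: count_eq; rewrite N_zero.
by rewrite /resid c0; case: i => //; rewrite subr0 /wait /interW /= arrT0 subr0.
Qed.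

Lemma psum_resid t n w : psum (resid t) n.+1 w = T (count t w + n.+1) w - t.
Proof.
elim: n => [|n IH]; first by rewrite /psum big_ord1 addn1.
by rewrite psumS IH /= /wait /interW /= -addnS; ring.
Qed.

Lemma measurable_count_case (f : nat -> Om -> R) t : 0 <= t ->
  (forall n, measurable_fun setT (f n)) -> measurable_fun setT (fun w => f (count t w) w).
Proof.
move=> t0 mf _ Y mY; rewrite setTI.
have mN n : measurable [set w | N t w = n%:R%:E].
  by rewrite -[X in measurable X]setTI; exact: (measurable_N t0 measurableT (emeasurable_set1 _)).
have mc n : measurable [set w | count t w = n].
  case: n => [|n]; last first.
    rewrite (_ : mkset _ = [set w | N t w = n.+1%:R%:E]) //; apply/seteqP; split => w /=; last exact: count_eq.
    by case: (N_val w t0) => [[k Nk]|Ny]; rewrite /count ?Nk ?Ny /= ?natrK ?truncn0// => ->.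
  rewrite (_ : mkset _ = ~` \bigcup_n [set w | N t w = n.+1%:R%:E]).
    by apply: measurableC; apply: bigcupT_measurable.
  apply/seteqP; split => w /=; first by move=> c0 [n _ /count_eq]; rewrite c0.
  move=> h; case: (N_val w t0) => [[[|k] Nk]|Ny]; last by rewrite /count Ny /= truncn0.
    exact: count_eq.
  by exfalso; apply: h; exists k.
rewrite (_ : _ @^-1` _ = \bigcup_n ([set w | count t w = n] `&` f n @^-1` Y)).
  apply: bigcupT_measurable => n; apply: measurableI => //.
  by rewrite -[X in measurable X]setTI; exact: mf.
by apply/seteqP; split => w /=; [move=> ?; exists (count t w)|move=> [n _ [/= -> ?]]].
Qed.

Lemma measurable_resid t i : 0 <= t -> measurable_fun setT (resid t i).
Proof.
move=> t0; case: i => [|i] /=.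
  apply: measurable_funB => //; apply: (measurable_count_case (f := fun n => T n.+1)) => // n.
  exact: measurable_arrT.
apply: (measurable_count_case (f := fun n => wait (n + i.+1))) => // n.
exact: measurable_interW.
Qed.

(** Turns an increment into an event about the waiting times restarted at s. Finiteness of [N s]
    lets it be subtracted. *)
Lemma incr_eqP s t k w : 0 <= s -> s <= t -> N s w \is a fin_num ->
  (N t w - N s w)%E = k%:R%:E <-> between (resid s) k (t - s) w.
Proof.
move=> s0 st Nfin; have t0 := le_trans s0 st.
have Ns := N_fin s0 Nfin; set n := count s w in Ns.
have -> : (N t w - N s w)%E = k%:R%:E <-> N t w = (n + k)%:R%:E.
  rewrite Ns; case: (N_val w t0) => [[m ->]|->]; last by split.
  rewrite -EFinB; split=> [[]|[]]; last by rewrite natrD => ->; congr EFin; ring.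
  by move=> h; congr EFin; rewrite natrD -h; ring.
rewrite N_eqP// /between/= psum_resid -/n addnS ltrD2r.
case: k => [|k]; last by rewrite psum_resid -/n lerD2r.
rewrite addn0 /psum big_ord0 subr_ge0 st; split; first by move=> /andP[_ ->].
by move=> /= ->; rewrite andbT; apply: le_trans st; have /N_eqP -/(_ s0)/andP[] := Ns.
Qed.

Lemma resid_restart s t k w : 0 <= s -> s <= t -> N s w \is a fin_num ->
  between (resid s) k (t - s) w ->
  [/\ N t w \is a fin_num, resid t 0%N w = psum (resid s) k.+1 w - (t - s) &
    forall i, resid t i.+1 w = resid s (k.+1 + i)%N w].
Proof.
move=> s0 st Nfin /(incr_eqP _ s0 st Nfin); rewrite (N_fin s0 Nfin); set n := count s w.
have t0 := le_trans s0 st.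
case Nt : (N t w) => [r||] // [] h; have {h} rE : r = (n + k)%:R by rewrite natrD -h; ring.
have ct : count t w = (n + k)%N by apply: count_eq; rewrite Nt rE.
split => //; first by rewrite psum_resid -/n /resid ct addnS; ring.
by move=> i; rewrite /resid ct -/n; congr (wait _ w); lia.
Qed.

End paths.

(** * Extension of product rules from pi-systems *)

Section product_rule.
Context {R : realType} {d : measure_display} {Om : measurableType d}.
Variable P : probability Om R.

Definition product_rule (s : seq nat) (A : nat -> set Om) : Prop :=
  P (\bigcap_(i in [set i | i \in s]) A i) = (\prod_(i <- s) fine (P (A i)))%:E.

Lemma eq_product_rule s (A B : nat -> set Om) : (forall i, i \in s -> A i = B i) ->
  product_rule s A -> product_rule s B.
Proof.
move=> AB; rewrite /product_rule => h.
rewrite (_ : \bigcap_(i in _) B i = \bigcap_(i in [set i | i \in s]) A i); last first.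
  by apply: eq_bigcapr => i si; rewrite AB.
by rewrite h; congr EFin; rewrite !big_seq; apply: eq_bigr => i si; rewrite AB.
Qed.

Lemma bigcap_seq_measurable (s : seq nat) (A : nat -> set Om) :
  (forall i, i \in s -> measurable (A i)) -> measurable (\bigcap_(i in [set i | i \in s]) A i).
Proof. by move=> mA; apply: bigcap_measurableType => i /= /mA. Qed.

Variables (G : nat -> set (set Om)) (s : seq nat).
Hypotheses (s_uniq : uniq s) (GI : forall i, setI_closed (G i)) (GT : forall i, G i setT).
Hypothesis GM : forall i, G i `<=` measurable.

(** One coordinate at a time: [s1] lists those already ranging over the generated sigma-algebra.
    With all others fixed, both sides are finite measures in the k-th set and agree on the pi-system
    [G k]. *)
Lemma product_rule_sigma : (forall A : nat -> set Om, (forall i, i \in s -> G i (A i)) -> product_rule s A) ->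
  forall A : nat -> set Om, (forall i, i \in s -> <<s G i >> (A i)) -> product_rule s A.
Proof.
move=> rule.
have GsM i A : <<s G i >> A -> measurable A.
  by apply: smallest_sub; [exact: sigma_algebra_measurable|exact: GM].
suff H (s1 : seq nat) A : (forall i, i \in s -> if i \in s1 then <<s G i >> (A i) else G i (A i)) -> product_rule s A.
  by move=> A HA; apply: (H s) => i si; rewrite si; exact: HA.
elim: s1 A => [|k s1 IH] A HA; first by apply: rule => i /HA; rewrite in_nil.
have [ks|nks] := boolP (k \in s); last first.
  apply: IH => i si; have := HA i si; rewrite in_cons; case: eqP => // ik.
  by move: nks; rewrite -ik si.
have [ks1|nks1] := boolP (k \in s1).
  by apply: IH => i si; have := HA i si; rewrite in_cons; case: eqP => // -> ; rewrite ks1.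
pose AZ Z j := if j == k then Z else A j.
pose F := \bigcap_(j in [set j | j \in s /\ j != k]) A j.
pose p := \prod_(j <- s | j != k) fine (P (A j)).
have p0 : 0 <= p by apply: prodr_ge0 => j _; exact: fine_ge0.
have mA j : j \in s -> measurable (A j).
  by move=> js; have := HA j js; case: ifP => // _; [exact: GsM|exact: GM].
have mF : measurable F by apply: bigcap_measurableType => j /= [js _]; exact: mA.
have cap Z : \bigcap_(j in [set j | j \in s]) AZ Z j = Z `&` F.
  apply/seteqP; split => w.
    move=> h; split; first by have := h k ks; rewrite /AZ eqxx.
    by move=> j [/= js /negbTE jk]; have := h j js; rewrite /AZ jk.
  by move=> [Zw Fw] j /= js; rewrite /AZ; case: ifPn => // jk; exact: Fw.
have prd Z : \prod_(j <- s) fine (P (AZ Z j)) = p * fine (P Z).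
  rewrite (bigD1_seq k)//= {1}/AZ eqxx mulrC; congr (_ * _).
  by apply: eq_bigr => j /negbTE jk; rewrite /AZ jk.
have AZE : product_rule s (AZ (A k)) -> product_rule s A.
  by apply: eq_product_rule => j _; rewrite /AZ; case: eqP => [->|].
apply: AZE; rewrite /product_rule cap prd.
have := HA k ks; rewrite in_cons eqxx /= => GAk.
have PAk : (P (A k) = (fine (P (A k)))%:E)%E by rewrite fineK// fin_num_measure//; exact: mA.
rewrite EFinM -PAk.
pose m1 : {measure set Om -> \bar R} := mrestr P mF.
pose m2 : {measure set Om -> \bar R} := mscale (NngNum p0) P.
have : m1 (A k) = m2 (A k); last exact.
apply: (@g_sigma_algebra_measure_unique _ _ _ (G k) (@GM k) (fun=> setT)) GAk => //.
- by rewrite bigcup_const.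
- move=> Z GZ; change (P (Z `&` F) = (p%:E * P Z)%E).
  have : product_rule s (AZ Z).
    apply: IH => j js; rewrite /AZ; have := HA j js; rewrite in_cons; case: eqP => [->|] //=.
    by rewrite (negbTE nks1).
  rewrite /product_rule cap prd => ->; rewrite EFinM fineK// fin_num_measure//; exact: GM GZ.
- by move=> _; rewrite ltey_eq fin_num_measure.
Qed.

End product_rule.

(** * Poisson increments from exponential waiting times *)

Section poisson_process.
Context {R : realType}.

Lemma poisL_setT (lam : R) : 0 <= lam -> poisL lam setT = 1%E.
Proof.
move=> lam0; rewrite /poisL.
under eq_eseriesr do rewrite indicE in_setT mul1r -mulrA EFinM.
rewrite nneseriesZl//=; last by move=> n _; rewrite lee_fin divr_ge0// exprn_ge0.
have -> : (\sum_(0 <= k <oo) (lam ^+ k / k`!%:R)%:E = (expR lam)%:E)%E.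
  rewrite expRE -EFin_lim; last by rewrite /pseries/=; under eq_fun do rewrite mulrC; exact: is_cvg_series_exp_coeff.
  apply/congr_lim/funext => n/=; rewrite /pseries/= /series/= -sumEFin//.
  by under eq_bigr do rewrite mulrC.
by rewrite -EFinM expRN mulVf ?gt_eqF ?expR_gt0.
Qed.

Lemma poisL_ge0 (lam : R) B : 0 <= lam -> (0 <= poisL lam B)%E.
Proof.
move=> lam0; apply: nneseries_ge0 => k _ _; rewrite lee_fin mulr_ge0// ?indic_ge0//.
by rewrite divr_ge0// mulr_ge0 ?expR_ge0// exprn_ge0.
Qed.

Lemma poisL_le1 (lam : R) B : 0 <= lam -> (poisL lam B <= 1)%E.
Proof.
move=> lam0; rewrite -(poisL_setT lam0); apply: lee_nneseries => k _.
  by rewrite lee_fin mulr_ge0 ?indic_ge0// divr_ge0// mulr_ge0 ?expR_ge0// exprn_ge0.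
rewrite lee_fin ler_wpM2r//; first by rewrite divr_ge0// mulr_ge0 ?expR_ge0// exprn_ge0.
by rewrite !indicE in_setT; case: (_ \in _).
Qed.

Lemma poisL_fin (lam : R) B : 0 <= lam -> poisL lam B \is a fin_num.
Proof. by move=> l0; rewrite ge0_fin_numE ?poisL_ge0//; apply: le_lt_trans (poisL_le1 _ l0) (ltry _). Qed.

Context {d : measure_display} {Om : measurableType d}.
Variables (P : probability Om R) (N : R -> Om -> \bar R) (la : R).
Hypotheses (CN : CountingProcess N) (la0 : 0 < la).
Local Notation q := (expo_tail la).

Lemma N_natP t w : 0 <= t -> (exists n, N t w = n%:R%:E) \/ N t w = +oo%E.
Proof. by move=> t0; have [/(_ t t0)] := CN.2 w. Qed.

Lemma measurable_N t : 0 <= t -> measurable_fun setT (N t).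
Proof. by move=> t0; have [+ _] := CN; exact. Qed.

Lemma measurable_incr (t : nat -> R) j : 0 <= t j -> 0 <= t j.-1 -> measurable_fun setT (incr N t j).
Proof. by move=> *; apply: emeasurable_funB; exact: measurable_N. Qed.

Lemma measurable_N_fin t : 0 <= t -> measurable [set w | N t w \is a fin_num].
Proof.
move=> t0; rewrite (_ : mkset _ = N t @^-1` [set x | x \is a fin_num]) //.
have := emeasurable_fin_num measurableT (measurable_N t0).
by rewrite setTI.
Qed.

(** [restart] summed over the values k in B. Requiring [N t] to be finite makes the event a
    countable disjoint union over k and provides the hypothesis for the next step. *)
Lemma poisson_step E c s t B : measurable E -> measurable B ->
  0 <= s -> s <= t -> E `<=` [set w | N s w \is a fin_num] ->
  iid_tail P E c q (resid N s) ->
  iid_tail P (E `&` [set w | B (N t w - N s w)%E /\ N t w \is a fin_num])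
    (c * fine (poisL (la * (t - s)) B)) q (resid N t).
Proof.
move=> mE mB s0 st Efin HE r a; have t0 := le_trans s0 st.
have ts0 : 0 <= t - s by rewrite subr_ge0.
have lam0 : 0 <= la * (t - s) by rewrite mulr_ge0// ltW.
have mres i : measurable_fun setT (resid N s i) by exact: measurable_resid.
have mT : measurable (tails (resid N t) r a) by apply: measurable_tails => i; exact: measurable_resid.
have mincr k : measurable [set w | (N t w - N s w)%E = k%:R%:E].
  rewrite -[X in measurable X]setTI; have := emeasurable_funB (measurable_N t0) (measurable_N s0).
  by move=> /(_ measurableT _ (emeasurable_set1 k%:R%:E)).
have HX : forall k, P (E `&` [set w | (N t w - N s w)%E = k%:R%:E] `&` tails (resid N t) r a) =
    (c * pois la (t - s) k * \prod_(i < r) q (a i))%:E.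
  move=> k; have -> : E `&` [set w | (N t w - N s w)%E = k%:R%:E] = E `&` between (resid N s) k (t - s).
    apply/seteqP; split => w [Ew /=] h; split => //.
      by apply/(incr_eqP CN) => //; exact: Efin.
    by apply/(incr_eqP CN) => //; exact: Efin.
  have := @restart _ _ _ P la la0 (resid N s) E c mres mE HE k (t - s) (resid N t) ts0.
  apply=> w Ew bw; have [_ h1 h2] := resid_restart CN s0 st (Efin _ Ew) bw; by split.
pose F k := if `[< B k%:R%:E >] then E `&` [set w | (N t w - N s w)%E = k%:R%:E] `&` tails (resid N t) r a else set0.
have -> : E `&` [set w | B (N t w - N s w)%E /\ N t w \is a fin_num] `&` tails (resid N t) r a = \bigcup_k F k.
  apply/seteqP; split => w.
    move=> [[Ew [Bw Nt]] Tw]; have Ns := Efin _ Ew.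
    have [k kE] : exists k, (N t w - N s w)%E = k%:R%:E.
      case: (N_natP w s0) => [[n En]|En]; last by move: Ns; rewrite /= En.
      case: (N_natP w t0) => [[m Em]|Em]; last by move: Nt; rewrite /= Em.
      have nm : (n <= m)%N.
        have [_ [_ [_ [_ [/(_ s t s0 st) + _]]]]] := CN.2 w.
        by rewrite En Em lee_fin ler_nat.
      by exists (m - n)%N; rewrite En Em -EFinB natrB.
    by exists k => //; rewrite /F asboolT -?kE.
  move=> [k _]; rewrite /F; case: asboolP => // Bk [[Ew /= kE] Tw]; split => //; split => //=.
  have [h _ _] := resid_restart CN s0 st (Efin _ Ew) (iffLR (incr_eqP CN k s0 st (Efin _ Ew)) kE).
  by rewrite kE.
rewrite measure_semi_bigcup//; last 3 first.
- move=> k; rewrite /F; case: ifP => // _; apply: measurableI => //; exact: measurableI.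
- move=> i j _ _ [w []]; rewrite /F; do 2 case: ifP => // _.
  by move=> [[_ /= ->] _] [[_ /=]] [/eqP]; rewrite eqr_nat => /eqP.
- apply: bigcupT_measurable => k; rewrite /F; case: ifP => // _; apply: measurableI => //; exact: measurableI.
have c0 : 0 <= c.
  have := mass HE; rewrite -lee_fin => <-; exact: measure_ge0.
have p0 : 0 <= \prod_(i < r) q (a i) by apply: prodr_ge0 => i _; exact: expo_tail_ge0.
rewrite mulrAC EFinM fineK ?poisL_fin// /poisL -nneseriesZl//=; last first.
  by move=> k _; rewrite lee_fin mulr_ge0 ?indic_ge0// divr_ge0// mulr_ge0 ?expR_ge0// exprn_ge0.
apply: eq_eseriesr => k _; rewrite /F indicE; case: asboolP => Bk.
  by rewrite HX mem_set// mul1r -EFinM /pois; congr EFin; ring.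
by rewrite measure0 memNset// mul0r mule0.
Qed.

Lemma N_fin_mono s t w : 0 <= s -> s <= t -> N t w \is a fin_num -> N s w \is a fin_num.
Proof.
move=> s0 st; have [_ [_ [_ [_ [/(_ s t s0 st) + _]]]]] := CN.2 w.
case: (N_natP w s0) => [[n ->]//|->]; case: (N_natP w (le_trans s0 st)) => [[n ->]|->//].
by rewrite leNgt ltry.
Qed.

Hypothesis HW : iid_tail P setT 1 q (wait N).

Lemma fin_step t : 0 <= t -> iid_tail P [set w | N t w \is a fin_num] 1 q (resid N t).
Proof.
move=> t0; have := @poisson_step setT 1 0 t setT measurableT measurableT (lexx 0) t0.
rewrite resid0// subr0 poisL_setT ?mulr_ge0// ?(ltW la0)// mulr1 setTI => /(_ _ HW) h.
rewrite (_ : [set w | _] = [set w | setT (N t w - N 0 w)%E /\ N t w \is a fin_num]).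
  by apply: h => w _ /=; have [_ [_ [_ [-> _]]]] := CN.2 w.
by apply/seteqP; split => w /=; [split|move=> []].
Qed.

(** Explosion is excluded almost surely: by [fin_step], where the Poisson weights sum to 1, the
    event that [N t] is finite has mass 1. *)
Lemma N_fin_as t A : 0 <= t -> measurable A -> P (A `&` [set w | N t w \is a fin_num]) = P A.
Proof.
move=> t0 mA; have mf := measurable_N_fin t0.
have nfin : P (~` [set w | N t w \is a fin_num]) = 0%E.
  by rewrite probability_setC// (mass (fin_step t0)) subee.
apply/eqP; rewrite eq_le; apply/andP; split.
  by apply: le_measure; rewrite ?inE//; exact: measurableI.
rewrite -[leRHS]adde0 -[in leRHS]nfin.
apply: le_trans (measureU2 _ _ _); [|exact: measurableI|exact: measurableC].
apply: le_measure; rewrite ?inE//.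
  by apply: measurableU; [exact: measurableI|exact: measurableC].
by move=> w Aw; case: (pselect (N t w \is a fin_num)) => h; [left|right].
Qed.

Section increments.
Variables (t : nat -> R) (m : nat).
Hypotheses (t0 : 0 <= t 0%N) (tS : forall j, (j < m)%N -> t j < t j.+1).

Let t_ge0 j : (j <= m)%N -> 0 <= t j.
Proof.
by elim: j => // j IH jm; apply: le_trans (IH (ltnW jm)) _; exact: ltW (tS jm).
Qed.

Lemma measurable_incrT j : (1 <= j <= m)%N -> measurable_fun setT (incr N t j).
Proof.
move=> /andP[j1 jm]; apply: measurable_incr; first exact: t_ge0.
by apply: t_ge0; apply: leq_trans jm; exact: leq_pred.
Qed.

(** The induction carries more than the probability: on [E k] the waiting times after [t k] are
    still independent exponential, which feeds the next [poisson_step]. The finiteness built into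
    [E m] is removed at the end by [N_fin_as]. *)
Lemma poisson_increments (B : nat -> set (\bar R)) : (forall j, measurable (B j)) ->
  P (\bigcap_(j in jrange m) [set w | B j (incr N t j w)]) =
  (\prod_(1 <= j < m.+1) fine (poisL (la * (t j - t j.-1)) (B j)))%:E.
Proof.
move=> mB; pose E k := \bigcap_(j in jrange k) [set w | B j (incr N t j w)] `&` [set w | N (t k) w \is a fin_num].
have mI k : (k <= m)%N -> measurable (\bigcap_(j in jrange k) [set w | B j (incr N t j w)]).
  move=> km; apply: bigcap_measurableType => j /andP[j1 jk].
  rewrite -[X in measurable X]setTI; apply: measurable_incrT => //; rewrite j1; exact: leq_trans km.
have mE k : (k <= m)%N -> measurable (E k).
  by move=> km; apply: measurableI; [exact: mI|apply: measurable_N_fin; exact: t_ge0].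
have H k : (k <= m)%N ->
    iid_tail P (E k) (\prod_(1 <= j < k.+1) fine (poisL (la * (t j - t j.-1)) (B j))) q (resid N (t k)).
  elim: k => [_|k IH km].
    rewrite big_geq// /E (_ : bigcap _ _ = setT) ?setTI; first exact: fin_step.
    by apply/seteqP; split => // w _ j /andP[/leq_trans/[apply]]; rewrite ltn0.
  rewrite big_nat_recr//=.
  have := poisson_step (mE _ (ltnW km)) (mB k.+1) (t_ge0 (ltnW km)) (ltW (tS km)) _ (IH (ltnW km)).
  rewrite (_ : E k `&` _ = E k.+1); first by apply => w [].
  apply/seteqP; split => w.
    move=> [[h1 h2] [h3 h4]]; split => // j /andP[j1]; rewrite leq_eqVlt => /orP[/eqP ->|jk] //.
    by apply: h1; rewrite /jrange j1.
  move=> [h1 h2]; have k1 : jrange k.+1 k.+1 by rewrite /jrange leqnn.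
  split; last by split => //; exact: (h1 k.+1 k1).
  split; last by apply: N_fin_mono h2; [exact: t_ge0 (ltnW km)|exact: ltW (tS km)].
  by move=> j /andP[j1 jk]; apply: h1; rewrite /jrange j1 ltnW.
by rewrite -(mass (H m (leqnn m))) -[LHS](N_fin_as (t_ge0 (leqnn m)))//; exact: mI.
Qed.

End increments.

Lemma prod_subseq m (s : seq nat) (f : nat -> R) : uniq s -> (forall i, i \in s -> jrange m i) ->
  \prod_(1 <= j < m.+1) (if j \in s then f j else 1) = \prod_(j <- s) f j.
Proof.
move=> us sm; rewrite -big_mkcond/= -big_filter; apply: perm_big; apply: uniq_perm => //.
  by apply: filter_uniq; exact: iota_uniq.
move=> i; rewrite mem_filter mem_index_iota ltnS; case: (boolP (i \in s)) => //= /sm.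
by rewrite /jrange.
Qed.

Lemma bigcap_subseq m (s : seq nat) (F : nat -> set Om) : (forall i, i \in s -> jrange m i) ->
  \bigcap_(i in [set i | i \in s]) F i = \bigcap_(j in jrange m) (if j \in s then F j else setT).
Proof.
move=> sm; apply/seteqP; split => w h j.
  by move=> _; case: ifP => // js; exact: h.
by move=> /= js; have := h j (sm j js); rewrite js.
Qed.

Lemma exp_PP : PP P N la.
Proof.
(* Independence is about arbitrary sublists of increments; the missing ones are given the whole
   space, of Poisson mass 1. *)
have sub m t s (B : nat -> set (\bar R)) : 0 <= t 0%N -> (forall j, (j < m)%N -> t j < t j.+1) ->
    (forall j, measurable (B j)) -> uniq s -> (forall i, i \in s -> jrange m i) ->
    P (\bigcap_(j in [set i | i \in s]) [set w | B j (incr N t j w)]) =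
    (\prod_(j <- s) fine (poisL (la * (t j - t j.-1)) (B j)))%:E.
  move=> t0 tS mB us sm.
  have tle j : (j < m)%N -> 0 <= la * (t j.+1 - t j).
    by move=> jm; rewrite mulr_ge0 ?subr_ge0 ?ltW// tS.
  rewrite (bigcap_subseq _ sm) -(prod_subseq _ us sm).
  pose B' j := if j \in s then B j else setT.
  rewrite (_ : \bigcap_(j in _) _ = \bigcap_(j in jrange m) [set w | B' j (incr N t j w)]); last first.
    by apply: eq_bigcapr => j _; rewrite /B'; case: ifP.
  rewrite poisson_increments//; last by move=> j; rewrite /B'; case: ifP.
  congr EFin; apply: eq_big_nat => -[//|j] /andP[_ jm]; rewrite /B'; case: ifP => // _.
  by rewrite poisL_setT// tle.
have one m t j B : 0 <= t 0%N -> (forall j, (j < m)%N -> t j < t j.+1) -> measurable B -> jrange m j ->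
    P [set w | B (incr N t j w)] = (fine (poisL (la * (t j - t j.-1)) B))%:E.
  move=> t0 tS mB jm; have := sub m t [:: j] (fun=> B) t0 tS (fun=> mB) isT.
  rewrite big_seq1 => <-; last by move=> i; rewrite inE => /eqP ->.
  congr (P _); apply/seteqP; split => w; first by move=> Bw i /=; rewrite inE => /eqP ->.
  by move=> /(_ j); apply; rewrite /= inE.
split; [|split].
- move=> m t [m1 [t0 tS]] s x us sm.
  have t0' : 0 <= t 0%N by rewrite t0.
  have mB (j : nat) : measurable [set y : \bar R | (y <= (x j)%:E)%E].
    rewrite (_ : mkset _ = [set` `]-oo, (x j)%:E]]); first exact: emeasurable_itv.
    by apply/seteqP; split => y /=; rewrite in_itv.
  rewrite (sub m t s (fun j => [set y | (y <= (x j)%:E)%E]))//.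
  congr EFin; rewrite !big_seq; apply: eq_bigr => j /sm jm.
  have e : P [set w | (incr N t j w <= (x j)%:E)%E] = _ := one m t j _ t0' tS (mB j) jm.
  by rewrite e.
- move=> m t hh B [m1 [t0 tS]] hh0 mB.
  (* The shifted times start at a positive time, which is why [poisson_increments] asks only for a
     nonnegative [t 0]. *)
  rewrite !poisson_increments// ?t0//.
  + by congr EFin; apply: eq_bigr => j _; congr (fine (poisL (la * _) _)); ring.
  + by rewrite add0r ltW.
  + by move=> j jm; rewrite ltrD2r tS.
- move=> t t0 B mB.
  have := one 1%N (fun j => if j is 0 then 0 else t) 1%N B.
  rewrite subr0 fineK ?poisL_fin ?mulr_ge0 ?(ltW t0) ?(ltW la0)// => <- //; last by case.
  congr (P _); apply/seteqP; split => w; rewrite /incr /=;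
  by have [_ [_ [_ [-> _]]]] := CN.2 w; rewrite sube0.
Qed.

End poisson_process.

(** * Independence from countably many thresholds *)

Section independence.
Context {R : realType} {d : measure_display} {Om : measurableType d}.
Variable P : probability Om R.

Lemma product_rule_filter (p : pred nat) (s : seq nat) (A : nat -> set Om) :
  (forall i, i \in s -> ~~ p i -> A i = setT) -> product_rule P [seq i <- s | p i] A -> product_rule P s A.
Proof.
move=> AT; rewrite /product_rule big_filter => h.
rewrite (_ : \bigcap_(i in _) A i = \bigcap_(i in [set i | i \in [seq i <- s | p i]]) A i); last first.
  apply/seteqP; split => w Aw i /=; first by rewrite mem_filter => /andP[_ si]; exact: Aw.
  move=> si; have [pi|npi] := boolP (p i); first by apply: Aw; rewrite /= mem_filter pi.
  by rewrite AT.
rewrite h; congr EFin; rewrite [RHS](bigID p)/= [X in _ * X]big_seq_cond [X in _ * X]big1 ?mulr1//.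
by move=> i /andP[si npi]; rewrite AT// probability_setT.
Qed.

(** [XS] will be the rationals for waiting times and the integers for increments, so that countably
    many product rules suffice. The whole space is added to each pi-system; indices at which it is
    chosen are dropped from s. *)
Lemma product_rule_sigma_indexed (Idx : nat -> Prop) (Ev : nat -> R -> set Om) (XS : set R) :
  XS !=set0 -> (forall x y, XS x -> XS y -> XS (Num.min x y)) ->
  (forall i x y, Ev i x `&` Ev i y = Ev i (Num.min x y)) ->
  (forall i x, Idx i -> measurable (Ev i x)) ->
  (forall s x, uniq s -> (forall i, i \in s -> Idx i) -> (forall i, XS (x i)) ->
    product_rule P s (fun i => Ev i (x i))) ->
  forall s A, uniq s -> (forall i, i \in s -> Idx i) ->
    (forall i, i \in s -> <<s [set Ev i x | x in XS] >> (A i)) -> product_rule P s A.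
Proof.
move=> [x0 XS0] XSI EvI mEv rule s A us sI sA.
pose G i : set (set Om) := [set B | B = setT \/ (i \in s /\ exists2 x, XS x & B = Ev i x)].
apply: (@product_rule_sigma _ _ _ P G) => //.
- move=> i B C [->|[si [x XSx ->]]]; first by rewrite setTI.
  move=> [->|[_ [y XSy ->]]]; first by rewrite setIT; right; split => //; exists x.
  by right; split => //; exists (Num.min x y); [exact: XSI|].
- by move=> i; left.
- by move=> i B [->//|[si [x _ ->]]]; apply: mEv; exact: sI.
- move=> B HB; pose p i := `[< B i != setT >].
  apply: (product_rule_filter (p := p)) => [i si /asboolPn /negP|]; first by rewrite negbK => /eqP.
  have /choice[x Hx] : forall i, exists x, XS x /\ (i \in [seq i <- s | p i] -> B i = Ev i x).
    move=> i; case: (boolP (i \in [seq i <- s | p i])) => [|_]; last by exists x0.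
    rewrite mem_filter => /andP[/asboolP pi si]; have [BT|[_ [x XSx Bx]]] := HB i si.
      by move: pi; rewrite BT eqxx.
    by exists x.
  apply: (@eq_product_rule _ _ _ _ _ (fun i => Ev i (x i))).
    by move=> i ip; have [_ /(_ ip)] := Hx i.
  apply: rule; first exact: filter_uniq.
    by move=> i; rewrite mem_filter => /andP[_ /sI].
  by move=> i; have [] := Hx i.
- move=> i si; apply: sub_sigma_algebra2 (sA i si) => B [x XSx <-]; right.
  by split => //; exists x.
Qed.

Lemma sigma_ratr_preimage (X : Om -> R) (B : set R) : measurable B ->
  <<s [set [set w | X w <= x] | x in range (@ratr R)] >> (X @^-1` B).
Proof.
move=> mB; set G := [set _ | _ in _].
suff : measurable_fun (setT : set (g_sigma_algebraType G)) (X : _ -> R).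
  by move=> /(_ measurableT _ mB); rewrite setTI.
apply: (measurability _ (RGenOInfty.measurableE R)) => //.
move=> _ [_ [a ->] <-]; rewrite setTI.
rewrite (_ : _ @^-1` _ = \bigcup_(q in [set q : rat | a <= ratr q]) ~` [set w | X w <= ratr q]); last first.
  apply/seteqP; split => w /=; rewrite in_itv/= andbT.
    move=> /rat_in_itvoo[q]; rewrite in_itv/= => /andP[aq qX].
    by exists q => /=; [exact: ltW|apply/negP; rewrite -ltNge].
  by move=> [q /= aq /negP]; rewrite -ltNge; exact: le_lt_trans.
rewrite bigcup_mkcond; apply: (@bigcupT_measurable_rat _ (g_sigma_algebraType G)) => q.
case: ifP => // _; apply: (@measurableC _ (g_sigma_algebraType G)); apply: sub_sigma_algebra.
by exists (ratr q).
Qed.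

Section real_variables.
Variables (Idx : nat -> Prop) (X : nat -> Om -> R).
Hypothesis mX : forall i, Idx i -> measurable_fun setT (X i).

Lemma indep_ratr : (forall s (x : nat -> rat), uniq s -> (forall i, i \in s -> Idx i) ->
    product_rule P s (fun i => [set w | X i w <= ratr (x i)])) ->
  forall s (B : nat -> set R), uniq s -> (forall i, i \in s -> Idx i) ->
    (forall i, measurable (B i)) -> product_rule P s (fun i => X i @^-1` B i).
Proof.
move=> rule s B us sI mB.
apply: (@product_rule_sigma_indexed Idx (fun i x => [set w | X i w <= x]) (range ratr)) => //.
- by exists (ratr 0), 0.
- by move=> _ _ [x _ <-] [y _ <-]; case: leP => _; [exists x|exists y].
- by move=> i x y; apply/seteqP; split => w /=; rewrite le_min => /andP.
- move=> i x Ii; rewrite (_ : mkset _ = X i @^-1` `]-oo, x]).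
    by rewrite -[X in measurable X]setTI; exact: mX.
  by apply/seteqP; split => w /=; rewrite in_itv.
- move=> s' x us' sI' xr.
  have /choice[y Hy] : forall i, exists y : rat, x i = ratr y by move=> i; have [y _ <-] := xr i; exists y.
  apply: (@eq_product_rule _ _ _ _ _ (fun i => [set w | X i w <= ratr (y i)])).
    by move=> i _; rewrite Hy.
  exact: rule.
- by move=> i _; exact: sigma_ratr_preimage.
Qed.

End real_variables.

Lemma indep_tails (N : R -> Om -> \bar R) r (a : nat -> R) : CountingProcess N ->
  indep P (fun n => (1 <= n)%N) (fun n x => [set w | interW N n w <= x]) ->
  P (tails (wait N) r a) = (\prod_(i < r) fine (P (wait N i @^-1` `]a i, +oo[%classic)))%:E.
Proof.
move=> CN ind.
have h : product_rule P (iota 1 r) (fun i => interW N i @^-1` `]a i.-1, +oo[%classic).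
  apply: (@indep_ratr (fun n => (1 <= n)%N) (interW N) (fun i _ => measurable_interW CN i)) => //.
  - by move=> s x us sI; exact: (ind s (fun i => ratr (x i))).
  - exact: iota_uniq.
  - by move=> i; rewrite mem_iota => /andP[].
rewrite (_ : tails _ _ _ = \bigcap_(i in [set i | i \in iota 1 r]) (interW N i @^-1` `]a i.-1, +oo[%classic)).
  rewrite [LHS]h; congr EFin; rewrite -(addn0 1%N) iotaDl big_map -val_enum_ord big_map big_enum/=.
  by apply: eq_bigr => i _; rewrite add1n.
apply/seteqP; split => w Tw i /=.
  by rewrite mem_iota => /andP[]; case: i => // i _ ir; rewrite in_itv/= andbT; exact: Tw.
by move=> ir; have := Tw i.+1; rewrite /= mem_iota/= add1n ltnS in_itv/= andbT; exact.
Qed.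

Lemma indep_iid_tail (N : R -> Om -> \bar R) (la : R) : 0 < la -> CountingProcess N ->
  indep P (fun n => (1 <= n)%N) (fun n x => [set w | interW N n w <= x]) ->
  (forall n, (1 <= n)%N -> forall B : set R, measurable B ->
     P (interW N n @^-1` B) = exponential_prob la B) ->
  iid_tail P setT 1 (expo_tail la) (wait N).
Proof.
move=> la0 CN ind law r a; rewrite setTI mul1r [LHS]indep_tails//; congr EFin.
by apply: eq_bigr => i _; rewrite /wait law// -(expoE la0) (expo_gt la0).
Qed.

End independence.

(** * Interarrival times of a mixed Poisson process *)

Section mixed_poisson_waiting_times.
Context {R : realType}.

(** For a Poisson process of rate y: the probability that the first jump falls in one of the first M
    cells of mesh dlt and is alone in its cell. *)
Definition grid_weight (dlt : R) (M : nat) (y : R) : R :=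
  \sum_(i < M) expR (- (y * dlt)) ^+ i * (y * dlt * expR (- (y * dlt))).

(** The geometric sum S satisfies S (1 - e) = 1 - e ^ M for e = exp (- x), and x e <= 1 - e <= x. *)
Lemma grid_weight_bounds dlt M y : 0 < dlt -> 0 < y ->
  expR (- (y * dlt)) * (1 - expR (- (y * dlt)) ^+ M) <= grid_weight dlt M y <= 1.
Proof.
move=> d0 y0; rewrite /grid_weight -mulr_suml; set x := y * dlt; have x0 : 0 < x by rewrite mulr_gt0.
set e := expR (- x); set S := \sum_(i < M) _.
have e0 : 0 < e by exact: expR_gt0.
have S0 : 0 <= S by apply: sumr_ge0 => i _; rewrite exprn_ge0// ltW.
have SE : S * (1 - e) = 1 - e ^+ M by have := subrX1 e M; rewrite -/S => h; lra.
have xe : x * e <= 1 - e.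
  have : e * (1 + x) <= 1.
    by rewrite -[leRHS](mulVf (lt0r_neq0 (expR_gt0 x))) -expRN; apply: ler_wpM2l; [exact: ltW|exact: expR_ge1Dx].
  lra.
have ex : 1 - e <= x by have := expR_ge1Dx (- x); rewrite -/e; lra.
have eM : 0 <= e ^+ M by rewrite exprn_ge0// ltW.
apply/andP; split.
  rewrite -SE mulrC -mulrA; apply: ler_wpM2l => //.
  by apply: ler_wpM2r; [exact: ltW|].
apply: le_trans (_ : S * (1 - e) <= 1); first exact: ler_wpM2l.
by rewrite SE; lra.
Qed.

Lemma cvg_half : (2^-1 ^+ k : R) @[k --> \oo] --> (0 : R).
Proof.
have h : `|2^-1| < 1 :> R by rewrite ger0_norm ?invr_ge0//; lra.
by have := cvg_geometric (1 : R) h; rewrite /geometric/=; under eq_fun do rewrite mul1r.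
Qed.

(** Mesh 2^-k with 4^k cells: the mesh tends to 0 while the covered length 2^k tends to infinity, so
    the first jump is isolated and not missed in the limit. *)
Lemma cvg_grid_weight y : 0 < y -> grid_weight (2^-1 ^+ k) (4 ^ k) y @[k --> \oo] --> (1 : R).
Proof.
move=> y0.
have h1 : expR (- (y * 2^-1 ^+ k)) @[k --> \oo] --> (1 : R).
  rewrite [X in _ --> X](_ : _ = expR (- (y * 0))); last by rewrite mulr0 oppr0 expR0.
  apply: continuous_cvg; first exact: continuous_expR.
  by apply: cvgN; apply: cvgM; [exact: cvg_cst|exact: cvg_half].
have h2 : expR (- (y * 2^-1 ^+ k)) ^+ (4 ^ k) @[k --> \oo] --> (0 : R).
  have e k : expR (- (y * 2^-1 ^+ k)) ^+ (4 ^ k) = expR (- (y * 2 ^+ k)).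
    rewrite -expRM_natl; congr expR.
    have -> : (4 ^ k)%:R = 2 ^+ k * 2 ^+ k :> R by rewrite -exprMn -natrM natrX.
    by rewrite exprVn; field; rewrite expf_neq0.
  apply: (@squeeze_cvgr _ _ _ _ (fun=> 0) (fun k => y^-1 * 2^-1 ^+ k)).
  - near=> k; rewrite e expR_ge0/=.
    have z0 : 0 < y * 2 ^+ k by rewrite mulr_gt0// exprn_gt0.
    rewrite exprVn -invfM expRN lef_pV2 ?posrE ?expR_gt0//.
    by apply: le_trans (expR_ge1Dx _); rewrite lerDr.
  - exact: cvg_cst.
  - rewrite -[X in _ --> X](mulr0 y^-1); apply: cvgM; [exact: cvg_cst|exact: cvg_half].
apply: (@squeeze_cvgr _ _ _ _ (fun k => expR (- (y * 2^-1 ^+ k)) * (1 - expR (- (y * 2^-1 ^+ k)) ^+ (4 ^ k))) (fun=> 1)).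
- near=> k; apply: grid_weight_bounds => //; exact: exprn_gt0.
- rewrite [X in _ --> X](_ : _ = 1 * (1 - 0)); last by rewrite subr0 mulr1.
  by apply: cvgM => //; apply: cvgB => //; exact: cvg_cst.
- exact: cvg_cst.
Unshelve. all: by end_near. Qed.

Lemma cvg_probability_sub {d} {T : measurableType d} (P : probability T R) (E : nat -> set T) (V : set T) :
  (forall k, measurable (E k)) -> measurable V -> (forall k, E k `<=` V) ->
  (forall w, V w -> \forall k \near \oo, E k w) -> P (E k) @[k --> \oo] --> P V.
Proof.
move=> mE mV EV Vev.
have mI (A : set T) : measurable A -> measurable_fun setT (fun w => (\1_A w)%:E : \bar R).
  by move=> mA; apply/measurable_EFinP; exact: measurable_indic.
have [|||||_ _] := @dominated_convergence _ _ _ P setT measurableT (fun k w => (\1_(E k) w)%:E)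
  (fun w => (\1_V w)%:E) (fun=> 1%E).
- by move=> k; exact: mI.
- exact: mI.
- apply: aeW => w _; apply: cvg_near_cst; case: (pselect (V w)) => Vw.
    by apply: filterS (Vev w Vw) => k Ek; rewrite !indicE !mem_set.
  by apply: nearW => k; rewrite !indicE !memNset// => /EV.
- by apply: finite_measure_integrable_cst.
- by apply: aeW => w k _; rewrite indicE; case: (_ \in _); rewrite /= ?normr1 ?normr0 lee_fin.
rewrite integral_indic// setIT; under eq_fun do rewrite integral_indic// setIT.
exact.
Qed.

Context {d : measure_display} {Om : measurableType d}.
Variables (P : probability Om R) (N : R -> Om -> \bar R) (U : probability R R).
Hypotheses (CN : CountingProcess N) (HU : MPPU P N U) (Upos : U [set y | 0 < y] = 1%E).

Local Notation I phi := (\int[U]_(y in [set y : R | (0 < y)%R]) (phi y)%:E)%E.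

Let gt0E : [set y : R | 0 < y] = `]0, +oo[%classic.
Proof. by apply/seteqP; split => y /=; rewrite in_itv/= andbT. Qed.

Let mgt0 : measurable [set y : R | 0 < y].
Proof. by rewrite gt0E. Qed.

(** An event fixing finitely many consecutive increments up to a time, with its probability for rate
    y as the weight. The inductive form lets the recursion on waiting times append increments to an
    arbitrary cylinder. *)
Inductive cylinder : R -> set Om -> (R -> R) -> Prop :=
| cylinder_nil : cylinder 0 setT (fun=> 1)
| cylinder_cons s t k E phi : cylinder s E phi -> s < t ->
    cylinder t (E `&` [set w | (N t w - N s w)%E = k%:R%:E]) (fun y => phi y * pois y (t - s) k).

Lemma cylinder_time_ge0 s E phi : cylinder s E phi -> 0 <= s.
Proof. by elim=> // {}s t k {}E {}phi _ s0 st; apply: le_trans s0 (ltW st). Qed.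

Lemma cylinder_fin s E phi : cylinder s E phi -> E `<=` [set w | N s w \is a fin_num].
Proof.
elim=> [w _|{}s t k {}E {}phi HE IH st w [Ew /=]].
  by have [_ [_ [_ [+ _]]]] := CN.2 w; rewrite /= => ->.
have s0 := cylinder_time_ge0 HE; have := IH w Ew => /= /(incr_eqP CN k s0 (ltW st)) [+ _] => /[apply].
by move=> /(resid_restart CN s0 (ltW st) (IH w Ew)) [].
Qed.

Lemma measurable_incr_eq s t k : 0 <= s -> 0 <= t -> measurable [set w | (N t w - N s w)%E = k%:R%:E].
Proof.
move=> s0 t0; rewrite -[X in measurable X]setTI.
have := emeasurable_funB (measurable_N CN t0) (measurable_N CN s0).
by move=> /(_ measurableT _ (emeasurable_set1 k%:R%:E)).
Qed.

Lemma cylinder_measurable s E phi : cylinder s E phi -> measurable E.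
Proof.
elim=> [|{}s t k {}E {}phi HE IH st]; first exact: measurableT.
have s0 := cylinder_time_ge0 HE; apply: measurableI => //; apply: measurable_incr_eq => //.
exact: le_trans s0 (ltW st).
Qed.

Lemma measurable_pois D k : measurable_fun setT (fun y : R => pois y D k).
Proof.
have my : measurable_fun setT (fun y : R => y * D) by exact: measurable_funM.
apply: measurable_funM => //; apply: measurable_funM; last exact: measurable_funX.
by apply: measurableT_comp => //; exact: measurableT_comp.
Qed.

Lemma pois_ge0 (y D : R) k : 0 <= y -> 0 <= D -> 0 <= pois y D k.
Proof. by move=> y0 D0; rewrite divr_ge0// mulr_ge0 ?expR_ge0// exprn_ge0// mulr_ge0. Qed.

Lemma pois0 (y D : R) : pois y D 0 = expR (- (y * D)).
Proof. by rewrite /pois expr0 fact0 divr1 mulr1. Qed.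

Lemma pois1 (y D : R) : pois y D 1 = expR (- (y * D)) * (y * D).
Proof. by rewrite /pois expr1 divr1. Qed.

Lemma cylinder_weight_ge0 s E phi y : cylinder s E phi -> 0 < y -> 0 <= phi y.
Proof.
move=> + y0; elim=> // {}s t k {}E {}phi _ p0 st.
by rewrite mulr_ge0// pois_ge0 ?subr_ge0 ?ltW.
Qed.

Lemma measurable_cylinder_weight s E phi : cylinder s E phi -> measurable_fun setT phi.
Proof.
elim=> [|{}s t k {}E {}phi _ mp st]; first exact: measurable_cst.
by apply: measurable_funM => //; exact: measurable_pois.
Qed.

Lemma cylinder_repr s E phi : cylinder s E phi ->
  exists m (t : nat -> R) (kap : nat -> nat), [/\ t 0%N = 0, forall j, (j < m)%N -> t j < t j.+1,
    t m = s, E = \bigcap_(j in jrange m) [set w | incr N t j w = (kap j)%:R%:E] &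
    forall y, phi y = \prod_(1 <= j < m.+1) pois y (t j - t j.-1) (kap j)].
Proof.
elim=> [|{}s s' k {}E {}phi _ [m [t [kap [t0 tS tm EE phiE]]]] ss'].
  exists 0%N, (fun=> 0), (fun=> 0%N); split => //; last by move=> y; rewrite big_geq.
  by apply/seteqP; split => // w _ j /andP[/leq_trans/[apply]]; rewrite ltn0.
exists m.+1, (fun j => if (j <= m)%N then t j else s'), (fun j => if (j <= m)%N then kap j else k).
split => //.
- by move=> j; rewrite ltnS => jm; rewrite jm; case: ltnP => [|mj]; [exact: tS|rewrite (_ : j = m) ?tm//; apply/eqP; rewrite eqn_leq jm].
- by rewrite ltnn.
- rewrite EE; apply/seteqP; split => w.
    move=> [h /= hk] j /andP[j1]; rewrite leq_eqVlt => /orP[/eqP ->|jm] /=.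
      by rewrite /incr/= ltnn leqnn tm.
    have jm' : (j <= m)%N by []. have jm'' : (j.-1 <= m)%N by apply: leq_trans jm'; exact: leq_pred.
    by rewrite /incr jm' jm''; apply: h; rewrite /jrange j1.
  move=> h; split.
    move=> j /andP[j1 jm] /=; have := h j; rewrite /jrange/= j1 /incr jm leqW// (leq_trans (leq_pred _) jm).
    exact.
  by have := h m.+1; rewrite /jrange /= leqnn /incr/= ltnn leqnn tm; exact.
- move=> y; rewrite phiE [RHS]big_nat_recr//= ltnn leqnn tm; congr (_ * _).
  by apply: eq_big_nat => j /andP[j1]; rewrite ltnS => jm; rewrite jm (leq_trans (leq_pred _) jm).
Qed.

Lemma cylinder_prob s E phi : cylinder s E phi -> P E = I phi.
Proof.
move=> /cylinder_repr [[|m] [t [kap [t0 tS _ -> phiE]]]].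
  rewrite (_ : bigcap _ _ = setT); last first.
    by apply/seteqP; split => // w _ j /andP[/leq_trans/[apply]]; rewrite ltn0.
  under eq_integral do rewrite phiE big_geq//.
  by rewrite probability_setT integral_cst// mul1e; exact/esym/Upos.
rewrite HU; last by split.
by apply: eq_integral => y _; rewrite phiE.
Qed.

Lemma cylinder_integrable s E phi : cylinder s E phi ->
  U.-integrable [set y | 0 < y] (EFin \o phi).
Proof.
move=> HE; apply/integrableP; split.
  by apply/measurable_EFinP; apply: measurable_funTS; exact: measurable_cylinder_weight HE.
rewrite (eq_integral (fun y => (phi y)%:E)).
  by rewrite -(cylinder_prob HE); apply: le_lt_trans (probability_le1 _ (cylinder_measurable HE)) (ltry _).
by move=> y /[!inE] /= y0; rewrite ger0_norm// (cylinder_weight_ge0 HE).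
Qed.

(* [MPPU] only speaks of increments over fixed times, so the next jump is located between
   two points of a grid, whose mesh then tends to 0. *)
Definition grid_event s E (a : nat -> R) r (dlt : R) (i : nat) : set Om :=
  let u := s + a 0%N + i%:R * dlt in
  E `&` [set w | (N u w - N s w)%E = 0%:R%:E] `&`
    [set w | (N (u + dlt) w - N u w)%E = 1%:R%:E] `&` tails (resid N (u + dlt)) r (fun i => a i.+1).

Lemma grid_event_cylinder s E phi a dlt i : cylinder s E phi -> 0 < a 0%N -> 0 < dlt ->
  let u := s + a 0%N + i%:R * dlt in
  cylinder (u + dlt) (E `&` [set w | (N u w - N s w)%E = 0%:R%:E] `&`
    [set w | (N (u + dlt) w - N u w)%E = 1%:R%:E]) (fun y => phi y * pois y (u - s) 0 * pois y (u + dlt - u) 1).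
Proof.
move=> HE a0 d0 u; apply: (@cylinder_cons u); last by rewrite ltrDl.
apply: cylinder_cons HE _; rewrite /u -addrA ltrDl ltr_wpDr// mulr_ge0// ltW//.
Qed.

Lemma grid_event_values s E phi a r dlt i w : cylinder s E phi -> 0 < a 0%N -> 0 < dlt ->
  grid_event s E a r dlt i w -> let u := s + a 0%N + i%:R * dlt in
  [/\ 0 <= s, s <= u, N s w = (count N s w)%:R%:E, N u w = (count N s w)%:R%:E &
    N (u + dlt) w = (count N s w).+1%:R%:E].
Proof.
move=> HE a0 d0; rewrite /grid_event; set u := s + _ + _ => -[[[Ew h1] h2] Tw] /=.
have {}h1 : (N u w - N s w)%E = 0%:R%:E := h1.
have {}h2 : (N (u + dlt) w - N u w)%E = 1%:R%:E := h2.
have s0 := cylinder_time_ge0 HE; have su : s <= u by rewrite /u -addrA lerDl; apply: addr_ge0; [exact: ltW|rewrite mulr_ge0// ltW].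
have u0 := le_trans s0 su; have uud : u <= u + dlt by rewrite lerDl ltW.
have Nsf := cylinder_fin HE Ew; have Ns := N_fin CN s0 Nsf; set n := count N s w in Ns *.
have Nu : N u w = n%:R%:E.
  move: h1; rewrite Ns; case: (N_natP CN w u0) => [[m ->]|->] //; rewrite -EFinB => -[] /eqP.
  by rewrite subr_eq0 => /eqP ->.
split => //.
move: h2; rewrite Nu; case: (N_natP CN w (le_trans u0 uud)) => [[m ->]|->] //; rewrite -EFinB => -[] h.
by congr EFin; rewrite -natr1; have : m%:R - n%:R = 1%:R :> R := h; lra.
Qed.

(** The jump lies after u and no later than u + dlt. Measuring the second waiting time from u + dlt
    instead of from the jump can only shorten it. *)
Lemma grid_event_sub s E phi a r dlt i : cylinder s E phi -> (forall i, 0 < a i) -> 0 < dlt ->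
  grid_event s E a r dlt i `<=` E `&` tails (resid N s) r.+1 a.
Proof.
move=> HE a0 d0 w Gw; have [s0 su Ns Nu Nud] := grid_event_values HE (a0 0%N) d0 Gw.
move: Gw; rewrite /grid_event => -[[[Ew _] _] Tw].
set u := s + _ + _ in su Nu Nud Tw; set n := count N s w in Ns Nu Nud.
have u0 := le_trans s0 su; have uud : u <= u + dlt by rewrite lerDl ltW.
have /(N_eqP CN _ _ u0)/andP[_ uT] := Nu.
have /(N_eqP CN _ _ (le_trans u0 uud))/andP[Tud _] := Nud.
split => // -[|[|i']] /=; rewrite ?ltnS => ir.
- by rewrite /resid -/n ltrBrDl; apply: le_lt_trans uT; rewrite /u lerDl mulr_ge0// ltW.
- have := Tw 0%N ir; rewrite /= /resid (count_eq Nud) -/n => h.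
  rewrite /wait /interW addn1 /=; apply: lt_le_trans h _; exact: lerB.
- have := Tw i'.+1 ir; rewrite /= /resid (count_eq Nud) -/n; congr (_ < wait N _ w); lia.
Qed.

Lemma grid_event_eventually s E phi a r w : cylinder s E phi -> (forall i, 0 < a i) ->
  (E `&` tails (resid N s) r.+1 a) w ->
  \forall k \near \oo, (\bigcup_(i < 4 ^ k) grid_event s E a r (2^-1 ^+ k) i) w.
Proof.
move=> HE a0 [Ew Tw].
have s0 := cylinder_time_ge0 HE; have Nsf := cylinder_fin HE Ew; have Ns := N_fin CN s0 Nsf.
set n := count N s w in Ns; pose tau := arrT N n.+1 w.
have tau_gt : s + a 0%N < tau by have := Tw 0%N isT; rewrite /= /resid -/n ltrBrDl.
(* Threshold of the second waiting time. For r = 0 there is none, and 0 then only demands that the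
   following jump fall outside the cell. *)
pose c1 : R := if r is 0 then 0 else a 1%N.
(* Slack of the second waiting time. The end u + dlt of the cell comes at most dlt after the jump,
   so a mesh below eta preserves the threshold. *)
pose eta := arrT N n.+2 w - tau - c1.
have eta0 : 0 < eta.
  case: r @c1 @eta Tw => [|r] c1 eta Tw; rewrite /eta /tau /c1; first by rewrite subr0 subr_gt0 (arrT_lt CN).
  by have := Tw 1%N isT; rewrite /= /resid -/n /wait /interW addn1 /= subr_gt0.
have near1 : \forall k \near \oo, 2^-1 ^+ k < eta by exact: (cvgr_lt _ cvg_half).
have near2 : \forall k \near \oo, tau - s - a 0%N < 2 ^+ k :> R.
  have := @nbhs_infty_gtr R (tau - s - a 0%N); apply: filterS => k /lt_trans; apply.
  by rewrite -natrX ltr_nat ltn_expl.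
apply: filterS2 near1 near2 => k; set dlt := 2^-1 ^+ k => dlt_eta k_large.
have d0 : 0 < dlt by rewrite exprn_gt0.
have Md : (4 ^ k)%:R * dlt = 2 ^+ k.
  have -> : (4 ^ k)%:R = 2 ^+ k * 2 ^+ k :> R by rewrite -exprMn -natrM natrX.
  by rewrite /dlt exprVn -mulrA mulfV ?mulr1// expf_neq0.
(* The first grid point not before the jump ends the required cell; index 0 is excluded because the
   jump comes strictly after s + a 0. *)
have ex : exists j, tau <= s + a 0%N + j%:R * dlt.
  by exists (4 ^ k)%N; rewrite Md; lra.
case: (ex_minnP ex) => -[|i] hi imin; first by move: hi; rewrite mul0r addr0 leNgt tau_gt.
have ui : s + a 0%N + i%:R * dlt < tau.
  by rewrite ltNge; apply/negP => /imin; rewrite ltnn.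
have iM : (i < 4 ^ k)%N.
  rewrite -(ltr_nat R) -(ltr_pM2r d0) Md; lra.
exists i => //; rewrite /grid_event; set u := s + _ + _ in ui *.
have uE : u + dlt = s + a 0%N + i.+1%:R * dlt by rewrite /u -natr1; ring.
rewrite -uE in hi.
have su : s <= u by rewrite /u -addrA lerDl; apply: addr_ge0; [exact: ltW|rewrite mulr_ge0// ltW].
have u0 := le_trans s0 su; have uud : u <= u + dlt by rewrite lerDl ltW.
have eta_le : c1 < arrT N n.+2 w - (u + dlt) by rewrite /eta in dlt_eta; lra.
have a1ge : 0 <= c1 by rewrite /c1; case: (r) => // _; exact: ltW.
have /(N_eqP CN _ _ s0)/andP[Tns _] := Ns.
have Nu : N u w = n%:R%:E by apply/(N_eqP CN) => //; rewrite ui andbT; exact: le_trans su.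
have Nud : N (u + dlt) w = n.+1%:R%:E.
  by apply/(N_eqP CN); [exact: le_trans uud|rewrite hi/=; lra].
split; [split; [split => //|]|].
- by rewrite /= Ns Nu -EFinB subrr.
- by rewrite /= Nu Nud -EFinB -natr1 addrC addKr.
- move=> [|j] /= jr; rewrite /resid (count_eq Nud).
    by move: eta_le; rewrite /c1; case: (r) jr.
  have h := Tw j.+2 jr; rewrite /= /resid -/n in h.
  by rewrite addSnnS.
Qed.

(** Induction on r, over all cylinders: the first waiting time is spent on locating the next jump in
    a cell, which lengthens the cylinder by two increments. For each mesh the cells are disjoint and
    their weights add up to [psi] times [grid_weight]; both sides then pass to the limit. *)
Lemma mixed_waiting_times r s E phi a : cylinder s E phi -> (forall i, 0 < a i) ->
  P (E `&` tails (resid N s) r a) = I (fun y => phi y * expR (- (y * \sum_(i < r) a i))).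
Proof.
elim: r s E phi a => [|r IH] s E phi a HE a0.
  rewrite (_ : tails _ 0 _ = setT) ?setIT; last by apply/seteqP; split => // w _ i.
  rewrite (cylinder_prob HE); apply: eq_integral => y _.
  by rewrite big_ord0 mulr0 oppr0 expR0 mulr1.
pose dlt k : R := 2^-1 ^+ k; have d0 k : 0 < dlt k by rewrite exprn_gt0.
pose F k i := grid_event s E a r (dlt k) i.
pose psi y := phi y * expR (- (y * \sum_(i < r.+1) a i)).
have mE := cylinder_measurable HE; have s0 := cylinder_time_ge0 HE.
have mF k i : measurable (F k i).
  have HG := grid_event_cylinder i HE (a0 0%N) (d0 k).
  apply: measurableI; first exact: cylinder_measurable HG.
  by apply: measurable_tails => j; apply: measurable_resid => //; exact: cylinder_time_ge0 HG.
have PF k i : P (F k i) = I (fun y => psi y * (expR (- (y * dlt k)) ^+ i * (y * dlt k * expR (- (y * dlt k))))).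
  have HG := grid_event_cylinder i HE (a0 0%N) (d0 k).
  rewrite /F /grid_event (IH _ _ _ _ HG)//; apply: eq_integral => y _; congr EFin.
  have -> : s + a 0%N + i%:R * dlt k - s = a 0%N + i%:R * dlt k by ring.
  have -> : s + a 0%N + i%:R * dlt k + dlt k - (s + a 0%N + i%:R * dlt k) = dlt k by ring.
  have -> : psi y = phi y * expR (- (y * (a 0%N + \sum_(j < r) a j.+1))) by rewrite /psi big_ord_recl.
  rewrite pois0 pois1; set A := \sum_(_ < _) _.
  have -> : expR (- (y * (a 0%N + i%:R * dlt k))) = expR (- (y * a 0%N)) * expR (- (y * dlt k)) ^+ i.
    by rewrite -expRM_natl -expRD; congr expR; ring.
  have -> : expR (- (y * (a 0%N + A))) = expR (- (y * a 0%N)) * expR (- (y * A)).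
    by rewrite -expRD; congr expR; ring.
  ring.
have mpsi : measurable_fun setT psi.
  apply: measurable_funM; first exact: measurable_cylinder_weight HE.
  by apply: measurableT_comp => //; apply: measurableT_comp => //; exact: measurable_funM.
have psi0 y : 0 < y -> 0 <= psi y.
  by move=> y0; rewrite mulr_ge0 ?expR_ge0// (cylinder_weight_ge0 HE).
have mexp (c : R) : measurable_fun setT (fun y : R => expR (- (y * c))).
  by apply: measurableT_comp => //; apply: measurableT_comp => //; exact: measurable_funM.
have mterm k i : measurable_fun setT (fun y => psi y * (expR (- (y * dlt k)) ^+ i * (y * dlt k * expR (- (y * dlt k))))).
  apply: measurable_funM => //; apply: measurable_funM; first by apply: measurable_funX.
  by apply: measurable_funM => //; exact: measurable_funM.
have term0 k i y : 0 < y -> 0 <= expR (- (y * dlt k)) ^+ i * (y * dlt k * expR (- (y * dlt k))).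
  by move=> y0; apply: mulr_ge0; rewrite ?exprn_ge0 ?expR_ge0// mulr_ge0 ?expR_ge0// mulr_ge0// ltW.
have gwE k y : psi y * grid_weight (dlt k) (4 ^ k) y =
    \sum_(i < 4 ^ k) psi y * (expR (- (y * dlt k)) ^+ i * (y * dlt k * expR (- (y * dlt k)))).
  by rewrite mulr_sumr.
have PU k : P (\bigcup_(i < 4 ^ k) F k i) = I (fun y => psi y * grid_weight (dlt k) (4 ^ k) y).
  rewrite bigcup_mkord measure_bigsetU//; last first.
    move=> i j _ _ [w [Fi Fj]]; apply/eqP; rewrite eqn_leq.
    have one_jump i' j' : F k i' w -> F k j' w -> (i' <= j')%N.
      move=> Fi' Fj'; rewrite leqNgt; apply/negP => ij.
      have [_ su _ Nu _] := grid_event_values HE (a0 0%N) (d0 k) Fi'.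
      have [_ su' _ _ Nud] := grid_event_values HE (a0 0%N) (d0 k) Fj'.
      have u0 : 0 <= s + a 0%N + j'%:R * dlt k + dlt k by apply: addr_ge0 (ltW (d0 k)); exact: le_trans su'.
      have uu : s + a 0%N + j'%:R * dlt k + dlt k <= s + a 0%N + i'%:R * dlt k.
        rewrite -addrA lerD2l -[X in _ + X]mul1r -mulrDl natr1; apply: ler_wpM2r; first exact: ltW.
        by rewrite ler_nat.
      have [_ [_ [_ [_ [/(_ _ _ u0 uu) + _]]]]] := CN.2 w.
      by rewrite Nu Nud lee_fin ler_nat ltnn.
    by rewrite !one_jump.
  transitivity (\sum_(i < 4 ^ k)
      I (fun y => psi y * (expR (- (y * dlt k)) ^+ i * (y * dlt k * expR (- (y * dlt k))))))%E.
    by apply: eq_bigr => i _; exact: PF.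
  rewrite -ge0_integral_sum//; last 2 first.
  - by move=> i; apply/measurable_EFinP; apply: measurable_funTS.
  - move=> i y y0; by rewrite lee_fin; apply: mulr_ge0; [exact: psi0|exact: term0].
  by apply: eq_integral => y _; rewrite gwE sumEFin.
have lhs : P (\bigcup_(i < 4 ^ k) F k i) @[k --> \oo] --> P (E `&` tails (resid N s) r.+1 a).
  apply: cvg_probability_sub.
  - by move=> k; exact: bigcup_measurable.
  - by apply: measurableI => //; apply: measurable_tails => i; exact: measurable_resid.
  - by move=> k w [i _]; apply: (grid_event_sub HE a0).
  - by move=> w; exact: (grid_event_eventually HE a0).
have [|||||_ _ rhs] := @dominated_convergence _ _ _ U [set y | 0 < y] mgt0
  (fun k y => (psi y * grid_weight (dlt k) (4 ^ k) y)%:E) (fun y => (psi y)%:E) (fun y => (phi y)%:E).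
- move=> k; apply/measurable_EFinP; apply: measurable_funTS; under eq_fun do rewrite gwE.
  exact: measurable_sum.
- by apply/measurable_EFinP; exact: measurable_funTS.
- apply: aeW => y y0; apply: cvg_EFin; first by near=> k.
  rewrite -[X in _ --> X]mulr1; apply: cvgM; first exact: cvg_cst.
  exact: cvg_grid_weight.
- exact: cylinder_integrable HE.
- apply: aeW => y k y0; rewrite lee_fin.
  have /andP[g1 g2] := grid_weight_bounds (4 ^ k) (d0 k) y0.
  have g0 : 0 <= grid_weight (dlt k) (4 ^ k) y.
    by apply: sumr_ge0 => i _; exact: term0.
  have psi_le : psi y <= phi y.
    rewrite /psi -[leRHS]mulr1 ler_wpM2l ?(cylinder_weight_ge0 HE)// -expR0 ler_expR oppr_le0.
    by apply: mulr_ge0; [exact: ltW|apply: sumr_ge0 => i _; exact: ltW].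
  have psiy : 0 <= psi y by exact: psi0.
  rewrite ger0_norm; last exact: mulr_ge0.
  apply: le_trans psi_le.
  by rewrite -[leRHS]mulr1; exact: ler_wpM2l.
move: rhs; under eq_fun do rewrite -PU.
move=> rhs; exact: (cvg_unique _ lhs rhs).
Unshelve. all: by end_near. Qed.

End mixed_poisson_waiting_times.

(** * Characterization of exponential laws *)

Section exponential_characterization.
Context {R : realType}.

Lemma continuous_eq0_ratr (g : R -> R) t : 0 < t -> {for t, continuous g} ->
  (forall q : rat, 0 < ratr q :> R -> g (ratr q) = 0) -> g t = 0.
Proof.
move=> t0 gt g0; apply/eqP; apply: contrapT => /negP gt0.
have n1 : \forall x \near t, g x != 0 by exact: (cvgr_neq0 _ gt).
have n2 : \forall x \near t, 0 < x by exact: (@lt_nbhsr _ 0 t).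
have /nbhs_ballP[e /= e0 he] : \forall x \near t, g x != 0 /\ 0 < x by apply: filterS2 n1 n2.
have tte : t < t + e by rewrite ltrDl.
have [q] := rat_in_itvoo tte; rewrite in_itv/= => /andP[tq qe].
have tq_e : ball t e (ratr q : R) by rewrite /ball/= distrC ger0_norm ?subr_ge0 ?ltW//; lra.
by have [+ q0] := he _ tq_e; rewrite g0// eqxx.
Qed.

Variables (F : R -> R) (p : R).
Hypotheses (dF : forall t : R, 0 < t -> derivable F t 1)
  (cF : forall t : R, 0 < t -> derive1 F x @[x --> t] --> derive1 F t)
  (F'gt0 : forall t : R, 0 < t -> 0 < derive1 F t)
  (F'p : derive1 F x @[x --> 0^'+] --> p).

(** Continuity extends the equation S (a + b) = S a S b for S = 1 - F to positive reals.
    Differentiating in b and letting b tend to 0 from the right gives F' a = p S a, so S t exp (p t)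
    is a constant c. Then c^2 = c, and F' > 0 excludes c = 0. *)
Lemma multiplicative_tail_expR :
  (forall q r : rat, 0 < ratr q :> R -> 0 < ratr r :> R ->
     1 - F (ratr q + ratr r) = (1 - F (ratr q)) * (1 - F (ratr r))) ->
  forall t : R, 0 < t -> 1 - F t = expR (- (p * t)).
Proof.
move=> SM.
have dFi (t : R) : 0 < t -> is_derive t (1 : R) F (derive1 F t).
  by move=> t0; rewrite derive1E; apply: DeriveDef => //; exact: dF.
have contF (t : R) : 0 < t -> {for t, continuous F}.
  by move=> t0; apply: differentiable_continuous; apply/derivable1_diffP; exact: dF.
have contD (a t : R) : 0 < a + t -> {for t, continuous (fun x => F (a + x))}.
  move=> at0; apply: (@continuous_comp _ _ _ (fun x => a + x) F); last exact: contF.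
  by apply: continuousD; [exact: cst_continuous|].
have SM1 (q : rat) (b : R) : 0 < ratr q :> R -> 0 < b -> 1 - F (ratr q + b) = (1 - F (ratr q)) * (1 - F b).
  move=> q0 b0; apply/eqP; rewrite -subr_eq0; apply/eqP.
  apply: (@continuous_eq0_ratr (fun b => 1 - F (ratr q + b) - (1 - F (ratr q)) * (1 - F b))) => //.
    apply: cvgB; first by apply: cvgB; [exact: cvg_cst|apply: contD; exact: addr_gt0].
    by apply: cvgM; [exact: cvg_cst|apply: cvgB; [exact: cvg_cst|exact: contF]].
  by move=> r r0; rewrite SM// subrr.
have {SM1}SM (a b : R) : 0 < a -> 0 < b -> 1 - F (a + b) = (1 - F a) * (1 - F b).
  move=> a0 b0; apply/eqP; rewrite -subr_eq0; apply/eqP.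
  apply: (@continuous_eq0_ratr (fun a => 1 - F (a + b) - (1 - F a) * (1 - F b))) => //.
    apply: cvgB; last by apply: cvgM; [apply: cvgB; [exact: cvg_cst|exact: contF]|exact: cvg_cst].
    apply: cvgB; first exact: cvg_cst.
    by under eq_fun do rewrite addrC; rewrite addrC; apply: contD; exact: addr_gt0.
  by move=> r r0; rewrite SM1// subrr.
have F'M (a b : R) : 0 < a -> 0 < b -> derive1 F (a + b) = (1 - F a) * derive1 F b.
  move=> a0 b0; have ab0 := addr_gt0 a0 b0.
  have d1 : is_derive b (1 : R) (fun x => 1 - F (a + x)) (- derive1 F (a + b)).
    have h1 : is_derive b (1 : R) (fun x => a + x) 1.
      rewrite -[X in is_derive _ _ _ X]add0r.
      exact: (is_deriveD (is_derive_cst a b 1) (is_derive_id b 1)).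
    have h2 := dFi _ ab0.
    have := @is_derive1_comp _ F (fun x => a + x) b _ _ h2 h1 => h3.
    rewrite mulr1 in h3.
    rewrite -[X in is_derive _ _ _ X]sub0r.
    have h0 : is_derive b (1 : R) (cst (1 : R)) (0 : R) by exact: is_derive_cst.
    have h4 := is_deriveB h0 h3; refine h4.
  have d2 : is_derive b (1 : R) (fun x => (1 - F a) * (1 - F x)) (- ((1 - F a) * derive1 F b)).
    have h2 := dFi _ b0.
    have h0 : is_derive b (1 : R) (cst (1 : R)) (0 : R) by exact: is_derive_cst.
    rewrite -mulrN -[X in _ * X]sub0r.
    have h4 := is_deriveZ (1 - F a) (is_deriveB h0 h2); refine h4.
  apply: oppr_inj; rewrite -(@derive_val _ _ _ _ _ _ _ d1) -(@derive_val _ _ _ _ _ _ _ d2).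
  apply: near_eq_derive.
  have n2 : \forall x \near b, 0 < x by exact: (@lt_nbhsr _ 0 b).
  by apply: filterS n2 => x x0; exact: SM.
have F'E (a : R) : 0 < a -> derive1 F a = (1 - F a) * p.
  move=> a0.
  have n2 : \forall x \near 0^'+, derive1 F (a + x) = (1 - F a) * derive1 F x.
    by have := @nbhs_right_gt R 0; apply: filterS => x x0; exact: F'M.
  have l1 : derive1 F (a + x) @[x --> 0^'+] --> derive1 F a.
    have l0 : a + x @[x --> 0^'+] --> a + 0.
      by apply: cvgD; [exact: cvg_cst|exact: cvg_at_right_filter].
    by rewrite addr0 in l0; exact: (cvg_comp _ _ l0 (cF a0)).
  have l2 : (1 - F a) * derive1 F x @[x --> 0^'+] --> (1 - F a) * p.
    by apply: cvgM; first exact: cvg_cst.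
  have l3 : derive1 F (a + x) @[x --> 0^'+] --> (1 - F a) * p.
    by apply: cvg_trans l2; apply: near_eq_cvg; apply: filterS n2.
  by apply: (cvg_unique _ l1 l3); exact: norm_hausdorff.
(* The substitution t = exp u maps the whole line onto the positive half-line, so that a zero
   derivative everywhere makes g constant. *)
pose g (u : R) := (1 - F (expR u)) * expR (p * expR u).
have dg (u : R) : is_derive u (1 : R) g 0.
  have e0 := expR_gt0 u.
  have h0 : is_derive (expR u) (1 : R) (cst (1 : R)) (0 : R) by exact: is_derive_cst.
  have h1 := is_deriveB h0 (dFi _ e0).
  have h2 : is_derive (expR u) (1 : R) (fun x => expR (p * x)) (p * expR (p * expR u)).
    have := @is_derive1_comp _ expR (fun x => p * x) (expR u) _ _ (is_derive_expR _) (is_deriveZ p (is_derive_id (expR u) 1)).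
    by rewrite /GRing.scale/= mulr1 mulrC.
  have h3 := is_deriveM h1 h2.
  have h4 := @is_derive1_comp _ _ expR u _ _ h3 (is_derive_expR u).
  suff -> : (0 : R) = ((1 - F (expR u)) * (p * expR (p * expR u)) +
      expR (p * expR u) * (0 - derive1 F (expR u))) * expR u by refine h4.
  by rewrite F'E//; ring.
have gc (t : R) : 0 < t -> (1 - F t) * expR (p * t) = g 0.
  by move=> t0; rewrite -(is_derive_0_is_cst (ln t) 0 dg) /g lnK.
have St (t : R) : 0 < t -> 1 - F t = g 0 * expR (- (p * t)).
  by move=> t0; rewrite -(gc t t0) -mulrA -expRD subrr expR0 mulr1.
have c0 : g 0 != 0.
  apply/eqP => c0; have := F'gt0 (@ltr01 R); rewrite F'E// St// c0 !mul0r ltxx; exact/negP.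
suff c1 : g 0 = 1 by move=> t t0; rewrite St// c1 mul1r.
have := SM 1 1 (@ltr01 R) (@ltr01 R); rewrite !St ?addr_gt0//.
have -> : - (p * (1 + 1)) = - (p * 1) + - (p * 1) by ring.
rewrite expRD; have := expR_gt0 (- (p * 1)); set e := expR _ => e0.
move=> ge; apply: (mulfI c0); apply: (mulIf (mulf_neq0 (lt0r_neq0 e0) (lt0r_neq0 e0))).
by rewrite mulr1 ge mulrACA.
Qed.

Lemma exponential_derive1_limit (al : R) :
  (forall t : R, 0 < t -> F t = 1 - expR (- al * t)) -> p = al.
Proof.
move=> FE.
have F'E (t : R) : 0 < t -> derive1 F t = al * expR (- al * t).
  move=> t0; rewrite derive1E (@near_eq_derive _ _ _ _ (fun t => 1 - expR (- al * t))); last first.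
    have n2 : \forall x \near t, 0 < x by exact: (@lt_nbhsr _ 0 t).
    by apply: filterS n2 => x x0; exact: FE.
  have h0 : is_derive t (1 : R) (cst (1 : R)) (0 : R) by exact: is_derive_cst.
  have h1 := @is_derive1_comp _ expR (fun x => - al * x) t _ _ (is_derive_expR _) (is_deriveZ (- al) (is_derive_id t 1)).
  have h2 := is_deriveB h0 h1.
  rewrite (@derive_val _ _ _ _ _ _ _ h2) sub0r /GRing.scale/= mulr1; ring.
have l1 : al * expR (- al * x) @[x --> 0^'+] --> al * expR (- al * 0).
  apply: cvgM; first exact: cvg_cst.
  apply: cvg_at_right_filter; apply: continuous_comp; last exact: continuous_expR.
  by apply: continuousM; [exact: cst_continuous|].
rewrite mulr0 expR0 mulr1 in l1.
have l2 : derive1 F x @[x --> 0^'+] --> al.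
  apply: cvg_trans l1; apply: near_eq_cvg.
  by have := @nbhs_right_gt R 0; apply: filterS => x x0; rewrite F'E.
by apply: (cvg_unique _ F'p l2); exact: norm_hausdorff.
Qed.

End exponential_characterization.

Lemma exponential_law_of_tail {R : realType} (la : R) (la0 : 0 < la) (m : probability R R) :
  (forall t : R, 0 < t -> m `]t, +oo[%classic = (expR (- (la * t)))%:E) ->
  forall B, measurable B -> m B = exponential_prob la B.
Proof.
move=> mt B mB; rewrite -(expoE la0); apply: ray_unique => // a.
transitivity ((expo_tail la a)%:E : \bar R); last exact/esym/expo_gt.
rewrite /expo_tail; case: (ltP 0 a) => [a0|a0]; first by rewrite mulNr; exact: mt.
rewrite mulr0 expR0; suff : m `]a, +oo[%classic = 1%E by [].
apply/eqP; rewrite eq_le probability_le1//=.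
(* The tail is known only at positive points; at t = e / la it is exp (- e) >= 1 - e, which bounds
   the tail at a <= 0 from below. *)
apply/lee_addgt0Pr => e e0; have t0 : 0 < e / la by rewrite divr_gt0.
set t := e / la in t0.
have h : (m `]t, +oo[%classic <= m `]a, +oo[%classic)%E.
  by apply: le_measure; rewrite ?inE//; apply: subset_itvr; rewrite bnd_simp; exact: le_trans a0 (ltW t0).
apply: le_trans (leeD2r _ h); rewrite mt// -EFinD lee_fin.
have := expR_ge1Dx (- (la * (e / la))); rewrite /t mulrCA mulfV ?lt0r_neq0// mulr1; lra.
Qed.

(** * Disintegrations and conditional probabilities *)

Section conditional_probability.
Context {R : realType} {d : measure_display} {Om : measurableType d}.

Lemma probability_setI1 (m : probability Om R) A B : measurable A -> measurable B ->
  m B = 1%E -> m (A `&` B) = m A.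
Proof.
move=> mA mB mB1; have mC : m (~` B) = 0%E by rewrite probability_setC// mB1 subee.
have mAB : m (A `\` B) = 0%E.
  by apply: subset_measure0 mC; [exact: measurableD|exact: measurableC|move=> x []].
by rewrite [RHS](measureDI m mA mB) [X in (X + _)%E]mAB add0e.
Qed.

Variables (P : probability Om R) (X : Om -> R).
Hypothesis mX : measurable_fun setT X.

Lemma preimage_measurable (C : set R) : measurable C -> measurable (X @^-1` C).
Proof. by move=> mC; rewrite -[X in measurable X]setTI; exact: mX. Qed.

Lemma ae_pushforward (A : R -> Prop) : {ae push P mX, forall y, A y} -> {ae P, forall w, A (X w)}.
Proof.
by move=> [B [mB PB AB]]; exists (X @^-1` B); split => //; [exact: preimage_measurable|move=> w; exact: AB].
Qed.

Lemma pushforward_ae (A : set R) : measurable A -> {ae P, forall w, A (X w)} -> {ae push P mX, forall y, A y}.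
Proof.
move=> mA AX; exists (~` A); split => //; first exact: measurableC.
apply: (@measure_negligible _ _ _ P); first by apply: preimage_measurable; exact: measurableC.
exact: AX.
Qed.

Lemma pushforward_ae_eq (D : set R) (F G : R -> R) : measurable D -> measurable_fun D F -> measurable_fun D G ->
  {ae P, forall w, F (X w) = G (X w)} -> {ae push P mX, forall y, D y -> F y = G y}.
Proof.
move=> mD mF mG FG.
suff : {ae push P mX, forall y, (~` (D `&` [set y | F y != G y])) y}.
  by apply: filterS => y + Dy; apply: contra_notP => /eqP.
apply: pushforward_ae; last by apply: filterS FG => w FGw [_ /=]; rewrite FGw eqxx.
apply: measurableC; rewrite (_ : mkset _ = [set y | (F y)%:E != (G y)%:E]).
  by apply: measurable_neqe => //; exact/measurable_EFinP.
by apply/seteqP; split => y /=; rewrite eqe.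
Qed.

Lemma sigma_meas_measurable (g : Om -> R) : sigma_meas X g -> measurable_fun setT g.
Proof. by move=> sg _ U /sg[B [mB ->]]; rewrite setTI; exact: preimage_measurable. Qed.

(** The set where f' < f is the preimage under X of a Borel set, as a union over rationals q of {f >
    q} and {f' < q}. Both versions have the same integral over it, so it is null; then the roles are
    exchanged. *)
Lemma cond_prob_version_unique E (g g' : Om -> R) :
  cond_prob_version P X E g -> cond_prob_version P X E g' -> {ae P, forall w, g w = g' w}.
Proof.
suff H (f f' : Om -> R) : cond_prob_version P X E f -> cond_prob_version P X E f' -> {ae P, forall w, f w <= f' w}.
  by move=> hg hg'; apply: filterS2 (H _ _ hg hg') (H _ _ hg' hg) => w h1 h2; apply/eqP; rewrite eq_le h1.
move=> [sf [If Hf]] [sf' [If' Hf']].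
have /choice[B1 HB1] : forall q : rat, exists B, measurable B /\ f @^-1` `]ratr q, +oo[ = X @^-1` B by move=> q; exact: sf.
have /choice[B2 HB2] : forall q : rat, exists B, measurable B /\ f' @^-1` `]-oo, ratr q[ = X @^-1` B by move=> q; exact: sf'.
pose C := \bigcup_q (B1 q `&` B2 q).
have mC : measurable C by apply: bigcupT_measurable_rat => q; apply: measurableI; [have [] := HB1 q|have [] := HB2 q].
have CE w : C (X w) <-> f' w < f w.
  split.
    move=> [q _ [b1 b2]].
    have : (X @^-1` B1 q) w by []. rewrite -(HB1 q).2 /= in_itv/= andbT => qf.
    have : (X @^-1` B2 q) w by []. rewrite -(HB2 q).2 /= in_itv/= => fq.
    exact: lt_trans fq qf.
  move=> /rat_in_itvoo[q]; rewrite in_itv/= => /andP[fq qf]; exists q => //; split.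
    by have : (X @^-1` B1 q) w by rewrite -(HB1 q).2 /= in_itv/= qf.
  by have : (X @^-1` B2 q) w by rewrite -(HB2 q).2 /= in_itv/= fq.
have mA := preimage_measurable mC.
have mf := sigma_meas_measurable sf; have mf' := sigma_meas_measurable sf'.
have IfA : P.-integrable (X @^-1` C) (EFin \o f) by apply: integrableS If.
have IfA' : P.-integrable (X @^-1` C) (EFin \o f') by apply: integrableS If'.
have int0 : (\int[P]_(w in X @^-1` C) `|(f w)%:E - (f' w)%:E| = 0)%E.
  rewrite (eq_integral (fun w => (EFin \o f) w - (EFin \o f') w)%E); last first.
    by move=> w /[!inE] /CE ff' /=; rewrite ger0_norm// subr_ge0 ltW.
    transitivity (\int[P]_(w in X @^-1` C) (f w)%:E - \int[P]_(w in X @^-1` C) (f' w)%:E)%E.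
    exact: integralB.
  by rewrite Hf'// -Hf// subee//; exact: integrable_fin_num IfA.
have mfun : measurable_fun (X @^-1` C) (fun w => (f w)%:E - (f' w)%:E)%E.
  by apply: emeasurable_funB; apply/measurable_EFinP; exact: measurable_funTS.
have /(ae_eq_integral_abs _ mA mfun) := int0.
apply: filterS => w; apply: contraPP => /negP; rewrite -ltNge => /CE Cw /(_ Cw) /= /eqP.
by move/CE : Cw => ff'; rewrite -EFinB eqe subr_eq0 gt_eqF.
Qed.

Variables (D : set R) (Pf : R -> probability Om R).
Hypotheses (mD : measurable D) (XD : forall w, D (X w)).
Hypotheses (dis : disintegration P Pf (pushforward P X) D) (cons : consistent Pf (pushforward P X) D X).

(** By consistency, applied to C and to its complement in D, P_y (X in C) is the indicator of C at y
    for almost every y. Intersecting E with {X in C} under P_y thus only restricts the integral to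
    C. *)
Lemma disintegration_preimage E (C : set R) : measurable E -> measurable C ->
  (\int[P]_(w in X @^-1` C) Pf (X w) E = P (E `&` X @^-1` C))%E.
Proof.
move=> mE mC; have mXC := preimage_measurable mC.
have mEC := measurableI _ _ mE mXC.
have [mfE _] := dis mE; have [mfEC <-] := dis mEC.
transitivity (\int[push P mX]_(y in D) ((fun y => Pf y E) \_ C) y)%E; last first.
  apply: ge0_ae_eq_integral => //.
  - apply/measurable_restrict => //; apply: measurable_funS mfE => //; exact: subIsetl.
  - by move=> y _; rewrite /patch; case: ifP.
  have c1 : {ae push P mX, forall y, (C `&` D) y -> Pf y (X @^-1` (C `&` D)) = 1%E} := cons (measurableI _ _ mC mD) (@subIsetr _ _ _).
  have c2 : {ae push P mX, forall y, (D `\` C) y -> Pf y (X @^-1` (D `\` C)) = 1%E} := cons (measurableD mD mC) (@subDsetl _ _ _).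
  apply: filterS2 c1 c2 => y h1 h2 Dy; rewrite /patch.
  have XE (w : Om) : D (X w) by [].
  case: ifPn => [/set_mem Cy|/negP Cy].
    have h := h1 (conj Cy Dy); apply/esym/probability_setI1 => //.
    by rewrite -h; congr (Pf y _); apply/seteqP; split => w //= [].
  have {}Cy : ~ C y by move=> Cy'; apply: Cy; exact: mem_set.
  have h := h2 (conj Dy Cy).
  have h' : Pf y (X @^-1` C) = 0%E.
    rewrite -[X in Pf y X]setCK probability_setC; last exact: measurableC.
    rewrite (_ : ~` _ = X @^-1` (D `\` C)) ?h ?subee//.
    by apply/seteqP; split => w //= [].
  by apply/esym; apply: subset_measure0 h' => //; exact: subIsetr.
rewrite -integral_mkcondr (ge0_integral_pushforward mX)//.
- rewrite (_ : X @^-1` (D `&` C) = X @^-1` C)//.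
  by apply/seteqP; split => w //= [].
- exact: measurableI.
- by apply: measurable_funS mfE => //; exact: subIsetl.
Qed.

Lemma disintegration_version E : measurable E ->
  cond_prob_version P X E (fun w => fine (Pf (X w) E)).
Proof.
move=> mE; have [mfE _] := dis mE.
have sm : sigma_meas X (fun w => fine (Pf (X w) E)).
  move=> U mU; exists (D `&` ((fun y => Pf y E) @^-1` (EFin @` U))); split.
    apply: mfE => //; exact: measurable_image_EFin.
  apply/seteqP; split => w /=.
    by move=> Uw; split => //; exists (fine (Pf (X w) E)) => //; rewrite fineK// fin_num_measure.
  by move=> [_ [x Ux]] <-.
split => //; split.
  apply: (@measurable_bounded_integrable _ _ _ P) => //.
  - by rewrite (le_lt_trans (probability_le1 _ _))// ltry.
  - exact: sigma_meas_measurable.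
  - exists 1; split => // x x1 w _ /=; rewrite ger0_norm ?fine_ge0//; apply: le_trans (ltW x1).
    by rewrite -lee_fin fineK ?fin_num_measure// probability_le1.
move=> C mC; rewrite -disintegration_preimage//; apply: eq_integral => w _.
by rewrite fineK// fin_num_measure.
Qed.

End conditional_probability.

(** * Countable families of almost sure statements and measurable limits *)

Section limits_and_countable_families.
Context {R : realType}.

Lemma ae_forall_countable {d} {T : measurableType d} (mu : {measure set T -> \bar R})
    (I : countType) (A : I -> T -> Prop) :
  (forall i, {ae mu, forall w, A i w}) -> {ae mu, forall w, forall i, A i w}.
Proof.
move=> h; have : {ae mu, forall w, forall n, (if unpickle n is Some i then A i w else True)}.
  by apply: ae_foralln => n; case: unpickle => [i|]; [exact: h|exact: aeW].
by apply: filterS => w hw i; have := hw (pickle i); rewrite pickleK.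
Qed.

(** The limit is an iterated sequential limit, along 1 / (n + 1), of difference quotients that are
    measurable in x. *)
Lemma measurable_right_derivative_limit {d} {T : measurableType d} (A : set T) (F : T -> R -> R) (p : T -> R) :
  (forall t, measurable_fun A (F^~ t)) ->
  (forall x, A x -> forall t : R, 0 < t -> derivable (F x) t 1) ->
  (forall x, A x -> derive1 (F x) t @[t --> 0^'+] --> p x) -> measurable_fun A p.
Proof.
move=> mF dF F'p.
have harmonic_right (g : R -> R) (l : R) : g x @[x --> 0^'+] --> l -> g (harmonic n) @[n --> \oo] --> l.
  by move=> /cvg_at_rightP h; apply: h; split => [n|]; [rewrite invr_gt0|exact: cvg_harmonic].
apply: (@measurable_fun_cvg _ _ _ _ (fun n x => derive1 (F x) (harmonic n))); last first.
  by move=> x Ax; apply: harmonic_right; exact: F'p.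
move=> n; set t : R := harmonic n; have t0 : 0 < t by rewrite invr_gt0.
apply: (@measurable_fun_cvg _ _ _ _ (fun m x => (harmonic m)^-1 * (F x (harmonic m + t) - F x t))).
  by move=> m; apply: measurable_funM; [exact: measurable_cst|exact: measurable_funB].
move=> x Ax; have := dF x Ax t t0.
rewrite derive1E /derive => dFx.
have h : (fun h : R => h^-1 *: (F x (h *: (1 : R) + t) - F x t)) @ 0^' --> 'D_1 (F x) t by exact: dFx.
have {}h := harmonic_right _ _ (cvg_dnbhs_at_right h).
apply: cvg_trans h; apply: near_eq_cvg; near=> m; by rewrite /GRing.scale/= mulr1.
Unshelve. all: by end_near. Qed.

End limits_and_countable_families.

(** * Transport of the disintegration along an injective reparametrization *)

Section reparametrization.
Context {R : realType} {d : measure_display} {Om : measurableType d}.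
Variables (P : probability Om R) (Th : Om -> R) (D : set R) (Pf : R -> probability Om R).
Variables (A : set R) (ph : R -> R) (Thh : Om -> R) (Q : R -> probability Om R).
Hypotheses (mTh : measurable_fun setT Th) (mD : measurable D) (DTh : forall w, D (Th w)).
Hypotheses (dis : disintegration P Pf (pushforward P Th) D) (cons : consistent Pf (pushforward P Th) D Th).
Hypotheses (mA : measurable A) (AD : A `<=` D) (PA : {ae P, forall w, A (Th w)}).
Hypotheses (mph : measurable_fun A ph) (ph_inj : forall a b, A a -> A b -> ph a = ph b -> a = b).
Hypotheses (mThh : measurable_fun setT Thh) (ThhE : forall w, A (Th w) -> Thh w = ph (Th w)).
Hypothesis QE : forall (y : R) (E : set Om), measurable E ->
  (forall th, A th -> ph th = y -> Q y E = Pf th E) /\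
  ((forall th, A th -> ph th <> y) -> Q y E = P E).

Lemma image_ph_measurable B : measurable B -> B `<=` A -> measurable (ph @` B).
Proof.
move=> mB BA.
rewrite (_ : ph @` B = (ph \_ A) @` B).
  apply: injective_image_measurable => //.
    by apply/measurable_restrict => //; rewrite setTI.
  move=> a b /set_mem/BA Aa /set_mem/BA Ab; rewrite /patch !mem_set//; exact: ph_inj.
apply/seteqP; split => _ [x Bx <-]; exists x => //; rewrite /patch mem_set//; exact: BA.
Qed.

Lemma ae_Q E : measurable E -> {ae P, forall w, Q (Thh w) E = Pf (Th w) E}.
Proof.
by move=> mE; apply: filterS PA => w Aw; apply: (QE _ mE).1 => //; rewrite ThhE.
Qed.

(** Over the range of ph the preimage is the image of a Borel subset of A; off the range Q y E has
    the constant value P E. *)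
Lemma measurable_Q E : measurable E -> measurable_fun setT (fun y => Q y E).
Proof.
move=> mE _ U mU; rewrite setTI.
have mG : measurable (ph @` A) by exact: image_ph_measurable.
have mAE : measurable (A `&` (fun th => Pf th E) @^-1` U).
  by have [mfE _] := dis mE; apply: (measurable_funS mD AD mfE).
rewrite (_ : _ @^-1` U = ph @` (A `&` (fun th => Pf th E) @^-1` U) `|` (~` (ph @` A) `&` [set y | U (P E)])).
  apply: measurableU; first by apply: image_ph_measurable => //; exact: subIsetl.
  apply: measurableI; first exact: measurableC.
  have [UP|UP] := pselect (U (P E)).
    by rewrite (_ : mkset _ = setT); [exact: measurableT|apply/seteqP; split].
  by rewrite (_ : mkset _ = set0); [exact: measurable0|apply/seteqP; split].
apply/seteqP; split => y /=.
  have [[th Ath thy]|nG] := pselect ((ph @` A) y).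
    by rewrite ((QE y mE).1 th)// => UPf; left; exists th.
  rewrite ((QE y mE).2)// => [UP|th Ath thy]; first by right.
  by apply: nG; exists th.
move=> [[th [Ath UPf] thy]|[nG UP]]; first by rewrite ((QE y mE).1 th).
by rewrite ((QE y mE).2)// => th Ath thy; apply: nG; exists th.
Qed.

Lemma reparametrized_disintegration : disintegration P Q (pushforward P Thh) setT.
Proof.
move=> E mE; split; first exact: measurable_Q.
rewrite (ge0_integral_pushforward mThh)//; last exact: measurable_Q.
have [mfE <-] := dis mE.
rewrite (ge0_integral_pushforward mTh)//.
rewrite preimage_setT (_ : Th @^-1` D = setT); last by apply/seteqP; split=> w _ /=.
apply: ge0_ae_eq_integral => //.
- exact: (measurableT_comp (measurable_Q mE) mThh).
- by apply: (@measurable_comp _ _ _ _ _ _ D _ _ _ mD) => // _ [w _ <-].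
- by apply: filterS (ae_Q mE) => w h _.
Qed.

Lemma reparametrized_consistent : consistent Q (pushforward P Thh) setT Thh.
Proof.
move=> B mB _; have mE := preimage_measurable mThh mB.
(* The event {Th in C} is contained in {Thh in B}, so consistency with Th at C gives consistency
   with Thh at B. *)
pose C := A `&` ph @^-1` B; have mC : measurable C by exact: mph.
have CD : C `<=` D by move=> y [/AD].
have c1 : {ae push P mTh, forall y, C y -> Pf y (Th @^-1` C) = 1%E} := cons mC CD.
suff : {ae push P mThh, forall y, (~` (B `&` ~` ((fun y => Q y (Thh @^-1` B)) @^-1` [set 1%E]))) y}.
  by apply: filterS => y + By; apply: contra_notP.
apply: pushforward_ae.
  apply: measurableC; apply: measurableI => //; apply: measurableC.
  by rewrite -[X in measurable X]setTI; apply: measurable_Q.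
apply: filterS3 (ae_pushforward c1) (ae_Q mE) PA => w h QPf Aw [Bw /=]; apply.
rewrite QPf; apply/eqP; rewrite eq_le probability_le1//=.
rewrite -(h (conj Aw _)); last by rewrite /= -ThhE.
apply: le_measure; rewrite ?inE//; first exact: preimage_measurable.
by move=> v [Av Bv]; rewrite /= ThhE.
Qed.

Lemma reparametrized_product_rule s (E : nat -> set Om) : (forall i, i \in s -> measurable (E i)) ->
  {ae P, forall w, fine (Pf (Th w) (\bigcap_(i in [set i | i \in s]) E i)) = \prod_(i <- s) fine (Pf (Th w) (E i))} ->
  {ae push P mThh, forall y, product_rule (Q y) s E}.
Proof.
move=> mE rule; have mcap := bigcap_seq_measurable mE.
have mQf B : measurable B -> measurable_fun setT (fun y => fine (Q y B)).
  by move=> mB; apply: (measurableT_comp _ (measurable_Q mB)); exact: fine_measurable.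
have mG : measurable_fun setT (fun y => \prod_(i <- s) fine (Q y (E i))).
  rewrite (_ : (fun y => _) = (fun y => \prod_(i <- s) (if i \in s then fine (Q y (E i)) else 1))).
    apply: measurable_prod => i _; have [si|_] := boolP (i \in s); last exact: measurable_cst.
    exact: mQf (mE i si).
  by apply/funext => y; rewrite !big_seq; apply: eq_bigr => i ->.
have all_Q : {ae P, forall w, forall i, i \in s -> Q (Thh w) (E i) = Pf (Th w) (E i)}.
  apply: ae_foralln => i; have [si|_] := boolP (i \in s); last exact: aeW.
  by apply: filterS (ae_Q (mE i si)) => w.
have := @pushforward_ae_eq _ _ _ P Thh mThh setT _ _ measurableT (mQf _ mcap) mG.
have h : {ae P, forall w, fine (Q (Thh w) (\bigcap_(i in [set i | i \in s]) E i)) = \prod_(i <- s) fine (Q (Thh w) (E i))}.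
  apply: filterS3 rule (ae_Q mcap) all_Q => w + QE1 QE2; rewrite QE1 => ->.
  by rewrite !big_seq; apply: eq_bigr => i si; rewrite QE2.
move=> /(_ h); apply: filterS => y /(_ Logic.I) {}h.
by rewrite /product_rule -h fineK// fin_num_measure.
Qed.

Lemma reparametrized_indep (Idx : nat -> Prop) (W : nat -> Om -> R) :
  (forall i, measurable_fun setT (W i)) -> cond_indep P Th Idx (fun i x => [set w | W i w <= x]) ->
  {ae push P mThh, forall y, indep (Q y) Idx (fun i x => [set w | W i w <= x])}.
Proof.
move=> mW CI.
have mEv i x : measurable [set w | W i w <= x].
  rewrite (_ : mkset _ = W i @^-1` `]-oo, x]); first exact: preimage_measurable.
  by apply/seteqP; split => w /=; rewrite in_itv.
(* Thresholds are read off a finite list, because the functions from nat to rat are uncountable. *)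
have rule : {ae push P mThh, forall y, forall sz : seq nat * seq rat, uniq sz.1 -> (forall i, i \in sz.1 -> Idx i) ->
    product_rule (Q y) sz.1 (fun i => [set w | W i w <= ratr (nth 0 sz.2 i)])}.
  apply: ae_forall_countable => -[s z] /=.
  have [us|_] := boolP (uniq s); last exact: aeW.
  have [sI|] := pselect (forall i, i \in s -> Idx i); last by move=> ns; apply: aeW.
  pose E i := [set w | W i w <= ratr (nth 0 z i)].
  have h := CI s (fun i => ratr (nth 0 z i)) _ (fun i w => fine (Pf (Th w) (E i))) us sI
    (disintegration_version mTh mD DTh dis cons (bigcap_seq_measurable (fun i _ => mEv i _)))
    (fun i _ => disintegration_version mTh mD DTh dis cons (mEv i _)).
  by apply: filterS (reparametrized_product_rule (fun i _ => mEv i _) h).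
apply: filterS rule => y rule s x us sI.
apply: (@indep_ratr _ _ _ (Q y) Idx W (fun i _ => mW i) _ s (fun i => [set z | z <= x i])) => //; last first.
  move=> i; rewrite (_ : mkset _ = `]-oo, x i]%classic); first exact: measurable_itv.
  by apply/seteqP; split => w /=; rewrite in_itv.
move=> s' q us' sI'.
apply: (@eq_product_rule _ _ _ _ _ (fun i => [set w | W i w <= ratr (nth 0 (mkseq q (\max_(i <- s') i).+1) i)])).
  by move=> i si; rewrite nth_mkseq// ltnS; exact: leq_bigmax_seq.
exact: (rule (s', mkseq q (\max_(i <- s') i).+1)).
Qed.

End reparametrization.

(** * Measurability of Poisson probabilities in the rate *)

Section poisson_law.
Context {R : realType}.

Lemma poisL_set1 (lam : R) n : poisL lam [set n%:R%:E] = (expR (- lam) * lam ^+ n / n`!%:R)%:E.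
Proof.
rewrite /poisL; apply: lim_near_cst => //; exists n.+1 => // m /= nm.
rewrite (bigD1_seq n)/= ?iota_uniq//; last by rewrite mem_index_iota.
rewrite indicE mem_set// mul1r big1 ?adde0//.
move=> k kn; rewrite indicE memNset ?mul0r// => -[/eqP]; rewrite eqr_nat => /eqP h.
by rewrite h eqxx in kn.
Qed.

(* For [y * t < 0] the terms alternate in sign, so only absolute convergence is available;
   these values are needed since [sigma_meas] involves every value of the mixing variable. *)
Lemma measurable_poisL (B : set (\bar R)) (t : R) : measurable_fun setT (fun y : R => poisL (y * t) B).
Proof.
pose u (k : nat) (y : R) : R := \1_B (k%:R%:E : \bar R) * (expR (- (y * t)) * (y * t) ^+ k / k`!%:R).
have mu k : measurable_fun setT (u k).
  have myt : measurable_fun setT (fun y : R => y * t) by exact: measurable_funM.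
  apply: measurable_funM => //; apply: measurable_funM => //; apply: measurable_funM; last exact: measurable_funX.
  by apply: measurableT_comp => //; exact: measurableT_comp.
have cu y : cvgn (series (u ^~ y)).
  apply: normed_cvg; apply: (@series_le_cvg _ _ (fun k => expR (- (y * t)) * (`|y * t| ^+ k / k`!%:R))).
  - by move=> k /=.
  - by move=> k; rewrite mulr_ge0 ?expR_ge0// divr_ge0// exprn_ge0.
  - move=> k /=; rewrite /u -mulrA !normrM normfV normrX (ger0_norm (expR_ge0 _)) [`|k`!%:R|]ger0_norm//.
    rewrite -normrM; apply: ler_piMl; first by rewrite mulr_ge0 ?expR_ge0// divr_ge0// exprn_ge0.
    by rewrite indicE; case: (_ \in _); rewrite ?normr1 ?normr0.
  - apply: is_cvg_seriesZ; exact: is_cvg_series_exp_coeff.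
apply: (@emeasurable_fun_cvg _ _ _ setT (fun n y => \sum_(0 <= k < n) (u k y)%:E)%E (fun y => poisL (y * t) B)).
  by move=> n; apply: emeasurable_sum => k; exact/measurable_EFinP.
move=> y _; rewrite /poisL.
have : cvgn (EFin \o series (u^~ y)).
  by apply/cvg_ex; exists (limn (series (u^~ y)))%:E; apply: cvg_EFin; [exact: nearW|exact: cu].
rewrite (_ : EFin \o _ = (fun n => \sum_(0 <= k < n) (u k y)%:E)%E); first exact.
by apply/funext => n; rewrite /series/= sumEFin.
Qed.

Lemma measurable_fine_poisL (B : set (\bar R)) (t : R) :
  measurable_fun setT (fun y : R => fine (poisL (y * t) B)).
Proof. by apply: (measurableT_comp _ (measurable_poisL B t)); exact: fine_measurable. Qed.

End poisson_law.

Section version_congruence.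
Context {R : realType} {d : measure_display} {Om : measurableType d}.
Variables (P : probability Om R) (X : Om -> R).
Hypothesis mX : measurable_fun setT X.

Lemma sigma_meas_comp (f : R -> R) : measurable_fun setT f -> sigma_meas X (f \o X).
Proof. by move=> mf U mU; exists (f @^-1` U); split => //; rewrite -[X in measurable X]setTI; exact: mf. Qed.

Lemma eq_cond_prob_version E (g g' : Om -> R) : cond_prob_version P X E g -> sigma_meas X g' ->
  {ae P, forall w, g w = g' w} -> cond_prob_version P X E g'.
Proof.
move=> [sg [Ig Hg]] sg' gg'; split => //.
have mg := sigma_meas_measurable mX sg; have mg' := sigma_meas_measurable mX sg'.
have mEg : measurable_fun setT (EFin \o g) by exact/measurable_EFinP.
have mEg' : measurable_fun setT (EFin \o g') by exact/measurable_EFinP.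
split.
  apply/integrableP; split => //; have /integrableP[_] := Ig.
  rewrite (@ae_eq_integral _ _ _ P setT (fun w => `|(EFin \o g') w|)%E)//.
  - exact: measurableT_comp.
  - exact: measurableT_comp.
  - by apply: filterS gg' => w h _ /=; rewrite h.
move=> C mC; rewrite -Hg//; apply: ae_eq_integral => //.
- exact: preimage_measurable.
- exact: measurable_funTS.
- exact: measurable_funTS.
- by apply: filterS gg' => w h _ /=; rewrite h.
Qed.

End version_congruence.

(** * Equivalence of the four conditions *)

Section mixed_poisson_equivalence.
Context {R : realType} {d : measure_display} {Om : measurableType d}.
Variables (P : probability Om R) (N : R -> Om -> \bar R) (X : Om -> R) (Q : R -> probability Om R).
Hypotheses (CN : CountingProcess N) (mX : measurable_fun setT X).
Hypotheses (dis : disintegration P Q (pushforward P X) setT) (cons : consistent Q (pushforward P X) setT X).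

Local Notation PX := (push P mX).
Local Notation indepW y := (indep (Q y) (fun n => (1 <= n)%N) (fun n x => [set w | interW N n w <= x])).

Definition common_cdf (L : probability R R) (t : R) : R := fine (L [set x | x <= t]).

(** Standing Assumption A at theta, expressed through y = p_h(theta) alone: the density of the
    common law tends to y itself at 0+. *)
Definition smooth_interarrivals (y : R) : Prop := exists L : probability R R,
  [/\ forall n, (1 <= n)%N -> forall B, measurable B -> Q y (interW N n @^-1` B) = L B,
    forall t : R, 0 < t -> derivable (common_cdf L) t 1,
    forall t : R, 0 < t -> derive1 (common_cdf L) x @[x --> t] --> derive1 (common_cdf L) t,
    forall t : R, 0 < t -> 0 < derive1 (common_cdf L) t &
    derive1 (common_cdf L) x @[x --> 0^'+] --> y].

Definition exp_interarrivals (y : R) : Prop :=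
  [/\ 0 < y, indepW y &
    forall n, (1 <= n)%N -> forall B, measurable B -> Q y (interW N n @^-1` B) = exponential_prob y B].

Hypotheses (X_gt0 : {ae PX, forall y : R, 0 < y}) (Q_indep : {ae PX, forall y, indepW y})
  (Q_smooth : {ae PX, forall y, smooth_interarrivals y}).

Lemma common_cdf_tail (L : probability R R) (t : R) : fine (L `]t, +oo[%classic) = 1 - common_cdf L t.
Proof.
rewrite /common_cdf (_ : [set x | x <= t] = ~` `]t, +oo[%classic); last first.
  by apply/seteqP; split => x /=; rewrite in_itv/= andbT leNgt => /negP.
have -> : L (~` `]t, +oo[%classic) = (1 - L `]t, +oo[%classic)%E by apply: probability_setC.
by rewrite fineB ?fin_num_measure//= opprB addrCA subrr addr0.
Qed.

Lemma MPPmix_exp_interarrivals : MPPmix P N Q PX -> {ae PX, forall y, exp_interarrivals y}.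
Proof.
move=> [alpha [a0 [_ [hQ _]]]]; apply: filterS3 hQ Q_smooth X_gt0 => y [ind law] [L [LW dF cF F0 Fy]] y0.
split => // n n1 B mB; rewrite (law n n1 B mB); congr (exponential_prob _ B); apply/esym.
apply: (exponential_derive1_limit Fy) => t t0.
apply/eqP; rewrite -subr_eq0 opprB addrCA -[X in _ + X]opprB -common_cdf_tail subr_eq0; apply/eqP.
rewrite -(LW 1%N)//.
have e : Q y (interW N 1 @^-1` `]t, +oo[%classic) = (expo_tail (alpha y) t)%:E.
  by rewrite law// -(expoE (a0 y)); exact: expo_gt.
by rewrite e /= /expo_tail max_l// ltW.
Qed.

Lemma measurable_Qfine E : measurable E -> measurable_fun setT (fun y => fine (Q y E)).
Proof.
by move=> mE; have [mQ _] := dis mE; apply: (measurableT_comp _ mQ); exact: fine_measurable.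
Qed.

(* Recovers the rate of an exponential law from its distribution function at 1. *)
Definition rate_of_cdf1 (v : R) : R := if 0 < v < 1 then - ln (1 - v) else 1.

Lemma measurable_rate_of_cdf1 : measurable_fun setT rate_of_cdf1.
Proof.
apply: measurable_fun_ifT => //.
  by apply: measurable_and; apply: measurable_fun_ltr.
apply: measurableT_comp => //; apply: measurableT_comp; first exact: measurable_ln.
exact: measurable_funB.
Qed.

Lemma rate_of_cdf1_gt0 v : 0 < rate_of_cdf1 v.
Proof.
by rewrite /rate_of_cdf1; case: ifP => // /andP[v0 v1]; rewrite oppr_gt0 ln_lt0//; lra.
Qed.

Lemma measurable_W_le n (x : R) : measurable [set w | interW N n w <= x].
Proof.
rewrite (_ : mkset _ = interW N n @^-1` `]-oo, x]); last by apply/seteqP; split => w /=; rewrite in_itv.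
by apply: preimage_measurable => //; exact: measurable_interW.
Qed.

Lemma integral_Q E : measurable E -> (\int[PX]_y Q y E = P E)%E.
Proof. by move=> mE; have [_] := dis mE. Qed.

Lemma bigcap_jrange r (E : nat -> set Om) :
  \bigcap_(k in jrange r) E k = \bigcap_(k in [set i | i \in iota 1 r]) E k.
Proof.
rewrite (_ : [set` iota 1 r] = jrange r :> set nat)//.
by apply/seteqP; split => k /=; rewrite /jrange mem_iota add1n ltnS.
Qed.

(** The rate must be positive everywhere and measurable for the sigma-algebra generated by the maps
    y |-> Q_y(E), neither of which is clear for y itself. A function of Q_y(W_1 <= 1) has both
    properties and equals y almost everywhere. *)
Lemma exp_interarrivals_MPPmix : {ae PX, forall y, exp_interarrivals y} -> MPPmix P N Q PX.
Proof.
move=> HE; pose E1 := [set w | interW N 1 w <= 1].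
pose alpha y := rate_of_cdf1 (fine (Q y E1)).
have alphaE y : exp_interarrivals y -> alpha y = y.
  move=> [y0 _ law]; rewrite /alpha.
  suff -> : fine (Q y E1) = 1 - expR (- y).
    rewrite /rate_of_cdf1 subr_gt0 expR_lt1 oppr_lt0 y0/= ltrBlDr ltrDl expR_gt0/=.
    by rewrite opprB addrCA subrr addr0 expRK opprK.
  have -> : E1 = ~` (interW N 1 @^-1` `]1, +oo[%classic).
    by apply/seteqP; split => w; rewrite /E1/= in_itv/= andbT leNgt => /negP.
  rewrite probability_setC; last by apply: preimage_measurable => //; exact: measurable_interW.
  have e : Q y (interW N 1 @^-1` `]1, +oo[%classic) = (expo_tail y 1)%:E.
    by rewrite law// -(expoE y0); exact: expo_gt.
  by rewrite e /= /expo_tail max_l// mulr1.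
exists alpha; split; [|split; [|split]].
- by move=> y; exact: rate_of_cdf1_gt0.
- move=> U mU; apply: sub_sigma_algebra.
  exists E1, (EFin @` (rate_of_cdf1 @^-1` U)); split; first exact: measurable_W_le.
  split.
    by have := measurable_rate_of_cdf1 measurableT mU; rewrite setTI; exact: measurable_image_EFin.
  apply/seteqP; split => y /=; rewrite /alpha.
    by move=> Uy; exists (fine (Q y E1)) => //; rewrite fineK// fin_num_measure//; exact: measurable_W_le.
  by move=> [v Uv] <-.
- apply: filterS HE => y Ey; have [_ ind law] := Ey; split => // n n1 B mB.
  by rewrite alphaE// law.
- move=> r wk _ _.
  have mE : measurable (\bigcap_(k in jrange r) [set w | interW N k w <= wk k]).
    by apply: bigcap_measurableType => k _; exact: measurable_W_le.
  rewrite -integral_Q//; apply: ge0_ae_eq_integral => //.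
  + by have [] := dis mE.
  + apply/measurable_EFinP; apply: measurable_prod => k _; apply: measurable_Qfine; exact: measurable_W_le.
  + by move=> y _; rewrite lee_fin prodr_ge0// => k _; exact: fine_ge0.
  apply: filterS Q_indep => y ind _; rewrite bigcap_jrange ind ?iota_uniq//.
    by rewrite /index_iota subSS subn0.
  by move=> i; rewrite mem_iota => /andP[].
Qed.

Lemma exp_interarrivals_PP : {ae PX, forall y, exp_interarrivals y} -> {ae PX, forall y, PP (Q y) N y}.
Proof.
apply: filterS => y [y0 ind law]; apply: (exp_PP CN y0).
exact: indep_iid_tail.
Qed.

Lemma version_ae E g : measurable E -> cond_prob_version P X E g ->
  {ae P, forall w, g w = fine (Q (X w) E)}.
Proof.
move=> mE hg; apply: (cond_prob_version_unique mX hg).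
exact: (disintegration_version mX measurableT (fun=> I) dis cons mE).
Qed.

Lemma Q_version E : measurable E -> cond_prob_version P X E (fun w => fine (Q (X w) E)).
Proof. exact: (disintegration_version mX measurableT (fun=> I) dis cons). Qed.

Lemma X_gt0_prob : pushforward P X [set y : R | 0 < y] = 1%E.
Proof.
have mg : measurable [set y : R | 0 < y].
  by rewrite (_ : mkset _ = `]0, +oo[%classic)//; apply/seteqP; split => y /=; rewrite in_itv/= andbT.
have /(measure_negligible (measurableC mg)) h : PX.-negligible (~` [set y : R | 0 < y]) := X_gt0.
have {}h : P (X @^-1` (~` [set y : R | 0 < y])) = 0%E := h.
rewrite /pushforward -[X @^-1` _]setCK probability_setC; last first.
  by apply: measurableC; exact: preimage_measurable.
by rewrite preimage_setC in h; rewrite h sube0.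
Qed.

Lemma inc_times_ge0 m t j : inc_times m t -> (j <= m)%N -> 0 <= t j :> R.
Proof.
move=> [_ [t0 tS]]; elim: j => [|j IH] jm; first by rewrite t0.
by apply: le_trans (IH (ltnW jm)) _; apply: ltW; exact: tS.
Qed.

Lemma measurable_incr_preimage m t (hh : R) j B : inc_times m t -> 0 <= hh -> jrange m j -> measurable B ->
  measurable [set w | B (incr N (fun i => t i + hh) j w)].
Proof.
move=> it hh0 /andP[j1 jm] mB; have jm' := leq_trans (leq_pred j) jm.
have := @measurable_incr _ _ _ _ CN (fun i => t i + hh) j.
rewrite !addr_ge0 ?(inc_times_ge0 it)// => /(_ isT isT) /(_ measurableT _ mB).
by rewrite setTI.
Qed.

Lemma incr_addr0 (t : nat -> R) : incr N (fun i => t i + 0) = incr N t.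
Proof. by apply/funext => j; rewrite /incr !addr0. Qed.

Lemma measurable_incr_preimage0 m t j B : inc_times m t -> jrange m j -> measurable B ->
  measurable [set w | B (incr N t j w)].
Proof. by move=> it jm mB; rewrite -incr_addr0; exact: (measurable_incr_preimage it). Qed.

Lemma measurable_ele (x : \bar R) : measurable [set y : \bar R | (y <= x)%E].
Proof.
rewrite (_ : mkset _ = [set` `]-oo, x]]); first exact: emeasurable_itv.
by apply/seteqP; split => y /=; rewrite in_itv.
Qed.

(** [MPP] quantifies over arbitrary versions; each agrees almost surely with the one given by Q, for
    which the claims hold pointwise. *)
Lemma PP_MPP : {ae PX, forall y, PP (Q y) N y} -> MPP P N X.
Proof.
move=> /ae_pushforward HPP; split; first exact: X_gt0_prob.
split; [|split].
- move=> m t it s x g gs us sI hg hgs.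
  have mEv i : i \in s -> measurable [set w | (incr N t i w <= (x i)%:E)%E].
    by move=> si; apply: (measurable_incr_preimage0 it (sI i si) (measurable_ele (x i)%:E)).
  have gsE : {ae P, forall w, forall i, i \in s -> gs i w = fine (Q (X w) [set w | (incr N t i w <= (x i)%:E)%E])}.
    apply: ae_foralln => i; have [si|_] := boolP (i \in s); last exact: aeW.
    by apply: filterS (version_ae (mEv i si) (hgs i si)) => w ->.
  apply: filterS3 (version_ae (bigcap_seq_measurable mEv) hg) gsE HPP => w -> gE [ind _].
  by rewrite (ind m t it s x us sI) /= !big_seq; apply: eq_bigr => i si; rewrite gE.
- move=> m t hh B g g' it hh0 mB hg hg'.
  have mE : measurable (\bigcap_(j in jrange m) [set w | B j (incr N t j w)]).
    by apply: bigcap_measurableType => j jm; exact: (measurable_incr_preimage0 it jm (mB j)).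
  have mE' : measurable (\bigcap_(j in jrange m) [set w | B j (incr N (fun i => t i + hh) j w)]).
    by apply: bigcap_measurableType => j jm; exact: (measurable_incr_preimage it (ltW hh0) jm (mB j)).
  apply: filterS3 (version_ae mE hg) (version_ae mE' hg') HPP => w -> -> [_ [stat _]].
  by rewrite (stat m t hh B it hh0 mB).
- move=> t t0 B mB.
  have mE : measurable (N t @^-1` B).
    by have := measurable_N CN (ltW t0) measurableT mB; rewrite setTI.
  apply: (eq_cond_prob_version mX (Q_version mE)).
    have := sigma_meas_comp X (measurable_fine_poisL B t); exact.
  by apply: filterS HPP => w [_ [_ law]]; rewrite law.
Qed.

(** [MPP] gives the conditional law of [N t] only; stationarity carries it over to increments.
    Shifts must be positive, so an increment starting at time 0 is treated apart. *)
Lemma MPP_marginal m t j k : MPP P N X -> inc_times m t -> jrange m j ->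
  {ae P, forall w, fine (Q (X w) [set v | incr N t j v = k%:R%:E]) = pois (X w) (t j - t j.-1) k}.
Proof.
move=> [_ [_ [ST LAW]]] it jm; have [_ [t0 tS]] := it.
have /andP[j1 jm'] := jm; pose D := t j - t j.-1.
have D0 : 0 < D by rewrite subr_gt0; have := tS j.-1; rewrite prednK//; exact.
pose tt (i : nat) := if i is 0 then 0 else D.
have itt : inc_times 1 tt by split => //; split => // -[].
have hh0 : 0 <= t j.-1 by apply: inc_times_ge0 it _; exact: leq_trans (leq_pred j) jm'.
pose B (i : nat) : set (\bar R) := [set k%:R%:E].
have mB i : measurable (B i) by exact: emeasurable_set1.
have mE0 : measurable (N D @^-1` B 0%N).
  by have := measurable_N CN (ltW D0) measurableT (mB 0%N); rewrite setTI.
have mE : measurable [set v | incr N t j v = k%:R%:E] by exact: (measurable_incr_preimage0 it jm (mB 0%N)).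
have capE (t' : nat -> R) : \bigcap_(i in jrange 1) [set v | B i (incr N t' i v)] = [set v | B 0%N (incr N t' 1 v)].
  apply/seteqP; split => v; first by move=> h; exact: (h 1%N).
  by move=> h i; rewrite /jrange => /andP[i1 i2]; rewrite (_ : i = 1%N)//; apply/eqP; rewrite eqn_leq i2.
have E0E : [set v | B 0%N (incr N tt 1 v)] = N D @^-1` B 0%N.
  by apply/seteqP; split => v; rewrite /incr /=; have [_ [_ [_ [-> _]]]] := CN.2 v; rewrite sube0.
have E1E : [set v | B 0%N (incr N (fun i => tt i + t j.-1) 1 v)] = [set v | incr N t j v = k%:R%:E].
  by rewrite /incr /= add0r /D subrK.
have shift : {ae P, forall w, fine (Q (X w) (N D @^-1` B 0%N)) = fine (Q (X w) [set v | incr N t j v = k%:R%:E])}.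
  have [hh0'|] := ltP 0 (t j.-1).
    apply: (ST 1%N tt (t j.-1) B _ _ itt hh0' mB).
      by rewrite capE E0E; exact: Q_version.
    by rewrite capE E1E; exact: Q_version.
  move=> hh0'; have hh : t j.-1 = 0 by apply/eqP; rewrite eq_le hh0 hh0'.
  by rewrite -E0E -E1E hh incr_addr0; exact: aeW.
apply: filterS3 shift (version_ae mE0 (LAW D D0 _ (mB 0%N))) (ae_pushforward X_gt0) => w <- <- Xw0.
by rewrite /B poisL_set1 /pois.
Qed.

(* The lower bound excludes the junk value [+oo - +oo = -oo] of an increment. *)
Lemma incr_intE t j (k : nat) : 0 <= t j -> 0 <= t j.-1 ->
  [set w | incr N t j w = k%:R%:E] =
  [set w | (incr N t j w <= (k%:~R : R)%:E)%E] `\` [set w | (incr N t j w <= ((k%:Z - 1)%:~R : R)%:E)%E].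
Proof.
move=> tj tj'; apply/seteqP; split => w /=.
  by move=> ->; rewrite !lee_fin; split => //; apply/negP; rewrite -ltNge intrB -pmulrn ltrBlDr ltrDl.
rewrite /incr; case: (N_natP CN w tj) => [[a ->]|->]; case: (N_natP CN w tj') => [[b ->]|->] /=.
- rewrite -EFinB !lee_fin => -[h1 /negP]; rewrite -ltNge => h2.
  have e : a%:R - b%:R = (a%:Z - b%:Z)%:~R :> R by rewrite intrB.
  rewrite e ler_int in h1; rewrite e ltr_int in h2.
  by rewrite e; have -> : a%:Z - b%:Z = k%:Z by lia.
- by move=> [_]; rewrite leNye.
- by move=> [].
- by move=> [_]; rewrite leNye.
Qed.

(** Conditional independence concerns the events {increment <= x}. At integer thresholds these form
    a countable family, and {increment = k} is a difference of two of them, hence one null set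
    serves all lists and all k. *)
Lemma MPP_product_rule m t : MPP P N X -> inc_times m t ->
  {ae P, forall w, forall s (k : nat -> nat), uniq s -> (forall i, i \in s -> jrange m i) ->
    product_rule (Q (X w)) s (fun i => [set v | incr N t i v = (k i)%:R%:E])}.
Proof.
move=> [_ [CI _]] it.
pose Ev (i : nat) (x : R) := [set v | (incr N t i v <= x%:E)%E].
have mEv i x : jrange m i -> measurable (Ev i x).
  by move=> im; exact: (measurable_incr_preimage0 it im (measurable_ele x%:E)).
pose xz (z : seq int) i : R := (nth 0 z i)%:~R.
have rule : {ae P, forall w, forall sz : seq nat * seq int, uniq sz.1 -> (forall i, i \in sz.1 -> jrange m i) ->
    product_rule (Q (X w)) sz.1 (fun i => Ev i (xz sz.2 i))}.
  apply: ae_forall_countable => -[s z] /=.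
  have [us|_] := boolP (uniq s); last exact: aeW.
  have [sI|] := pselect (forall i, i \in s -> jrange m i); last by move=> ns; apply: aeW.
  have mE : measurable (\bigcap_(i in [set i | i \in s]) Ev i (xz z i)).
    by apply: bigcap_seq_measurable => i si; exact: mEv (sI i si).
  have := CI m t it s (xz z) _ (fun i w => fine (Q (X w) (Ev i (xz z i)))) us sI (Q_version mE)
    (fun i si => Q_version (mEv _ _ (sI i si))).
  by apply: filterS => w h _ _; rewrite /product_rule -h fineK// fin_num_measure.
apply: filterS rule => w rule s k us sI.
apply: (@product_rule_sigma_indexed _ _ _ _ (jrange m) Ev (range (fun z : int => z%:~R))) => //.
- by exists 0%:~R, 0.
- by move=> _ _ [x _ <-] [y _ <-]; case: leP => _; [exists x|exists y].
- move=> i x y; apply/seteqP; split => v /=; rewrite /Ev /= EFin_min le_min; first by case=> -> ->.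
  by move=> /andP.
- move=> s' x us' sI' xr.
  have /choice[z Hz] : forall i, exists z : int, x i = z%:~R by move=> i; have [z _ <-] := xr i; exists z.
  apply: (@eq_product_rule _ _ _ _ _ (fun i => Ev i (xz (mkseq z (\max_(i <- s') i).+1) i))).
    by move=> i si; rewrite /xz nth_mkseq ?Hz// ltnS; exact: leq_bigmax_seq.
  exact: (rule (s', mkseq z (\max_(i <- s') i).+1)).
- move=> i si; have /andP[i1 im] := sI i si.
  rewrite (incr_intE _ (inc_times_ge0 it im) (inc_times_ge0 it (leq_trans (leq_pred i) im))).
  set G := [set Ev i x | x in range _].
  apply: (@measurableD _ (g_sigma_algebraType G)); apply: sub_sigma_algebra.
    by exists (k i)%:~R => //; exists (k i).
  by exists ((k i)%:Z - 1)%:~R => //; exists ((k i)%:Z - 1).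
Qed.

Lemma MPP_MPPU : MPP P N X -> MPPU P N PX.
Proof.
move=> HM m t kap it.
pose E := \bigcap_(j in jrange m) [set w | incr N t j w = (kap j)%:R%:E].
have mEj j : jrange m j -> measurable [set w | incr N t j w = (kap j)%:R%:E].
  by move=> jm; exact: (measurable_incr_preimage0 it jm (emeasurable_set1 (kap j)%:R%:E)).
have mE : measurable E by apply: bigcap_measurableType => j jm; exact: mEj.
pose G (y : R) := \prod_(1 <= j < m.+1) pois y (t j - t j.-1) (kap j).
have mG : measurable_fun setT G.
  by apply: measurable_prod => j _; exact: measurable_pois.
have QG : {ae PX, forall y, setT y -> fine (Q y E) = G y}.
  apply: (pushforward_ae_eq mX measurableT (measurable_Qfine mE) mG).
  have marg : {ae P, forall w, forall j, jrange m j ->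
      fine (Q (X w) [set v | incr N t j v = (kap j)%:R%:E]) = pois (X w) (t j - t j.-1) (kap j)}.
    apply: ae_foralln => j; have [jm|] := pselect (jrange m j); last by move=> nj; apply: aeW.
    by apply: filterS (MPP_marginal (kap j) HM it jm) => w.
  apply: filterS2 (MPP_product_rule HM it) marg => w rule mw.
  have := rule (iota 1 m) kap (iota_uniq _ _); rewrite /product_rule -bigcap_jrange => -> /=; last first.
    by move=> i; rewrite mem_iota add1n ltnS.
  rewrite /G /index_iota subSS subn0 !big_seq; apply: eq_bigr => i.
  by rewrite mem_iota add1n ltnS => im; exact: mw.
have mgt : measurable [set y : R | 0 < y].
  by rewrite (_ : mkset _ = `]0, +oo[%classic)//; apply/seteqP; split => y /=; rewrite in_itv/= andbT.
rewrite -/E -integral_Q// [RHS]integral_mkcond.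
apply: ge0_ae_eq_integral => //.
- by have [] := dis mE.
- apply/measurable_restrict => //; rewrite setTI; apply/measurable_EFinP; exact: measurable_funTS.
- move=> y _; rewrite /patch; case: ifPn => // /set_mem /= y0; rewrite lee_fin big_nat.
  apply: prodr_ge0 => j jm; apply: pois_ge0; first exact: ltW.
  by rewrite subr_ge0; have [_ [_ tS]] := it; case: j jm => // j /andP[_ jm]; apply/ltW/tS.
- apply: filterS2 QG X_gt0 => y h y0 _; rewrite /patch mem_set//.
  by rewrite -[LHS]fineK ?fin_num_measure// h.
Qed.

Definition Q_tail (y t : R) : R := fine (Q y (interW N 1 @^-1` `]t, +oo[%classic)).

Lemma measurable_Q_tail t : measurable_fun setT (Q_tail^~ t).
Proof.
by apply: measurable_Qfine; apply: preimage_measurable => //; exact: measurable_interW.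
Qed.

Lemma Q_tail_ge0 y t : 0 <= Q_tail y t.
Proof. exact: fine_ge0. Qed.

(** The right-hand side depends on the thresholds only through their sum, whatever their number,
    which makes mixed moments of the tails comparable. *)
Lemma MPPU_integral_tails r (a : nat -> R) : MPPU P N PX -> (forall i, 0 < a i) ->
  (\int[PX]_y (\prod_(i < r) Q_tail y (a i))%:E =
   \int[PX]_(y in [set y : R | (0 < y)%R]) (expR (- (y * \sum_(i < r) a i)))%:E)%E.
Proof.
move=> HU a0.
pose Xf : {mfun Om >-> R} := HB.pack_for {mfun Om >-> R} X (isMeasurableFun.Build _ _ _ _ X mX).
pose U : probability R R := distribution P Xf.
have := @mixed_waiting_times _ _ _ _ _ U CN HU X_gt0_prob r _ _ _ a (cylinder_nil N) a0.
rewrite setTI (resid0 CN) => h.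
have mE : measurable (tails (wait N) r a).
  by apply: measurable_tails => i; exact: measurable_interW.
transitivity (P (tails (wait N) r a)); last first.
  by rewrite h; apply: eq_integral => y _; rewrite mul1r.
rewrite -integral_Q//; apply: ge0_ae_eq_integral => //.
- by apply/measurable_EFinP; apply: measurable_prod => i _; exact: measurable_Q_tail.
- by have [] := dis mE.
- by move=> y _; rewrite lee_fin prodr_ge0// => i _; exact: Q_tail_ge0.
- apply: filterS2 Q_indep Q_smooth => y ind [L [LW _ _ _ _]] _.
  rewrite (indep_tails _ _ CN)//; congr EFin; apply: eq_bigr => i _.
  by rewrite /Q_tail /wait !LW.
Qed.

(* With [Y = Q_tail y q * Q_tail y r] and [Z = Q_tail y (q + r)], the means of Y^2, Y Z and Z^2
   are joint tail probabilities of W_1, ..., W_4, of W_1, W_2, W_3 and of W_1, W_2 at thresholds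
   with the same sum, hence equal; so Y - Z has mean square 0. *)
Lemma MPPU_Q_tail_mul (q r : R) : MPPU P N PX -> 0 < q -> 0 < r ->
  {ae PX, forall y, Q_tail y (q + r) = Q_tail y q * Q_tail y r}.
Proof.
move=> HU q0 r0; have qr0 := addr_gt0 q0 r0.
pose I (f : R -> R) := (\int[PX]_y (f y)%:E)%E.
pose c := (\int[PX]_(y in [set y : R | (0 < y)%R]) (expR (- (y * (q + r + (q + r)))))%:E)%E.
pose Y y := Q_tail y q * Q_tail y r; pose Z y := Q_tail y (q + r).
have Y0 y : 0 <= Y y by rewrite mulr_ge0 ?Q_tail_ge0.
have Z0 y : 0 <= Z y by exact: Q_tail_ge0.
have mZ : measurable_fun setT Z by exact: measurable_Q_tail.
have mY : measurable_fun setT Y by apply: measurable_funM; exact: measurable_Q_tail.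
have IE k (a : nat -> R) f : (forall i, 0 < a i) -> \sum_(i < k) a i = q + r + (q + r) ->
    (forall y, f y = \prod_(i < k) Q_tail y (a i)) -> I f = c.
  move=> a0 aE fE; rewrite /I /c -aE -MPPU_integral_tails//.
  by apply: eq_integral => y _; rewrite fE.
have IYY : I (fun y => Y y * Y y) = c.
  apply: (IE 4%N (fun i => if odd i then r else q)) => [i| |y]; first by case: ifP.
    by rewrite !big_ord_recl big_ord0/= addr0 -!addrA.
  by rewrite !big_ord_recl big_ord0/= mulr1 /Y -!mulrA.
have IYZ : I (fun y => Y y * Z y) = c.
  apply: (IE 3%N (fun i => if i == 2%N then q + r else if odd i then r else q)) => [i| |y].
  - by case: ifP => // _; case: ifP.
  - by rewrite !big_ord_recl big_ord0/= addr0 -!addrA.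
  - by rewrite !big_ord_recl big_ord0/= mulr1 /Y -!mulrA.
have IZZ : I (fun y => Z y * Z y) = c.
  apply: (IE 2%N (fun=> q + r)) => [i| |y] //.
    by rewrite !big_ord_recl big_ord0/= addr0.
  by rewrite !big_ord_recl big_ord0/= mulr1.
have c_fin : c \is a fin_num.
  rewrite -IZZ ge0_fin_numE; last by apply: integral_ge0 => y _; rewrite lee_fin mulr_ge0.
  apply: le_lt_trans (ltry 1%R); rewrite -(probability_setT P) -(integral_Q measurableT).
  apply: ge0_le_integral => //.
  - by move=> y _; rewrite lee_fin mulr_ge0.
  - by apply/measurable_EFinP; exact: measurable_funM.
  - by have [] := dis measurableT.
  - move=> y _; rewrite probability_setT lee_fin mulr_ile1//;
    by rewrite -lee_fin fineK ?fin_num_measure ?probability_le1//; apply: preimage_measurable => //; exact: measurable_interW.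
have mYZ2 : measurable_fun setT (fun y => (Y y - Z y) ^+ 2).
  by apply: measurable_funX; exact: measurable_funB.
have I0 : I (fun y => (Y y - Z y) ^+ 2) = 0%E.
  have ID (f g : R -> R) : measurable_fun setT f -> measurable_fun setT g -> (forall y, 0 <= f y) -> (forall y, 0 <= g y) ->
      I (fun y => f y + g y) = (I f + I g)%E.
    move=> mf mg f0 g0; rewrite /I -ge0_integralD//.
    - by move=> y _; rewrite lee_fin.
    - exact/measurable_EFinP.
    - by move=> y _; rewrite lee_fin.
    - exact/measurable_EFinP.
  have mYZ := measurable_funM mY mZ.
  (* The square is expanded with every term on the side where it is nonnegative, giving I ((Y -
     Z)^2) + 2 c = 2 c; finiteness of c allows cancellation. *)
  have h1 : I (fun y => (Y y - Z y) ^+ 2 + (Y y * Z y + Y y * Z y)) = (I (fun y => (Y y - Z y) ^+ 2)%R + (c + c))%E.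
    rewrite ID//; last 3 first.
    - exact: measurable_funD.
    - by move=> y; exact: sqr_ge0.
    - by move=> y; rewrite addr_ge0// mulr_ge0.
    by rewrite (ID (fun y => Y y * Z y) (fun y => Y y * Z y))// ?IYZ// => y; rewrite mulr_ge0.
  have h2 : I (fun y => Y y * Y y + Z y * Z y) = (c + c)%E.
    rewrite (ID (fun y => Y y * Y y) (fun y => Z y * Z y)) ?IYY ?IZZ//; try exact: measurable_funM.
      by move=> y; rewrite mulr_ge0.
    by move=> y; rewrite mulr_ge0.
  have : I (fun y => (Y y - Z y) ^+ 2 + (Y y * Z y + Y y * Z y)) = I (fun y => Y y * Y y + Z y * Z y).
    by congr I; apply/funext => y; ring.
  rewrite h1 h2 => h; have cc_fin : (c + c)%E \is a fin_num by rewrite fin_numD c_fin.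
  by rewrite -[LHS](addeK _ cc_fin) h subee.
have : ae_eq PX setT (fun y => ((Y y - Z y) ^+ 2)%:E) (cst 0%E).
  apply/ae_eq_integral_abs => //; first exact/measurable_EFinP.
  by rewrite -I0; apply: eq_integral => y _; rewrite /= ger0_norm ?sqr_ge0.
apply: filterS => y h; have /eqP : (Y y - Z y) ^+ 2 = 0 by case: (h Logic.I).
by rewrite sqrf_eq0 subr_eq0 => /eqP/esym.
Qed.

Lemma MPPU_exp_interarrivals : MPPU P N PX -> {ae PX, forall y, exp_interarrivals y}.
Proof.
move=> HU.
have mult : {ae PX, forall y, forall qr : rat * rat, 0 < ratr qr.1 :> R -> 0 < ratr qr.2 :> R ->
    Q_tail y (ratr qr.1 + ratr qr.2) = Q_tail y (ratr qr.1) * Q_tail y (ratr qr.2)}.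
  apply: ae_forall_countable => -[q r] /=.
  have [q0|_] := ltP 0 (ratr q : R); last exact: aeW.
  have [r0|_] := ltP 0 (ratr r : R); last exact: aeW.
  by apply: filterS (MPPU_Q_tail_mul HU q0 r0).
have sm : {ae PX, forall y, smooth_interarrivals y /\ 0 < y} by apply: filterS2 Q_smooth X_gt0.
apply: filterS3 mult sm Q_indep => y mult [[L [LW dF cF F0 Fy]] y0] ind; split => //.
have QL t : Q_tail y t = 1 - common_cdf L t by rewrite /Q_tail LW// common_cdf_tail.
have Lexp t : 0 < t -> 1 - common_cdf L t = expR (- (y * t)).
  by apply: (multiplicative_tail_expR dF cF F0 Fy) => q r q0 r0; rewrite -!QL; exact: (mult (q, r)).
move=> n n1 B mB; rewrite LW//; apply: (exponential_law_of_tail y0) => // t t0.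
by rewrite -Lexp// -common_cdf_tail fineK// fin_num_measure.
Qed.

End mixed_poisson_equivalence.

Theorem theorem2 (R : realType) (d : measure_display) (Om : measurableType d)
    (P : probability Om R) (Th : Om -> R) (D : set R) (h : R -> R)
    (N : R -> Om -> \bar R) (K : R -> probability R R)
    (Pf : R -> probability Om R) (Lh : set R) (ph : R -> R) (L0 : set R)
    (Thh : Om -> R) (Q : R -> probability Om R) :
  (* Theta: positive real random variable with Theta(Omega) in D, D Borel *)
  measurable_fun [set: Om] Th -> (forall w, 0 < Th w) ->
  measurable D -> (forall w, D (Th w)) ->
  (* h : D -> R Borel *)
  measurable_fun D h ->
  (* N counting process, P-eMRP(K(h(Theta))) *)
  CountingProcess N -> meas_param K -> eMRP P N K h Th ->
  (* {P_theta} disintegration of P over P_Theta consistent with Theta *)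
  disintegration P Pf (pushforward P Th) D ->
  consistent Pf (pushforward P Th) D Th ->
  (* Standing Assumption A with null set L_h and function p_h *)
  standingA P N Th D h Pf K Lh ph ->
  (* L_0 : P_Theta-null Borel subset of D, h injective on D \ L_0 *)
  measurable L0 -> L0 `<=` D -> pushforward P Th L0 = 0%E ->
  (forall a b, (D `\` L0) a -> (D `\` L0) b -> h a = h b -> a = b) ->
  (* hat Theta : measurable extension of p_h o Theta from Theta^-1(D \ O_h) *)
  measurable_fun [set: Om] Thh ->
  (forall w, (D `\` (L0 `|` Lh)) (Th w) -> Thh w = ph (Th w)) ->
  (* Q_y = P_{p_h^-1(y)} if y in p_h(D \ O_h), Q_y = P otherwise *)
  (forall (y : R) (A : set Om), measurable A ->
     (forall th, (D `\` (L0 `|` Lh)) th -> ph th = y -> Q y A = Pf th A) /\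
     ((forall th, (D `\` (L0 `|` Lh)) th -> ph th <> y) -> Q y A = P A)) ->
  (disintegration P Q (pushforward P Thh) setT /\
   consistent Q (pushforward P Thh) setT Thh) /\
  ((MPP P N Thh <-> MPPmix P N Q (pushforward P Thh)) /\
   (MPP P N Thh <-> {ae pushforward P Thh, forall y, PP (Q y) N y}) /\
   (MPP P N Thh <-> MPPU P N (pushforward P Thh))).
Proof.
move=> mTh Th_gt0 mD DTh mh CN mK [CI _] dis cons [LawK [mLh [_ [PLh [[C [_ smooth]] [ph_gt0 ph_inj]]]]]].
move=> mL0 _ PL0 _ mThh ThhE QE.
pose A := D `\` (L0 `|` Lh).
have ALh th : A th -> (D `\` Lh) th by move=> [Dth nL]; split => // Lth; apply: nL; right.
have mA : measurable A by apply: measurableD => //; exact: measurableU.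
have AD : A `<=` D by move=> th [].
have PA : {ae P, forall w, A (Th w)}.
  exists (Th @^-1` (L0 `|` Lh)); split.
  - by apply: (preimage_measurable mTh); exact: measurableU.
  - rewrite preimage_setU; transitivity (P (Th @^-1` L0)); last exact: PL0.
    by apply: measureU0 => //; exact: preimage_measurable.
  - by move=> w /= nA; apply: contrapT => nL; apply: nA.
(* Measurability of p_h is derived from that of h and of the family K, through difference quotients
   of the distribution functions. *)
have mph : measurable_fun A ph.
  apply: (@measurable_right_derivative_limit _ _ _ A (fun th => Fcdf K (h th))).
  - move=> t; have mt : measurable [set x : R | x <= t].
      rewrite (_ : mkset _ = `]-oo, t]%classic); first exact: measurable_itv.
      by apply/seteqP; split => x /=; rewrite in_itv.
    apply: (measurableT_comp (f := fine)); first exact: fine_measurable.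
    apply: (measurableT_comp (f := fun s => K s [set x | x <= t])); first exact: mK.
    exact: measurable_funS mh.
  - by move=> th Ath; have [] := smooth th (ALh th Ath).
  - by move=> th Ath; have [_ [_ [_ +]]] := smooth th (ALh th Ath).
have ph_injA a b : A a -> A b -> ph a = ph b -> a = b.
  by move=> /ALh Aa /ALh Ab; exact: ph_inj.
have disQ := reparametrized_disintegration mTh mD DTh dis mA AD PA mph ph_injA mThh ThhE QE.
have consQ := reparametrized_consistent mTh mD dis cons mA AD PA mph ph_injA mThh ThhE QE.
split=> //.
have X_gt0 : {ae push P mThh, forall y : R, 0 < y}.
  apply: (pushforward_ae mThh).
    rewrite (_ : (fun y : R => _) = `]0, +oo[%classic); first exact: measurable_itv.
    by apply/seteqP; split => y /=; rewrite in_itv/= andbT.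
  by apply: filterS PA => w Aw; rewrite /= ThhE//; apply: ph_gt0; exact: ALh.
have Q_indep := reparametrized_indep mTh mD DTh dis cons mA AD PA mph ph_injA mThh ThhE QE
  (measurable_interW CN) CI.
(* The range of ph on A carries all the mass and is Borel by the injective image theorem; there Q_y
   is P_theta with p_h(theta) = y. *)
have Q_smooth : {ae push P mThh, forall y, smooth_interarrivals N Q y}.
  have image_smooth y : (ph @` A) y -> smooth_interarrivals N Q y.
    move=> [th Ath <-]; have [d1 [d2 [d3 d4]]] := smooth th (ALh th Ath).
    have cdfE : common_cdf (K (h th)) = Fcdf K (h th) by [].
    exists (K (h th)); rewrite cdfE; split; [|exact: d1|exact: d2|by move=> t /d3 /andP[]|exact: d4].
    move=> n n1 B mB; rewrite ((QE (ph th) _ _).1 th)//; first by apply: LawK => //; exact: AD.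
    by apply: preimage_measurable => //; exact: measurable_interW.
  apply: (@filterS _ _ _ (ph @` A)) => //.
  apply: (pushforward_ae mThh); first exact: (image_ph_measurable mA mph ph_injA).
  by apply: filterS PA => w Aw; exists (Th w) => //; rewrite ThhE.
have exp_MPP : {ae push P mThh, forall y, exp_interarrivals N Q y} -> MPP P N Thh.
  by move=> /(exp_interarrivals_PP CN); exact: (PP_MPP CN disQ consQ X_gt0).
have MPPU_exp := MPPU_exp_interarrivals CN disQ X_gt0 Q_indep Q_smooth.
have MPP_U := MPP_MPPU CN disQ consQ X_gt0.
split; [split|split; split].
- by move=> /MPP_U /MPPU_exp; exact: (exp_interarrivals_MPPmix CN disQ Q_indep).
- by move=> /(MPPmix_exp_interarrivals X_gt0 Q_smooth); exact: exp_MPP.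
- by move=> /MPP_U /MPPU_exp; exact: (exp_interarrivals_PP CN).
- exact: (PP_MPP CN disQ consQ X_gt0).
- exact: MPP_U.
- by move=> /MPPU_exp; exact: exp_MPP.
Qed.
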